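(* Let $a_1,a_2,a_3$ be three non-zero complex constants and $c=(c_1,c_2)\in\mathbb{C}^2\setminus\{0\}$. Suppose $(f_1,f_2)$ is a pair of transcendental entire functions on $\mathbb{C}^2$ with finite order satisfying, for all $z\in\mathbb{C}^2$, the system $$\begin{cases} a_1^2f_1(z)^2+(a_2f_2(z+c)+a_3f_2(z))^2=1,\\ a_1^2f_2(z)^2+(a_2f_1(z+c)+a_3f_1(z))^2=1.\end{cases}$$ Then there exist $\alpha_1,\alpha_2,A,k\in\mathbb{C}$ and a polynomial $\Phi$ in one variable over $\mathbb{C}$ such that, with $L(z)=\alpha_1z_1+\alpha_2z_2$ (so $L(c)=\alpha_1c_1+\alpha_2c_2$) and $t:=c_2z_1-c_1z_2$, the pair $(f_1,f_2)$ takes one of the following forms. (I) $$(f_1(z),f_2(z))=\left(\frac{1}{a_1}\cos(L(z)+\Phi(t)+A),\ \frac{1}{a_1}\cos(L(z)+\Phi(t)+A+k)\right),$$ where $a_2^2=a_1^2+a_3^2$, $e^{2ik}=1$ and $e^{2iL(c)}=-\dfrac{a_1-ia_3e^{-ik}}{a_1+ia_3e^{ik}}$. (II) $$(f_1(z),f_2(z))=\left(\frac{1}{a_1}\cos(-(L(z)+\Phi(t)+A)+k),\ \frac{1}{a_1}\cos(L(z)+\Phi(t)+A)\right),$$ where one of the following conditions is satisfied: (a) $e^{iL(c)}=1$, $e^{ik}\in\{i,-i\}$ and $a_1\in\{a_2+a_3,\,-(a_2+a_3)\}$; (b) $e^{iL(c)}=-1$, $e^{ik}\in\{i,-i\}$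 and $a_1\in\{a_2-a_3,\,-(a_2-a_3)\}$. (III) $$(f_1(z),f_2(z))=\left(\frac{1}{a_1}\cos(-(L(z)+\Phi(t)+A)+L(c)+k),\ \frac{1}{a_1}\cos(L(z)+\Phi(t)+A)\right),$$ where one of the following conditions is satisfied: (a) $e^{iL(c)}=1$, $e^{ik}\in\{i,-i\}$ and $a_1\in\{a_2+a_3,\,-(a_2+a_3)\}$; (b) $e^{iL(c)}=-1$, $e^{ik}\in\{i,-i\}$ and $a_1\in\{a_2-a_3,\,-(a_2-a_3)\}$.
   Context: Here $z=(z_1,z_2)\in\mathbb{C}^2$, $z+c=(z_1+c_1,z_2+c_2)$, and $i$ is the imaginary unit. An entire function on $\mathbb{C}^2$ is transcendental if it is not a polynomial. A pair $(f_1,f_2)$ of transcendental entire functions with finite order means that each of $f_1$ and $f_2$ is a transcendental entire function on $\mathbb{C}^2$ of finite order; the order of an entire function $f$ is $\limsup_{r\to\infty}\frac{\log^+ T(r,f)}{\log r}$ with $T(r,f)$ the Nevanlinna characteristic (equivalently $\limsup_{r\to\infty}\frac{\log^+\log^+ M(r,f)}{\log r}$ with $M(r,f)=\max_{\|z\|\le r}|f(z)|$). *)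

(* Defs.v *)
From Stdlib Require Import Reals.
From Coquelicot Require Import Coquelicot.

Local Open Scope C_scope.

(** [C * C] as a normed space over the field [C]: [ex_filterdiff] over this
    structure asks for a [C]-linear differential. *)
Definition C2_NormedModule : NormedModule C_AbsRing :=
  prod_NormedModule C_AbsRing C_NormedModule C_NormedModule.

Definition entire (f : C * C -> C) : Prop :=
  forall z : C2_NormedModule,
    @ex_filterdiff C_AbsRing C2_NormedModule C_NormedModule f (locally z).

Definition polynomial1 (P : C -> C) : Prop :=
  exists (d : nat) (a : nat -> C),
    forall t : C, P t = sum_n (fun j => a j * t ^ j) d.

Definition polynomial2 (f : C * C -> C) : Prop :=
  exists (d : nat) (a : nat -> nat -> C),
    forall z1 z2 : C,
      f (z1, z2) = sum_n (fun j => sum_n (fun k => a j k * z1 ^ j * z2 ^ k) d) d.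

Definition transcendental_entire (f : C * C -> C) : Prop :=
  entire f /\ ~ polynomial2 f.

Definition C2norm (z : C * C) : R :=
  sqrt (Cmod (fst z) ^ 2 + Cmod (snd z) ^ 2)%R.

(** [M(r, f)]. The coercion from [Rbar] to [R] loses nothing for [r >= 0] and
    continuous [f]: the closed ball is compact, so the supremum is a maximum. *)
Definition max_modulus (f : C * C -> C) (r : R) : R :=
  real (Lub_Rbar (fun m => exists z, (C2norm z <= r)%R /\ m = Cmod (f z))).

(** [log^+ x = log (max 1 x)]; in particular [log^+ 0 = 0]. *)
Definition lnp (x : R) : R := ln (Rmax 1 x).

Definition limsup_infty (g : R -> R) : Rbar :=
  Rbar_glb (fun s => exists r0 : R,
    s = Lub_Rbar (fun y => exists r : R, (r0 < r)%R /\ y = g r)).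

Definition order (f : C * C -> C) : Rbar :=
  limsup_infty (fun r => lnp (lnp (max_modulus f r)) / ln r)%R.

Definition finite_order (f : C * C -> C) : Prop := is_finite (order f).

Definition Cexp (z : C) : C :=
  (exp (Re z) * cos (Im z), exp (Re z) * sin (Im z))%R.

Definition Ccos (z : C) : C := (Cexp (Ci * z) + Cexp (- (Ci * z))) / 2.

Definition shift (c z : C * C) : C * C := (fst z + fst c, snd z + snd c).

(* Main.v *)
Require Import Defs.
From Stdlib Require Import Reals Lra Lia Psatz ClassicalEpsilon List.
From Coquelicot Require Import Coquelicot.

(** Each equation has the form [X^2 + Y^2 = 1], that is
    [(X + i Y) (X - i Y) = 1], so [u = X + i Y] is an entire function without
    zeros and [X = (u + 1/u) / 2], [Y = (u - 1/u) / (2 i)].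

    A nonvanishing function on C^2 has a continuous logarithm [P]
    ([continuous_log_exists]).  Finite order bounds [|u|] by the exponential of
    a power of [|z|], so on each complex line the real part of [P] has
    polynomial growth.  An entire function of one variable with this property
    is a polynomial ([entire_polynomial]); the proof is by Laurent coefficients
    on circles, whose independence of the radius is Goursat's theorem for
    rectangles in the coordinate [log z].  Hence [P] is polynomial on every
    line ([log_line_poly]), which suffices since every later step restricts to
    a line.

    Now [a1 f1 = cosh P1] and [a1 f2 = cosh P2], and the system becomes two
    vanishing linear combinations of the exponentials of [+- P1 z], [+- P2 z]
    and [+- P2 (z + c)], respectively with the indices exchanged.  By Borel's
    lemma ([borel_2]) such a relation forces constant differences between the
    exponents.  As a nonconstant [P2] cannot satisfy [P2 (z + c) = - P2 z + k],
    the only possibility is [P2 (z + c) = P2 z + m] together with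
    [P1 = P2 + k] or [P1 = - P2 + k] ([exponents_related]).  Comparing
    coefficients gives the relations between [a1], [a2], [a3], [exp m] and
    [exp k]: the first sign leads to form (I), the second to form (II).
    Finally [P2 (z + c) = P2 z + m] makes [P2] affine along [c], so it is a
    linear form plus a polynomial in [t] ([shift_affine]). *)

Local Open Scope C_scope.

(** * Continuity and complex differentiability *)

Lemma C_ext (z w : C) : Re z = Re w -> Im z = Im w -> z = w.
Proof. destruct z, w; unfold Re, Im; simpl; intros -> ->; reflexivity. Qed.

Lemma RtoC_neq0 (x : R) : x <> 0%R -> RtoC x <> 0.
Proof. intros H E; apply H; now apply (f_equal fst) in E. Qed.

Lemma Cmod_le_abs (z : C) : (Cmod z <= Rabs (Re z) + Rabs (Im z))%R.
Proof.
  destruct z as [x y]; unfold Re, Im; simpl.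
  replace (x, y) with (RtoC x + Ci * RtoC y) by
    (apply C_ext; unfold Re, Im; simpl; ring).
  eapply Rle_trans; [apply Cmod_triangle|].
  rewrite Cmod_mult, Cmod_Ci, !Cmod_R; lra.
Qed.

Lemma Re_le_Cmod (z : C) : (Rabs (Re z) <= Cmod z)%R.
Proof. apply re_le_Cmod. Qed.

Lemma Im_le_Cmod (z : C) : (Rabs (Im z) <= Cmod z)%R.
Proof.
  eapply Rle_trans; [apply Rmax_r|]; apply Rmax_Cmod.
Qed.

Section Continuity.
Context {T : UniformSpace}.
Implicit Types (f g : T -> C) (x : T).

Lemma continuous_C_components f x :
  continuous (fun t => Re (f t)) x -> continuous (fun t => Im (f t)) x ->
  continuous f x.
Proof.
  intros Hr Hi P [eps HP].
  destruct (Hr (ball (Re (f x)) eps)) as [d1 H1]; [now exists eps|].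
  destruct (Hi (ball (Im (f x)) eps)) as [d2 H2]; [now exists eps|].
  assert (Hd : (0 < Rmin d1 d2)%R) by (apply Rmin_glb_lt; apply cond_pos).
  exists (mkposreal _ Hd); intros y Hy; apply HP; split.
  - apply (H1 y). eapply ball_le; [|exact Hy]. apply Rmin_l.
  - apply (H2 y). eapply ball_le; [|exact Hy]. apply Rmin_r.
Qed.

Lemma continuous_Re_comp f x : continuous f x -> continuous (fun t => Re (f t)) x.
Proof. intros H; apply (continuous_comp f (fun z : C => fst z)); [exact H|]; apply continuous_fst. Qed.

Lemma continuous_Im_comp f x : continuous f x -> continuous (fun t => Im (f t)) x.
Proof. intros H; apply (continuous_comp f (fun z : C => snd z)); [exact H|]; apply continuous_snd. Qed.

Lemma continuous_Cconst (c : C) x : continuous (fun _ : T => c) x.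
Proof. apply continuous_const. Qed.

Lemma continuous_Cplus f g x :
  continuous f x -> continuous g x -> continuous (fun t => f t + g t) x.
Proof.
  intros Hf Hg; apply continuous_C_components; simpl;
  [apply (continuous_plus (fun t => Re (f t)) (fun t => Re (g t)))
  |apply (continuous_plus (fun t => Im (f t)) (fun t => Im (g t)))];
  auto using continuous_Re_comp, continuous_Im_comp.
Qed.

Lemma continuous_Copp f x : continuous f x -> continuous (fun t => - f t) x.
Proof.
  intros Hf; apply continuous_C_components; simpl;
  [apply (continuous_opp (fun t => Re (f t)))
  |apply (continuous_opp (fun t => Im (f t)))];
  auto using continuous_Re_comp, continuous_Im_comp.
Qed.

Lemma continuous_Cminus f g x :
  continuous f x -> continuous g x -> continuous (fun t => f t - g t) x.
Proof. intros; apply continuous_Cplus; [|apply continuous_Copp]; assumption. Qed.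

Lemma continuous_Cmult f g x :
  continuous f x -> continuous g x -> continuous (fun t => f t * g t) x.
Proof.
  intros Hf Hg; apply continuous_C_components.
  - apply (continuous_minus (fun t => Re (f t) * Re (g t))%R (fun t => Im (f t) * Im (g t))%R);
    apply (@continuous_mult T R_AbsRing);
    auto using continuous_Re_comp, continuous_Im_comp.
  - apply (continuous_plus (fun t => Re (f t) * Im (g t))%R (fun t => Im (f t) * Re (g t))%R);
    apply (@continuous_mult T R_AbsRing);
    auto using continuous_Re_comp, continuous_Im_comp.
Qed.

Lemma continuous_Cinv f x :
  continuous f x -> f x <> 0 -> continuous (fun t => / f t) x.
Proof.
  intros Hf H0.
  pose proof (continuous_Re_comp _ _ Hf) as Hr.
  pose proof (continuous_Im_comp _ _ Hf) as Hi.
  assert (Hn : continuous (fun t => / (Re (f t) * Re (f t) + Im (f t) * Im (f t)))%R x).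
  { apply (continuous_comp (fun t => Re (f t) * Re (f t) + Im (f t) * Im (f t))%R Rinv); [|apply continuous_Rinv].
    - apply (continuous_plus (fun t => Re (f t) * Re (f t))%R (fun t => Im (f t) * Im (f t))%R);
      apply (@continuous_mult T R_AbsRing); assumption.
    - intros E; apply H0; apply C_ext; unfold Re, Im in *; simpl in *; nra. }
  apply continuous_C_components.
  - apply (continuous_ext (fun t => Re (f t) * / (Re (f t) * Re (f t) + Im (f t) * Im (f t)))%R).
    { intros t; unfold Re, Im, Cinv; simpl; now rewrite !Rmult_1_r. }
    apply (@continuous_mult T R_AbsRing); assumption.
  - apply (continuous_ext (fun t => (- Im (f t)) * / (Re (f t) * Re (f t) + Im (f t) * Im (f t)))%R).
    { intros t; unfold Re, Im, Cinv; simpl; now rewrite !Rmult_1_r. }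
    apply (@continuous_mult T R_AbsRing); [|assumption].
    now apply (continuous_opp (fun t => Im (f t))).
Qed.

Lemma continuous_Cdiv f g x :
  continuous f x -> continuous g x -> g x <> 0 -> continuous (fun t => f t / g t) x.
Proof. intros; apply continuous_Cmult; [assumption|]; now apply continuous_Cinv. Qed.

Lemma continuous_Cpow f n x : continuous f x -> continuous (fun t => f t ^ n) x.
Proof.
  intros Hf; induction n as [|n IH]; simpl.
  - apply continuous_Cconst.
  - now apply continuous_Cmult.
Qed.

(** The target carries the sup-norm balls of a product space; this is the
    same continuity measured with [Cmod]. *)
Lemma continuous_to_C f x :
  continuous f x <->
  forall eps : R, (0 < eps)%R -> exists d : posreal,
    forall y, ball x d y -> (Cmod (f y - f x) < eps)%R.
Proof.
  split.
  - intros H eps Heps.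
    assert (He : (0 < eps / 2)%R) by lra.
    destruct (H (ball (f x) (eps / 2))) as [d Hd].
    { exists (mkposreal _ He); auto. }
    exists d; intros y Hy; destruct (Hd y Hy) as [H1 H2].
    eapply Rle_lt_trans; [apply Cmod_le_abs|].
    unfold ball in H1, H2; simpl in H1, H2; unfold AbsRing_ball in H1, H2; simpl in H1, H2.
    change (Rabs (Re (f y) - Re (f x)) < eps / 2)%R in H1.
    change (Rabs (Im (f y) - Im (f x)) < eps / 2)%R in H2.
    change (Rabs (Re (f y) - Re (f x)) + Rabs (Im (f y) - Im (f x)) < eps)%R. lra.
  - intros H P [eps HP].
    destruct (H eps (cond_pos eps)) as [d Hd].
    exists d; intros y Hy; apply HP.
    apply C_NormedModule_mixin_compat1; exact (Hd y Hy).
Qed.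

End Continuity.

Lemma ball_C_intro (z w : C) (d : posreal) : (Cmod (w - z) < d)%R -> ball (z : C_UniformSpace) d w.
Proof. apply C_NormedModule_mixin_compat1. Qed.

Lemma ball_C_elim (z w : C) (d : posreal) : ball (z : C_UniformSpace) d w -> (Cmod (w - z) < 2 * d)%R.
Proof.
  intros [H1 H2].
  eapply Rle_lt_trans; [apply Cmod_le_abs|].
  change (Rabs (Re w - Re z) < d)%R in H1.
  change (Rabs (Im w - Im z) < d)%R in H2.
  change (Rabs (Re w - Re z) + Rabs (Im w - Im z) < 2 * d)%R. lra.
Qed.

Lemma continuous_C_C (f : C -> C) (z : C) :
  continuous (f : C_UniformSpace -> C_UniformSpace) z <->
  forall eps : R, (0 < eps)%R -> exists d : R, (0 < d)%R /\
    forall y, (Cmod (y - z) < d)%R -> (Cmod (f y - f z) < eps)%R.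
Proof.
  rewrite continuous_to_C; split; intros H eps Heps; destruct (H eps Heps) as [d Hd].
  - exists d; split; [apply cond_pos|]. intros y Hy; apply Hd; now apply ball_C_intro.
  - destruct Hd as [Hd0 Hd].
    assert (Hd2 : (0 < d / 2)%R) by lra.
    exists (mkposreal _ Hd2); intros y Hy; apply Hd.
    apply ball_C_elim in Hy; simpl in Hy; lra.
Qed.

(** Carathéodory's form of the complex derivative: the difference quotient
    extends continuously to [z].  Algebraic rules become identities between
    quotients, and the extension removes the singularity of the quotient. *)
Definition der (f : C -> C) (z l : C) : Prop :=
  exists phi : C -> C, continuous (phi : C_UniformSpace -> C_UniformSpace) z /\
    phi z = l /\ forall y, f y = f z + (y - z) * phi y.

Definition cdiff (f : C -> C) (z : C) : Prop := exists l, der f z l.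

Lemma der_continuous f z l : der f z l -> continuous (f : C_UniformSpace -> C_UniformSpace) z.
Proof.
  intros (phi & Hc & _ & He).
  apply (continuous_ext (fun y : C_UniformSpace => f z + (y - z) * phi y)).
  { intros y; symmetry; apply He. }
  apply continuous_Cplus; [apply continuous_Cconst|].
  apply continuous_Cmult; [|exact Hc].
  apply continuous_Cminus; [apply continuous_id|apply continuous_Cconst].
Qed.

Lemma cdiff_continuous f z : cdiff f z -> continuous (f : C_UniformSpace -> C_UniformSpace) z.
Proof. intros [l H]; exact (der_continuous f z l H). Qed.

Lemma der_intro (f : C -> C) (z l : C) :
  (forall eps : R, (0 < eps)%R -> exists d : R, (0 < d)%R /\ forall y, (Cmod (y - z) < d)%R ->
     (Cmod (f y - f z - l * (y - z)) <= eps * Cmod (y - z))%R) -> der f z l.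
Proof.
  intros H.
  exists (fun y => if Ceq_dec y z then l else (f y - f z) / (y - z)); split; [|split].
  - apply continuous_C_C; intros eps Heps.
    destruct (H (eps / 2)%R) as (d & Hd & Hy); [lra|].
    exists d; split; [exact Hd|]; intros y Hyz.
    destruct (Ceq_dec z z) as [_|n]; [|now elim n].
    destruct (Ceq_dec y z) as [->|n].
    + unfold Cminus; rewrite Cplus_opp_r, Cmod_0; lra.
    + assert (Hn : y - z <> 0) by now apply Cminus_eq_contra.
      assert (Hp : (0 < Cmod (y - z))%R) by now apply Cmod_gt_0.
      replace ((f y - f z) / (y - z) - l) with ((f y - f z - l * (y - z)) / (y - z))
        by (field; exact Hn).
      rewrite Cmod_div by exact Hn.
      apply Rle_lt_trans with (eps / 2)%R; [|lra].
      apply Rle_div_l; [lra|]. now apply Hy.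
  - destruct (Ceq_dec z z) as [_|n]; [reflexivity|now elim n].
  - intros y; destruct (Ceq_dec y z) as [->|n].
    + ring.
    + field; now apply Cminus_eq_contra.
Qed.

Lemma cdiff_elim (f : C -> C) (z : C) : cdiff f z ->
  exists l, forall eps : R, (0 < eps)%R -> exists d : R, (0 < d)%R /\ forall y, (Cmod (y - z) < d)%R ->
     (Cmod (f y - f z - l * (y - z)) <= eps * Cmod (y - z))%R.
Proof.
  intros (l & phi & Hc & <- & He); exists (phi z); intros eps Heps.
  destruct (proj1 (continuous_C_C phi z) Hc eps Heps) as (d & Hd & Hy).
  exists d; split; [exact Hd|]; intros y Hyz.
  rewrite (He y).
  replace (f z + (y - z) * phi y - f z - phi z * (y - z)) with ((phi y - phi z) * (y - z)) by ring.
  rewrite Cmod_mult. apply Rmult_le_compat_r; [apply Cmod_ge_0|].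
  left; now apply Hy.
Qed.

Lemma cdiff_ext_loc (f g : C -> C) (z : C) (d : R) : (0 < d)%R ->
  (forall y, (Cmod (y - z) < d)%R -> f y = g y) -> cdiff f z -> cdiff g z.
Proof.
  intros Hd Hfg Hf; destruct (cdiff_elim _ _ Hf) as [l Hl].
  exists l; apply der_intro; intros eps Heps.
  destruct (Hl eps Heps) as (d' & Hd' & H).
  exists (Rmin d d'); split; [now apply Rmin_glb_lt|]; intros y Hy.
  rewrite <- (Hfg y), <- (Hfg z).
  - apply H; eapply Rlt_le_trans; [exact Hy|apply Rmin_r].
  - unfold Cminus; rewrite Cplus_opp_r, Cmod_0; exact Hd.
  - eapply Rlt_le_trans; [exact Hy|apply Rmin_l].
Qed.

Lemma cdiff_ext (f g : C -> C) (z : C) : (forall y, f y = g y) -> cdiff f z -> cdiff g z.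
Proof. intros H; apply cdiff_ext_loc with 1%R; [lra|auto]. Qed.

Lemma der_ext f g z l : (forall x, f x = g x) -> der f z l -> der g z l.
Proof. intros E (p & Hp & Hl & Ep); exists p; repeat split; try assumption. intros y; rewrite <- !E; apply Ep. Qed.

Lemma der_const c z : der (fun _ => c) z 0.
Proof. exists (fun _ => 0); repeat split; [apply continuous_Cconst|intros; ring]. Qed.

Lemma der_id z : der (fun x => x) z 1.
Proof. exists (fun _ => 1); repeat split; [apply continuous_Cconst|intros; ring]. Qed.

Lemma der_plus f g z l m : der f z l -> der g z m -> der (fun x => f x + g x) z (l + m).
Proof.
  intros (p & Hp & <- & Ep) (q & Hq & <- & Eq).
  exists (fun y => p y + q y); split; [now apply continuous_Cplus|split; [reflexivity|]].
  intros y; rewrite (Ep y), (Eq y); ring.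
Qed.

Lemma der_mult f g z l m : der f z l -> der g z m -> der (fun x => f x * g x) z (l * g z + f z * m).
Proof.
  intros (p & Hp & <- & Ep) Hg. pose proof (der_continuous _ _ _ Hg) as Hgc.
  destruct Hg as (q & Hq & <- & Eq).
  exists (fun y => p y * g y + f z * q y); split; [|split; [reflexivity|]].
  - apply continuous_Cplus; apply continuous_Cmult; auto using continuous_Cconst.
  - intros y; rewrite (Ep y), (Eq y); ring.
Qed.

Lemma der_comp f g z l m : der f (g z) l -> der g z m -> der (fun y => f (g y)) z (m * l).
Proof.
  intros (p & Hp & <- & Ep) Hg. pose proof (der_continuous _ _ _ Hg) as Hgc.
  destruct Hg as (q & Hq & <- & Eq).
  exists (fun y => q y * p (g y)); split; [|split; [reflexivity|]].
  - apply continuous_Cmult; [exact Hq|].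
    now apply (continuous_comp (g : C_UniformSpace -> C_UniformSpace) p).
  - intros y. rewrite (Ep (g y)). rewrite (Eq y) at 1. ring.
Qed.

Lemma cdiff_const (c z : C) : cdiff (fun _ => c) z.
Proof. eexists; apply der_const. Qed.

Lemma cdiff_id (z : C) : cdiff (fun y => y) z.
Proof. eexists; apply der_id. Qed.

Lemma cdiff_plus f g z : cdiff f z -> cdiff g z -> cdiff (fun y => f y + g y) z.
Proof. intros [l Hl] [m Hm]; eexists; now apply der_plus; [apply Hl|apply Hm]. Qed.

Lemma cdiff_mult f g z : cdiff f z -> cdiff g z -> cdiff (fun y => f y * g y) z.
Proof. intros [l Hl] [m Hm]; eexists; now apply der_mult; [apply Hl|apply Hm]. Qed.

Lemma cdiff_comp f g z : cdiff f (g z) -> cdiff g z -> cdiff (fun y => f (g y)) z.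
Proof. intros [l Hl] [m Hm]; eexists; now apply der_comp; [apply Hl|apply Hm]. Qed.

Lemma cdiff_opp f z : cdiff f z -> cdiff (fun y => - f y) z.
Proof.
  intros H; apply (cdiff_ext (fun y => - (1) * f y)); [intros; ring|].
  apply cdiff_mult; [apply cdiff_const|exact H].
Qed.

Lemma cdiff_minus f g z : cdiff f z -> cdiff g z -> cdiff (fun y => f y - g y) z.
Proof. intros; apply cdiff_plus; [|apply cdiff_opp]; assumption. Qed.

Lemma cdiff_pow f n z : cdiff f z -> cdiff (fun y => f y ^ n) z.
Proof.
  intros H; induction n as [|n IH]; simpl; [apply cdiff_const|now apply cdiff_mult].
Qed.

Lemma cdiff_inv f z : cdiff f z -> f z <> 0 -> cdiff (fun y => / f y) z.
Proof.
  intros Hf H0; apply (cdiff_comp Cinv f); [|exact Hf].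
  (* The quotient of the inverse at [f z] is only -1/(f z * y) where [y <> 0]. *)
  set (w := f z) in *.
  assert (Hw : (0 < Cmod w)%R) by now apply Cmod_gt_0.
  apply cdiff_ext_loc with (f := fun y => / w + (y - w) * - (/ (w * (if Ceq_dec y 0 then w else y)))) (d := Cmod w).
  - exact Hw.
  - intros y Hy. destruct (Ceq_dec y 0) as [->|n].
    + exfalso. replace (0 - w) with (- w) in Hy by ring. rewrite Cmod_opp in Hy; lra.
    + field; split; assumption.
  - eexists; exists (fun y => - (/ (w * (if Ceq_dec y 0 then w else y)))); split; [|split; [reflexivity|]].
    + apply continuous_Copp. apply continuous_Cinv.
      * apply continuous_Cmult; [apply continuous_Cconst|].
        apply continuous_C_C; intros eps Heps. exists (Rmin (Cmod w) eps).
        split; [now apply Rmin_glb_lt|]; intros y Hy.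
        destruct (Ceq_dec w 0) as [?|_]; [contradiction|].
        destruct (Ceq_dec y 0) as [->|n].
        -- exfalso. replace (0 - w) with (- w) in Hy by ring. rewrite Cmod_opp in Hy.
           pose proof (Rmin_l (Cmod w) eps); lra.
        -- eapply Rlt_le_trans; [exact Hy|apply Rmin_r].
      * destruct (Ceq_dec w 0) as [?|_]; [contradiction|now apply Cmult_neq_0].
    + intros y; destruct (Ceq_dec w 0) as [?|_]; [contradiction|]. ring.
Qed.

Lemma cdiff_div f g z : cdiff f z -> cdiff g z -> g z <> 0 -> cdiff (fun y => f y / g y) z.
Proof. intros; apply cdiff_mult; [assumption|now apply cdiff_inv]. Qed.

(** * The exponential *)

Lemma Cexp_plus (z w : C) : Cexp (z + w) = Cexp z * Cexp w.
Proof.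
  destruct z as [x y], w as [x' y']; unfold Cexp, Re, Im; simpl.
  rewrite exp_plus, cos_plus, sin_plus.
  apply C_ext; unfold Re, Im; simpl; ring.
Qed.

Lemma Cexp_0 : Cexp 0 = 1.
Proof. unfold Cexp; simpl; rewrite exp_0, cos_0, sin_0; apply C_ext; unfold Re, Im; simpl; ring. Qed.

Lemma Cmod_Cexp (z : C) : Cmod (Cexp z) = exp (Re z).
Proof.
  unfold Cmod, Cexp; simpl.
  replace (exp (Re z) * cos (Im z) * (exp (Re z) * cos (Im z) * 1) + exp (Re z) * sin (Im z) * (exp (Re z) * sin (Im z) * 1))%R
    with (Rsqr (exp (Re z)) * (Rsqr (sin (Im z)) + Rsqr (cos (Im z))))%R by (unfold Rsqr; ring).
  rewrite sin2_cos2, Rmult_1_r, sqrt_Rsqr; [reflexivity|left; apply exp_pos].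
Qed.

Lemma Cexp_neq_0 (z : C) : Cexp z <> 0.
Proof. apply Cmod_gt_0; rewrite Cmod_Cexp; apply exp_pos. Qed.

Lemma Cexp_opp (z : C) : Cexp (- z) = / Cexp z.
Proof.
  pose proof (Cexp_neq_0 z) as H.
  assert (E : Cexp (- z) * Cexp z = 1).
  { rewrite <- Cexp_plus. replace (- z + z) with (RtoC 0) by ring. apply Cexp_0. }
  replace (Cexp (- z)) with (Cexp (- z) * Cexp z * / Cexp z) by (field; exact H).
  rewrite E; ring.
Qed.

Lemma Cexp_minus (z w : C) : Cexp (z - w) = Cexp z / Cexp w.
Proof. unfold Cminus; rewrite Cexp_plus, Cexp_opp; reflexivity. Qed.

Lemma Cexp_periodic (x y : R) : Cexp (x, y + 2 * PI)%R = Cexp (x, y).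
Proof. unfold Cexp; simpl; now (rewrite sin_plus, cos_plus, cos_2PI, sin_2PI, !Rmult_0_r, !Rmult_1_r, Rplus_0_r, Rminus_0_r). Qed.

Lemma real_linear_approx (f : R -> R) (l : R) : derivable_pt_lim f 0 l ->
  forall eps : R, (0 < eps)%R -> exists d : R, (0 < d)%R /\ forall h : R, (Rabs h < d)%R ->
    (Rabs (f h - f 0 - l * h) <= eps * Rabs h)%R.
Proof.
  intros H eps Heps; destruct (H eps Heps) as [d Hd].
  exists d; split; [apply cond_pos|]; intros h Hh.
  destruct (Req_dec h 0) as [->|Hn].
  - replace (f 0 - f 0 - l * 0)%R with 0%R by ring. rewrite Rabs_R0; lra.
  - replace (f h - f 0 - l * h)%R with (((f (0 + h) - f 0) / h - l) * h)%R
      by (rewrite Rplus_0_l; field; exact Hn).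
    rewrite Rabs_mult; apply Rmult_le_compat_r; [apply Rabs_pos|left; now apply Hd].
Qed.

Lemma Cexp_approx_0 : forall eps : R, (0 < eps)%R -> exists d : R, (0 < d)%R /\ forall z, (Cmod z < d)%R ->
     (Cmod (Cexp z - 1 - z) <= eps * Cmod z)%R.
Proof.
  intros eps Heps.
  set (e := Rmin 1 (eps / 20)).
  assert (He : (0 < e)%R) by (apply Rmin_glb_lt; lra).
  assert (He1 : (e <= 1)%R) by apply Rmin_l.
  assert (He2 : (e <= eps / 20)%R) by apply Rmin_r.
  destruct (real_linear_approx exp 1) with (eps := e) as (d1 & Hd1 & H1); [apply derivable_pt_lim_exp_0|exact He|].
  destruct (real_linear_approx cos 0) with (eps := e) as (d2 & Hd2 & H2).
  { generalize (derivable_pt_lim_cos 0); now rewrite sin_0, Ropp_0. } { exact He. }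
  destruct (real_linear_approx sin 1) with (eps := e) as (d3 & Hd3 & H3).
  { generalize (derivable_pt_lim_sin 0); now rewrite cos_0. } { exact He. }
  exists (Rmin e (Rmin d1 (Rmin d2 d3))); split.
  { repeat apply Rmin_glb_lt; assumption || lra. }
  intros [x y] Hz.
  pose proof (Re_le_Cmod (x, y)) as Hx; pose proof (Im_le_Cmod (x, y)) as Hy.
  unfold Re, Im in Hx, Hy; simpl in Hx, Hy.
  set (m := Cmod (x, y)) in *.
  assert (Hm : (m < e /\ m < d1 /\ m < d2 /\ m < d3)%R).
  { pose proof (Rmin_l e (Rmin d1 (Rmin d2 d3))); pose proof (Rmin_r e (Rmin d1 (Rmin d2 d3))).
    pose proof (Rmin_l d1 (Rmin d2 d3)); pose proof (Rmin_r d1 (Rmin d2 d3)).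
    pose proof (Rmin_l d2 d3); pose proof (Rmin_r d2 d3). lra. }
  specialize (H1 x); specialize (H2 y); specialize (H3 y).
  rewrite exp_0 in H1; rewrite cos_0 in H2; rewrite sin_0 in H3.
  assert (A1 : (Rabs (exp x - 1 - x) <= e * m)%R).
  { eapply Rle_trans; [|apply Rmult_le_compat_l; [lra|exact Hx]].
    replace (exp x - 1 - x)%R with (exp x - 1 - 1 * x)%R by ring. apply H1; lra. }
  assert (A2 : (Rabs (cos y - 1) <= e * m)%R).
  { eapply Rle_trans; [|apply Rmult_le_compat_l; [lra|exact Hy]].
    replace (cos y - 1)%R with (cos y - 1 - 0 * y)%R by ring. apply H2; lra. }
  assert (A3 : (Rabs (sin y - y) <= e * m)%R).
  { eapply Rle_trans; [|apply Rmult_le_compat_l; [lra|exact Hy]].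
    replace (sin y - y)%R with (sin y - 0 - 1 * y)%R by ring. apply H3; lra. }
  assert (Hm0 : (0 <= m)%R) by apply Cmod_ge_0.
  assert (A4 : (Rabs (exp x - 1) <= 2 * m)%R).
  { replace (exp x - 1)%R with ((exp x - 1 - x) + x)%R by ring.
    eapply Rle_trans; [apply Rabs_triang|]. nra. }
  assert (A5 : (0 < exp x <= 3)%R).
  { split; [apply exp_pos|]. apply Rabs_le_between in A4. lra. }
  eapply Rle_trans; [apply Cmod_le_abs|].
  unfold Cexp, Re, Im; simpl.
  replace (exp x * cos y + - (1) + - x)%R with ((exp x - 1 - x) + exp x * (cos y - 1))%R by ring.
  replace (exp x * sin y + - 0 + - y)%R with (exp x * (sin y - y) + (exp x - 1) * y)%R by ring.
  eapply Rle_trans; [apply Rplus_le_compat; apply Rabs_triang|].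
  rewrite !Rabs_mult, (Rabs_right (exp x)) by lra.
  assert (B1 : (exp x * Rabs (cos y - 1) <= 3 * (e * m))%R).
  { apply Rmult_le_compat; try lra; apply Rabs_pos. }
  assert (B2 : (exp x * Rabs (sin y - y) <= 3 * (e * m))%R).
  { apply Rmult_le_compat; try lra; apply Rabs_pos. }
  assert (B3 : (Rabs (exp x - 1) * Rabs y <= 2 * m * m)%R).
  { apply Rmult_le_compat; try lra; apply Rabs_pos. }
  nra.
Qed.

Lemma der_Cexp_id (z : C) : der Cexp z (Cexp z).
Proof.
  apply der_intro; intros eps Heps.
  pose proof (exp_pos (Re z)) as Hp.
  destruct (Cexp_approx_0 (eps / exp (Re z))) as (d & Hd & H).
  { now apply Rdiv_lt_0_compat. }
  exists d; split; [exact Hd|]; intros y Hy.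
  replace y with (z + (y - z)) at 1 by ring.
  rewrite Cexp_plus.
  replace (Cexp z * Cexp (y - z) - Cexp z - Cexp z * (y - z)) with
    (Cexp z * (Cexp (y - z) - 1 - (y - z))) by ring.
  rewrite Cmod_mult, Cmod_Cexp.
  specialize (H _ Hy).
  apply (Rmult_le_compat_l (exp (Re z))) in H; [|lra].
  eapply Rle_trans; [exact H|]. right; field. lra.
Qed.

Lemma cdiff_Cexp (z : C) : cdiff Cexp z.
Proof. eexists; apply der_Cexp_id. Qed.

Lemma der_Cexp f z l : der f z l -> der (fun x => Cexp (f x)) z (l * Cexp (f z)).
Proof. intros Hf; exact (der_comp Cexp f z _ l (der_Cexp_id (f z)) Hf). Qed.

(** * Integrals of complex functions of a real variable *)

Definition contR (f : R -> C) : Prop := forall t : R, continuous (f : R_UniformSpace -> C_UniformSpace) t.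
Definition contC (f : C -> C) : Prop := forall z : C, continuous (f : C_UniformSpace -> C_UniformSpace) z.

(** Componentwise, so that the algebra reduces to real integrals. *)
Definition CInt (f : R -> C) (a b : R) : C :=
  (RInt (fun t => Re (f t)) a b, RInt (fun t => Im (f t)) a b).

Lemma ex_RInt_Re f a b : contR f -> ex_RInt (fun t => Re (f t)) a b.
Proof. intros H; apply (@ex_RInt_continuous R_CompleteNormedModule); intros t _; apply continuous_Re_comp, H. Qed.

Lemma ex_RInt_Im f a b : contR f -> ex_RInt (fun t => Im (f t)) a b.
Proof. intros H; apply (@ex_RInt_continuous R_CompleteNormedModule); intros t _; apply continuous_Im_comp, H. Qed.

Lemma CInt_ext f g a b : (forall t, f t = g t) -> CInt f a b = CInt g a b.
Proof. intros H; unfold CInt; f_equal; apply RInt_ext; intros t _; now rewrite H. Qed.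

Lemma CInt_plus f g a b : contR f -> contR g ->
  CInt (fun t => f t + g t) a b = CInt f a b + CInt g a b.
Proof.
  intros Hf Hg; apply C_ext; unfold CInt; simpl;
  [apply (@RInt_plus R_CompleteNormedModule (fun t => Re (f t)) (fun t => Re (g t)))
  |apply (@RInt_plus R_CompleteNormedModule (fun t => Im (f t)) (fun t => Im (g t)))];
  auto using ex_RInt_Re, ex_RInt_Im.
Qed.

Lemma CInt_scal (c : C) f a b : contR f -> CInt (fun t => c * f t) a b = c * CInt f a b.
Proof.
  intros Hf.
  assert (S : forall (l m : R) (u v : R -> R), ex_RInt u a b -> ex_RInt v a b ->
     RInt (fun t => l * u t + m * v t)%R a b = (l * RInt u a b + m * RInt v a b)%R).
  { intros l m u v Hu Hv.
    rewrite (@RInt_plus R_CompleteNormedModule (fun t => l * u t)%R (fun t => m * v t)%R);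
    [|apply (@ex_RInt_scal R_NormedModule u a b l Hu)|apply (@ex_RInt_scal R_NormedModule v a b m Hv)].
    exact (f_equal2 Rplus (@RInt_scal R_CompleteNormedModule u a b l Hu)
             (@RInt_scal R_CompleteNormedModule v a b m Hv)). }
  pose proof (ex_RInt_Re f a b Hf) as H1; pose proof (ex_RInt_Im f a b Hf) as H2.
  apply C_ext; unfold CInt; simpl.
  - rewrite (RInt_ext _ (fun t => Re c * Re (f t) + (- Im c) * Im (f t))%R).
    + rewrite (S _ _ _ _ H1 H2). unfold Re, Im; simpl; ring.
    + intros t _; unfold Re, Im; simpl; ring.
  - rewrite (RInt_ext _ (fun t => Im c * Re (f t) + Re c * Im (f t))%R).
    + rewrite (S _ _ _ _ H1 H2). unfold Re, Im; simpl; ring.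
    + intros t _; unfold Re, Im; simpl; ring.
Qed.

Lemma CInt_minus f g a b : contR f -> contR g ->
  CInt (fun t => f t - g t) a b = CInt f a b - CInt g a b.
Proof.
  intros Hf Hg.
  rewrite (CInt_ext _ (fun t => f t + (- (1)) * g t)); [|intros; ring].
  rewrite CInt_plus, CInt_scal; [ring|exact Hg|exact Hf|].
  intros t; apply continuous_Cmult; [apply continuous_Cconst|apply Hg].
Qed.

Lemma CInt_const (c : C) a b : CInt (fun _ => c) a b = RtoC (b - a) * c.
Proof.
  apply C_ext; unfold CInt; simpl;
  rewrite RInt_const; unfold scal; simpl; unfold mult; simpl; unfold Re, Im; ring.
Qed.

Lemma CInt_Chasles f a b c : contR f -> CInt f a b + CInt f b c = CInt f a c.
Proof.
  intros Hf; apply C_ext; unfold CInt; simpl;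
  [apply (@RInt_Chasles R_CompleteNormedModule (fun t => Re (f t)))
  |apply (@RInt_Chasles R_CompleteNormedModule (fun t => Im (f t)))];
  auto using ex_RInt_Re, ex_RInt_Im.
Qed.

Lemma CInt_conj f a b : contR f -> CInt (fun t => Cconj (f t)) a b = Cconj (CInt f a b).
Proof.
  intros Hf; apply C_ext; unfold CInt; simpl; [reflexivity|].
  apply (@RInt_opp R_CompleteNormedModule (fun t => Im (f t))); now apply ex_RInt_Im.
Qed.

(** The triangle inequality for integrals does not follow from the components;
    it comes from the normed-space structure. *)
Lemma CInt_le f (g : R -> R) a b lg : contR f -> (a <= b)%R ->
  (forall t, (a <= t <= b)%R -> (Cmod (f t) <= g t)%R) -> is_RInt g a b lg ->
  (Cmod (CInt f a b) <= lg)%R.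
Proof.
  intros Hf Hab HM Hg.
  assert (N : forall z : C, @norm _ C_R_NormedModule z = Cmod z).
  { intros z; unfold norm; simpl; unfold prod_norm, Cmod, norm; simpl. unfold abs; simpl.
    now rewrite !Rmult_1_r, <- !Rabs_mult, !Rabs_right by (apply Rle_ge, Rle_0_sqr). }
  rewrite <- N.
  apply (@norm_RInt_le C_R_NormedModule f g a b); try assumption.
  - intros t Ht; rewrite N; now apply HM.
  - apply (@is_RInt_fct_extend_pair R_NormedModule R_NormedModule);
    apply (@RInt_correct R_CompleteNormedModule); [now apply ex_RInt_Re|now apply ex_RInt_Im].
Qed.

Lemma CInt_bound f a b M : contR f -> (a <= b)%R ->
  (forall t, (a <= t <= b)%R -> (Cmod (f t) <= M)%R) ->
  (Cmod (CInt f a b) <= (b - a) * M)%R.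
Proof.
  intros Hf Hab HM. apply CInt_le with (g := fun _ => M); try assumption.
  apply (@is_RInt_const R_NormedModule).
Qed.

(** * Goursat's theorem for rectangles *)

(** The integral of [K z dz] along the positively oriented boundary of
    [[a, b] x [c, d]]. *)
Definition bdry (K : C -> C) (a b c d : R) : C :=
  CInt (fun t => K (t, c)) a b - CInt (fun t => K (t, d)) a b
  + Ci * (CInt (fun t => K (b, t)) c d - CInt (fun t => K (a, t)) c d).

Lemma contR_horizontal K y : contC K -> contR (fun t => K (t, y)).
Proof.
  intros HK t; apply (continuous_comp (fun t : R_UniformSpace => (t, y) : C_UniformSpace) K); [|apply HK].
  apply continuous_C_components; simpl; [apply continuous_id|apply continuous_const].
Qed.

Lemma contR_vertical K x : contC K -> contR (fun t => K (x, t)).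
Proof.
  intros HK t; apply (continuous_comp (fun t : R_UniformSpace => (x, t) : C_UniformSpace) K); [|apply HK].
  apply continuous_C_components; simpl; [apply continuous_const|apply continuous_id].
Qed.

Lemma bdry_split_x K a m b c d : contC K ->
  bdry K a b c d = bdry K a m c d + bdry K m b c d.
Proof.
  intros HK; unfold bdry.
  rewrite <- (CInt_Chasles (fun t => K (t, c)) a m b), <- (CInt_Chasles (fun t => K (t, d)) a m b)
    by now apply contR_horizontal.
  ring.
Qed.

Lemma bdry_split_y K a b c m d : contC K ->
  bdry K a b c d = bdry K a b c m + bdry K a b m d.
Proof.
  intros HK; unfold bdry.
  rewrite <- (CInt_Chasles (fun t => K (b, t)) c m d), <- (CInt_Chasles (fun t => K (a, t)) c m d)
    by now apply contR_vertical.
  ring.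
Qed.

Lemma CInt_affine (p q : C) a b :
  CInt (fun t => p + RtoC t * q) a b = RtoC (b - a) * p + RtoC ((b * b - a * a) / 2) * q.
Proof.
  assert (S : forall u v : R, RInt (fun t => u + t * v)%R a b = ((b - a) * u + (b * b - a * a) / 2 * v)%R).
  { intros u v; apply is_RInt_unique.
    replace ((b - a) * u + (b * b - a * a) / 2 * v)%R with
      (minus (b * u + b * b / 2 * v) (a * u + a * a / 2 * v))%R
      by (unfold minus, plus, opp; simpl; field).
    apply (@is_RInt_derive R_CompleteNormedModule (fun t => t * u + t * t / 2 * v)%R).
    - intros t _; auto_derive; [exact I|field].
    - intros t _; apply (@ex_derive_continuous R_AbsRing R_NormedModule).
      auto_derive; exact I. }
  apply C_ext; unfold CInt; simpl.
  - rewrite (RInt_ext _ (fun t => Re p + t * Re q)%R); [rewrite S; unfold Re, Im; simpl; ring|].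
    intros t _; unfold Re, Im; simpl; ring.
  - rewrite (RInt_ext _ (fun t => Im p + t * Im q)%R); [rewrite S; unfold Re, Im; simpl; ring|].
    intros t _; unfold Re, Im; simpl; ring.
Qed.

Lemma RtoC_pair (x y : R) : ((x, y) : C) = RtoC x + Ci * RtoC y.
Proof. apply C_ext; unfold Re, Im; simpl; ring. Qed.

(** An affine function has a quadratic primitive. *)
Lemma bdry_affine (p q : C) a b c d : bdry (fun z => p + q * z) a b c d = 0.
Proof.
  unfold bdry.
  rewrite (CInt_ext (fun t => p + q * (t, c)) (fun t => (p + q * (Ci * RtoC c)) + RtoC t * q));
    [|intros t; rewrite (RtoC_pair t c); ring].
  rewrite (CInt_ext (fun t => p + q * (t, d)) (fun t => (p + q * (Ci * RtoC d)) + RtoC t * q));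
    [|intros t; rewrite (RtoC_pair t d); ring].
  rewrite (CInt_ext (fun t => p + q * (b, t)) (fun t => (p + q * RtoC b) + RtoC t * (q * Ci)));
    [|intros t; rewrite (RtoC_pair b t); ring].
  rewrite (CInt_ext (fun t => p + q * (a, t)) (fun t => (p + q * RtoC a) + RtoC t * (q * Ci)));
    [|intros t; rewrite (RtoC_pair a t); ring].
  rewrite !CInt_affine. rewrite !RtoC_minus. ring.
Qed.

Lemma bdry_minus K G a b c d : contC K -> contC G ->
  bdry (fun z => K z - G z) a b c d = bdry K a b c d - bdry G a b c d.
Proof.
  intros HK HG; unfold bdry.
  rewrite (CInt_minus (fun t => K (t, c)) (fun t => G (t, c))),
    (CInt_minus (fun t => K (t, d)) (fun t => G (t, d))),
    (CInt_minus (fun t => K (b, t)) (fun t => G (b, t))),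
    (CInt_minus (fun t => K (a, t)) (fun t => G (a, t)))
    by (auto using contR_horizontal, contR_vertical).
  ring.
Qed.

Lemma bdry_bound K a b c d M : contC K -> (a <= b)%R -> (c <= d)%R ->
  (forall x y, (a <= x <= b)%R -> (c <= y <= d)%R -> (Cmod (K (x, y)) <= M)%R) ->
  (Cmod (bdry K a b c d) <= 2 * ((b - a) + (d - c)) * M)%R.
Proof.
  intros HK Hab Hcd HM; unfold bdry.
  assert (H1 := CInt_bound (fun t => K (t, c)) a b M (contR_horizontal K c HK) Hab ltac:(intros; apply HM; lra)).
  assert (H2 := CInt_bound (fun t => K (t, d)) a b M (contR_horizontal K d HK) Hab ltac:(intros; apply HM; lra)).
  assert (H3 := CInt_bound (fun t => K (b, t)) c d M (contR_vertical K b HK) Hcd ltac:(intros; apply HM; lra)).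
  assert (H4 := CInt_bound (fun t => K (a, t)) c d M (contR_vertical K a HK) Hcd ltac:(intros; apply HM; lra)).
  unfold Cminus.
  eapply Rle_trans; [apply Cmod_triangle|].
  rewrite Cmod_mult, Cmod_Ci, Rmult_1_l.
  eapply Rle_trans; [apply Rplus_le_compat; apply Cmod_triangle|].
  rewrite !Cmod_opp. lra.
Qed.

(** Subtracting the affine part of [K] at [p] does not change the integral, and
    what remains is at most [eps] times the diameter on a boundary of the same
    order: the bound is quadratic in the size of the rectangle. *)
Lemma bdry_local_bound K a b c d (p l : C) (eps : R) : contC K -> (a <= b)%R -> (c <= d)%R -> (0 <= eps)%R ->
  (a <= Re p <= b)%R -> (c <= Im p <= d)%R ->
  (forall x y, (a <= x <= b)%R -> (c <= y <= d)%R ->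
     (Cmod (K (x, y) - K p - l * ((x, y) - p)) <= eps * Cmod ((x, y) - p)%C)%R) ->
  (Cmod (bdry K a b c d) <= 2 * eps * (((b - a) + (d - c)) * ((b - a) + (d - c))))%R.
Proof.
  intros HK Hab Hcd He Hp1 Hp2 HM.
  assert (HG : contC (fun z => (K p - l * p) + l * z)).
  { intros z; apply continuous_Cplus; [apply continuous_Cconst|].
    apply continuous_Cmult; [apply continuous_Cconst|apply continuous_id]. }
  replace (bdry K a b c d) with (bdry (fun z => K z - ((K p - l * p) + l * z)) a b c d)
    by (rewrite (bdry_minus K (fun z => (K p - l * p) + l * z)), bdry_affine by assumption; ring).
  eapply Rle_trans; [apply bdry_bound with (M := (eps * ((b - a) + (d - c)))%R)|right; ring];
  try assumption.
  - intros z; apply continuous_Cminus; [apply HK|apply HG].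
  - intros x y Hx Hy.
    replace (K (x, y) - (K p - l * p + l * (x, y))) with (K (x, y) - K p - l * ((x, y) - p)) by ring.
    eapply Rle_trans; [now apply HM|].
    apply Rmult_le_compat_l; [exact He|].
    eapply Rle_trans; [apply Cmod_le_abs|].
    apply Rplus_le_compat; apply Rabs_le; unfold Re, Im in *; simpl; lra.
Qed.

(** One step of the bisection: a quarter of the rectangle carries a quarter
    of the boundary integral. *)
Lemma bdry_quarter K a c w h M : contC K -> (0 < w)%R -> (0 < h)%R ->
  (M < Cmod (bdry K a (a + w) c (c + h)))%R ->
  exists a' c', ((a' = a \/ a' = a + w / 2) /\ (c' = c \/ c' = c + h / 2) /\
   M / 4 < Cmod (bdry K a' (a' + w / 2) c' (c' + h / 2)))%R.
Proof.
  intros HK Hw Hh HM.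
  apply NNPP; intros Hno.
  assert (Hq : forall a' c', (a' = a \/ a' = a + w / 2)%R -> (c' = c \/ c' = c + h / 2)%R ->
    (Cmod (bdry K a' (a' + w / 2) c' (c' + h / 2)) <= M / 4)%R).
  { intros a' c' Ha Hc; apply Rnot_lt_le; intros Hl; apply Hno; eauto. }
  rewrite (bdry_split_x K a (a + w / 2)), !(bdry_split_y K _ _ c (c + h / 2) (c + h)) in HM by assumption.
  assert (H1 := Hq a c ltac:(auto) ltac:(auto)).
  assert (H2 := Hq a (c + h / 2)%R ltac:(auto) ltac:(auto)).
  assert (H3 := Hq (a + w / 2)%R c ltac:(auto) ltac:(auto)).
  assert (H4 := Hq (a + w / 2)%R (c + h / 2)%R ltac:(auto) ltac:(auto)).
  replace (a + w / 2 + w / 2)%R with (a + w)%R in * by field.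
  replace (c + h / 2 + h / 2)%R with (c + h)%R in * by field.
  assert (T := fun x y : C => Cmod_triangle x y).
  pose proof (T (bdry K a (a + w / 2) c (c + h / 2) + bdry K a (a + w / 2) (c + h / 2) (c + h))%C
    (bdry K (a + w / 2) (a + w) c (c + h / 2) + bdry K (a + w / 2) (a + w) (c + h / 2) (c + h))%C).
  pose proof (T (bdry K a (a + w / 2) c (c + h / 2)) (bdry K a (a + w / 2) (c + h / 2) (c + h))).
  pose proof (T (bdry K (a + w / 2) (a + w) c (c + h / 2)) (bdry K (a + w / 2) (a + w) (c + h / 2) (c + h))).
  lra.
Qed.

Lemma nested_limit (x : nat -> R) (w : R) : (0 < w)%R ->
  (forall n, x n <= x (S n) /\ x (S n) + w / 2 ^ S n <= x n + w / 2 ^ n)%R ->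
  exists l, forall n, (x n <= l <= x n + w / 2 ^ n)%R.
Proof.
  intros Hw Hx.
  assert (Hmono : forall n k, (x n <= x (n + k)%nat /\ x (n + k)%nat + w / 2 ^ (n + k) <= x n + w / 2 ^ n)%R).
  { intros n k; induction k as [|k IH]; [rewrite Nat.add_0_r; lra|].
    rewrite Nat.add_succ_r. specialize (Hx (n + k)%nat). lra. }
  assert (Hpos : forall n, (0 < w / 2 ^ n)%R) by (intros; apply Rdiv_lt_0_compat; [lra|apply pow_lt; lra]).
  destruct (completeness (fun y => exists n, y = x n)) as [l [Hub Hlub]].
  - exists (x 0%nat + w)%R; intros y [n ->].
    destruct (Hmono 0%nat n) as [_ H]; simpl in H. specialize (Hpos n). lra.
  - now exists (x 0%nat), 0%nat.
  - exists l; intros n; split; [apply Hub; now exists n|].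
    apply Hlub; intros y [m ->].
    destruct (Nat.le_ge_cases n m) as [H|H].
    + destruct (Hmono n (m - n)%nat) as [_ Hm].
      replace (n + (m - n))%nat with m in Hm by lia. specialize (Hpos m). lra.
    + destruct (Hmono m (n - m)%nat) as [Hm _].
      replace (m + (n - m))%nat with n in Hm by lia. specialize (Hpos n). lra.
Qed.

(** A nonzero integral survives repeated quartering in proportion [1 / 4^n],
    while at the limit point of the nested rectangles differentiability makes
    it [o (1 / 4^n)]. *)
Theorem goursat K a b c d : contC K -> (a < b)%R -> (c < d)%R ->
  (forall x y, (a <= x <= b)%R -> (c <= y <= d)%R -> cdiff K (x, y)) ->
  bdry K a b c d = 0.
Proof.
  intros HK Hab Hcd HD.
  apply NNPP; intros Hne; apply Cmod_gt_0 in Hne.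
  set (w := (b - a)%R); set (h := (d - c)%R).
  assert (Hw : (0 < w)%R) by (unfold w; lra). assert (Hh : (0 < h)%R) by (unfold h; lra).
  assert (Hpw : forall (u : R) n, (0 < u -> 0 < u / 2 ^ n)%R) by
    (intros; apply Rdiv_lt_0_compat; [lra|apply pow_lt; lra]).
  set (M := (Cmod (bdry K a b c d) / 2)%R).
  set (good := fun (n : nat) (p : R * R) => (M / 4 ^ n < Cmod (bdry K (fst p) (fst p + w / 2 ^ n) (snd p) (snd p + h / 2 ^ n)))%R).
  assert (Hstep : forall (q : nat * (R * R)), exists p',
     good (fst q) (snd q) -> good (S (fst q)) p' /\
       (fst p' = fst (snd q) \/ fst p' = fst (snd q) + w / 2 ^ fst q / 2)%R /\
       (snd p' = snd (snd q) \/ snd p' = snd (snd q) + h / 2 ^ fst q / 2)%R).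
  { intros [n [x y]]; simpl.
    destruct (classic (good n (x, y))) as [G|G]; [|exists (x, y); tauto].
    destruct (bdry_quarter K x y (w / 2 ^ n) (h / 2 ^ n) (M / 4 ^ n)) as (a' & c' & Ha & Hc & HM); auto.
    exists (a', c'); intros _; split; [|simpl; split; assumption].
    unfold good; simpl.
    replace (w / (2 * 2 ^ n))%R with (w / 2 ^ n / 2)%R by (field; apply pow_nonzero; lra).
    replace (h / (2 * 2 ^ n))%R with (h / 2 ^ n / 2)%R by (field; apply pow_nonzero; lra).
    replace (M / (4 * 4 ^ n))%R with (M / 4 ^ n / 4)%R by (field; apply pow_nonzero; lra).
    exact HM. }
  set (next := fun q => proj1_sig (constructive_indefinite_description _ (Hstep q))).
  assert (Hnext : forall q, good (fst q) (snd q) -> good (S (fst q)) (next q) /\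
       (fst (next q) = fst (snd q) \/ fst (next q) = fst (snd q) + w / 2 ^ fst q / 2)%R /\
       (snd (next q) = snd (snd q) \/ snd (next q) = snd (snd q) + h / 2 ^ fst q / 2)%R).
  { intros q; unfold next; destruct constructive_indefinite_description as [p Hp]; exact Hp. }
  set (s := fix s n := match n with O => (a, c) | S m => next (m, s m) end).
  assert (Hgood : forall n, good n (s n)).
  { induction n as [|n IH].
    - unfold good; simpl. rewrite !Rdiv_1_r.
      replace (a + w)%R with b by (unfold w; ring). replace (c + h)%R with d by (unfold h; ring).
      unfold M; lra.
    - exact (proj1 (Hnext (n, s n) IH)). }
  destruct (nested_limit (fun n => fst (s n)) w Hw) as [px Hpx].
  { intros n; destruct (Hnext (n, s n) (Hgood n)) as (_ & H & _); simpl in H |- *.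
    pose proof (Hpw w n Hw).
    replace (w / (2 * 2 ^ n))%R with (w / 2 ^ n / 2)%R by (field; apply pow_nonzero; lra).
    destruct H as [-> | ->]; lra. }
  destruct (nested_limit (fun n => snd (s n)) h Hh) as [py Hpy].
  { intros n; destruct (Hnext (n, s n) (Hgood n)) as (_ & _ & H); simpl in H |- *.
    pose proof (Hpw h n Hh).
    replace (h / (2 * 2 ^ n))%R with (h / 2 ^ n / 2)%R by (field; apply pow_nonzero; lra).
    destruct H as [-> | ->]; lra. }
  assert (HD0 : cdiff K (px, py)).
  { apply HD; [specialize (Hpx O)|specialize (Hpy O)]; simpl in *; unfold w, h in *; lra. }
  destruct (cdiff_elim _ _ HD0) as [l Hl].
  set (e := (M / (4 * ((w + h) * (w + h))))%R).
  assert (HM : (0 < M)%R) by (unfold M; lra).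
  assert (He : (0 < e)%R) by (unfold e; apply Rdiv_lt_0_compat; [lra|nra]).
  destruct (Hl e He) as (del & Hdel & Hy).
  destruct (pow_lt_1_zero (/ 2)) with (y := (del / (w + h))%R) as [N HN].
  { rewrite Rabs_right; lra. } { apply Rdiv_lt_0_compat; lra. }
  specialize (HN N (le_n N)). rewrite Rabs_right in HN by (apply Rle_ge, pow_le; lra).
  rewrite pow_inv in HN.
  assert (H2N : (0 < 2 ^ N)%R) by (apply pow_lt; lra).
  assert (Hsmall : ((w + h) / 2 ^ N < del)%R).
  { apply (Rmult_lt_compat_r (w + h)) in HN; [|lra].
    replace (del / (w + h) * (w + h))%R with del in HN by (field; lra).
    unfold Rdiv; lra. }
  pose proof (Hgood N) as G; unfold good in G.
  pose proof (Hpw w N Hw) as Hw'; pose proof (Hpw h N Hh) as Hh'.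
  pose proof (Hpx N) as HpxN; pose proof (Hpy N) as HpyN.
  assert (B := bdry_local_bound K (fst (s N)) (fst (s N) + w / 2 ^ N) (snd (s N)) (snd (s N) + h / 2 ^ N)
     (px, py) l e HK ltac:(lra) ltac:(lra) ltac:(lra) HpxN HpyN).
  apply (Rlt_irrefl (M / 4 ^ N)).
  eapply Rlt_le_trans; [exact G|]. eapply Rle_trans; [apply B|].
  - intros x y Hx Hy'; apply Hy.
    eapply Rle_lt_trans; [apply Cmod_le_abs|]. eapply Rle_lt_trans; [|exact Hsmall].
    replace ((w + h) / 2 ^ N)%R with (w / 2 ^ N + h / 2 ^ N)%R by (field; lra).
    apply Rplus_le_compat; apply Rabs_le; unfold Re, Im; simpl; lra.
  - replace (4 ^ N)%R with (2 ^ N * 2 ^ N)%R by (rewrite <- Rpow_mult_distr; f_equal; ring).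
    unfold e.
    replace (fst (s N) + w / 2 ^ N - fst (s N) + (snd (s N) + h / 2 ^ N - snd (s N)))%R with ((w + h) / 2 ^ N)%R by (field; lra).
    assert (Z : (2 * (M / (4 * ((w + h) * (w + h)))) * ((w + h) / 2 ^ N * ((w + h) / 2 ^ N)) = M / (2 ^ N * 2 ^ N) / 2)%R).
    { field; split; [lra|]. lra. }
    rewrite Z.
    assert (0 < M / (2 ^ N * 2 ^ N))%R by (apply Rdiv_lt_0_compat; nra). lra.
Qed.

(** * Laurent coefficients on circles about the origin *)

(** The integral of [F z / z^n] in [d arg z] over the circle of radius [exp x].
    In the coordinate [s = x + i y], [z = exp s], circles are vertical segments
    and annuli are rectangles with periodic integrands, so that Goursat's
    theorem for rectangles suffices. *)
Definition laurent (n : nat) (F : C -> C) (x : R) : C :=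
  CInt (fun y => F (Cexp (x, y)) / Cexp (x, y) ^ n) 0 (2 * PI).

Lemma contC_laurent n F : contC F -> contC (fun s => F (Cexp s) / Cexp s ^ n).
Proof.
  intros HF s.
  assert (He : continuous (Cexp : C_UniformSpace -> C_UniformSpace) s)
    by apply cdiff_continuous, cdiff_Cexp.
  apply continuous_Cdiv.
  - apply (continuous_comp (Cexp : C_UniformSpace -> C_UniformSpace) F); [exact He|apply HF].
  - now apply continuous_Cpow.
  - apply Cpow_nz, Cexp_neq_0.
Qed.

Lemma contR_laurent n F x : contC F -> contR (fun y => F (Cexp (x, y)) / Cexp (x, y) ^ n).
Proof. intros HF; apply (contR_vertical _ x (contC_laurent n F HF)). Qed.

Lemma contR_circle F x : contC F -> contR (fun y => F (Cexp (x, y))).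
Proof.
  intros HF; apply (contR_vertical (fun s => F (Cexp s)) x).
  intros s; apply (continuous_comp (Cexp : C_UniformSpace -> C_UniformSpace) F); [|apply HF].
  apply cdiff_continuous, cdiff_Cexp.
Qed.

Lemma exp_le_compat (x y : R) : (x <= y)%R -> (exp x <= exp y)%R.
Proof. intros [H| ->]; [left; now apply exp_increasing|apply Rle_refl]. Qed.

Lemma laurent_annulus n F x0 x1 : contC F -> (x0 < x1)%R ->
  (forall z, (exp x0 <= Cmod z <= exp x1)%R -> cdiff F z) ->
  laurent n F x0 = laurent n F x1.
Proof.
  intros HF Hx HD.
  pose proof PI_RGT_0 as Hpi.
  assert (G := goursat (fun s => F (Cexp s) / Cexp s ^ n) x0 x1 0 (2 * PI)
     (contC_laurent n F HF) Hx ltac:(lra)).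
  assert (G' : bdry (fun s => F (Cexp s) / Cexp s ^ n) x0 x1 0 (2 * PI) = 0).
  { apply G; intros x y Hxx _. apply cdiff_div.
    - apply cdiff_comp; [|apply cdiff_Cexp]. apply HD.
      rewrite Cmod_Cexp; unfold Re; simpl.
      split; apply exp_le_compat; lra.
    - apply cdiff_pow, cdiff_Cexp.
    - apply Cpow_nz, Cexp_neq_0. }
  unfold bdry in G'.
  (* The exponential has period 2 i PI, so the two horizontal sides cancel. *)
  rewrite (CInt_ext (fun t => F (Cexp (t, (2 * PI)%R)) / Cexp (t, (2 * PI)%R) ^ n)
     (fun t => F (Cexp (t, 0%R)) / Cexp (t, 0%R) ^ n)) in G'.
  - unfold laurent.
    set (u := CInt _ x0 x1) in G'. set (v := CInt _ 0 (2 * PI)) in G' |- *.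
    set (v' := CInt _ 0 (2 * PI)) in G'.
    change (v' = v).
    assert (E : Ci * (v - v') = 0) by (rewrite <- G'; ring).
    replace v with (v' + - Ci * (Ci * (v - v'))).
    + rewrite E; ring.
    + replace (- Ci * (Ci * (v - v'))) with (- (Ci * Ci) * (v - v')) by ring.
      replace (Ci * Ci) with (- (1) : C) by (apply C_ext; unfold Re, Im; simpl; ring). ring.
  - intros t. rewrite <- (Cexp_periodic t 0), Rplus_0_l. reflexivity.
Qed.

Lemma laurent_continuous n F x : contC F -> forall eps : R, (0 < eps)%R ->
  exists d : R, (0 < d)%R /\ forall x', (Rabs (x' - x) < d)%R ->
    (Cmod (laurent n F x' - laurent n F x) < eps)%R.
Proof.
  intros HF eps Heps.
  pose proof PI_RGT_0 as Hpi.
  pose proof (contC_laurent n F HF) as HK.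
  set (K := fun s => F (Cexp s) / Cexp s ^ n) in HK.
  set (e := (eps / (8 * PI))%R).
  assert (He : (0 < e)%R) by (unfold e; apply Rdiv_lt_0_compat; lra).
  destruct (uniform_continuity_2d_1d' (fun u v => Re (K (u, v))) 0 (2 * PI) x) with (eps := mkposreal e He) as [d1 H1].
  { intros y _; apply continuity_2d_pt_filterlim.
    apply (filterlim_ext (fun z : C => Re (K z))); [intros [u v]; reflexivity|].
    apply (continuous_Re_comp K (x, y)), HK. }
  destruct (uniform_continuity_2d_1d' (fun u v => Im (K (u, v))) 0 (2 * PI) x) with (eps := mkposreal e He) as [d2 H2].
  { intros y _; apply continuity_2d_pt_filterlim.
    apply (filterlim_ext (fun z : C => Im (K z))); [intros [u v]; reflexivity|].
    apply (continuous_Im_comp K (x, y)), HK. }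
  pose proof (cond_pos d1); pose proof (cond_pos d2).
  exists (Rmin d1 d2); split; [now apply Rmin_glb_lt|].
  intros x' Hx'. apply Rabs_lt_between in Hx'.
  pose proof (Rmin_l d1 d2); pose proof (Rmin_r d1 d2).
  change (Cmod (CInt (fun y => K (x', y)) 0 (2 * PI) - CInt (fun y => K (x, y)) 0 (2 * PI)) < eps)%R.
  rewrite <- CInt_minus by now apply contR_vertical.
  eapply Rle_lt_trans; [apply CInt_bound with (M := (2 * e)%R)|].
  - intros t; apply continuous_Cminus; apply contR_vertical; exact HK.
  - lra.
  - intros t Ht. eapply Rle_trans; [apply Cmod_le_abs|].
    assert (Z : Rabs (t - t) = 0%R) by (rewrite Rminus_diag_eq by reflexivity; apply Rabs_R0).
    assert (H1' : (Rabs (Re (K (x', t)) - Re (K (x, t))) < e)%R) by (apply H1; try rewrite Z; lra).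
    assert (H2' : (Rabs (Im (K (x', t)) - Im (K (x, t))) < e)%R) by (apply H2; try rewrite Z; lra).
    change (Rabs (Re (K (x', t)) - Re (K (x, t))) + Rabs (Im (K (x', t)) - Im (K (x, t))) <= 2 * e)%R. lra.
  - unfold e. apply Rle_lt_trans with (eps / 2)%R; [right; field; lra|lra].
Qed.

Lemma Ceq_eps (z w : C) : (forall eps : R, (0 < eps)%R -> (Cmod (z - w) <= eps)%R) -> z = w.
Proof.
  intros H; apply Ceq_minus, Cmod_eq_0.
  apply Rle_antisym; [|apply Cmod_ge_0].
  apply Rle_plus_epsilon; intros e He; rewrite Rplus_0_l; now apply H.
Qed.

(** An exceptional point only removes one radius, which continuity in the
    radius bridges. *)
Lemma laurent_const n F w : contC F -> (forall z, z <> w -> cdiff F z) ->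
  forall x0 x1, laurent n F x0 = laurent n F x1.
Proof.
  intros HF HD.
  assert (Hgap : forall x0 x1, (x0 < x1)%R -> (forall x, (x0 <= x <= x1)%R -> exp x <> Cmod w) ->
     laurent n F x0 = laurent n F x1).
  { intros x0 x1 Hx Hw; apply laurent_annulus; try assumption.
    intros z Hz; apply HD; intros ->.
    assert (Hp : (0 < Cmod w)%R) by (pose proof (exp_pos x0); lra).
    apply (Hw (ln (Cmod w))); [|now apply exp_ln].
    rewrite <- (ln_exp x0), <- (ln_exp x1).
    split; apply ln_le; try apply exp_pos; lra. }
  assert (Hlim : forall x0 xs, exp xs = Cmod w -> laurent n F x0 = laurent n F xs).
  { intros x0 xs Hxs. apply Ceq_eps; intros eps Heps.
    destruct (laurent_continuous n F xs HF eps Heps) as (d & Hd & H).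
    destruct (Rtotal_order x0 xs) as [Hl|[->|Hg]].
    - set (x := Rmax ((x0 + xs) / 2) (xs - d / 2)).
      assert (Hx : (x0 < x < xs)%R).
      { split; [apply Rlt_le_trans with ((x0 + xs) / 2)%R; [lra|apply Rmax_l]|apply Rmax_lub_lt; lra]. }
      assert (Hx2 : (xs - d / 2 <= x)%R) by apply Rmax_r.
      rewrite (Hgap x0 x).
      + left; apply H. rewrite Rabs_left; lra.
      + lra.
      + intros t Ht E. rewrite <- Hxs in E. apply exp_inv in E. lra.
    - unfold Cminus; rewrite Cplus_opp_r, Cmod_0; lra.
    - set (x := Rmin ((x0 + xs) / 2) (xs + d / 2)).
      assert (Hx : (xs < x < x0)%R).
      { split; [apply Rmin_glb_lt; lra|apply Rle_lt_trans with ((x0 + xs) / 2)%R; [apply Rmin_l|lra]]. }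
      assert (Hx2 : (x <= xs + d / 2)%R) by apply Rmin_r.
      rewrite <- (Hgap x x0).
      + left; apply H. rewrite Rabs_right; lra.
      + lra.
      + intros t Ht E. rewrite <- Hxs in E. apply exp_inv in E. lra. }
  intros x0 x1.
  destruct (classic (exists xs, exp xs = Cmod w)) as [[xs Hs]|Hno].
  - rewrite (Hlim x0 xs Hs), (Hlim x1 xs Hs); reflexivity.
  - destruct (Rtotal_order x0 x1) as [Hl|[->|Hg]]; [|reflexivity|symmetry];
    apply Hgap; try assumption; intros x _ E; apply Hno; eauto.
Qed.

Lemma Cmod_circle x y : Cmod (Cexp (x, y)) = exp x.
Proof. now rewrite Cmod_Cexp. Qed.

Lemma mean_value F w : contC F -> (forall z, z <> w -> cdiff F z) ->
  forall x, laurent 0 F x = RtoC (2 * PI) * F 0.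
Proof.
  intros HF HD x.
  pose proof PI_RGT_0 as Hpi.
  apply Ceq_eps; intros eps Heps.
  destruct (proj1 (continuous_C_C F 0) (HF 0) (eps / (2 * PI))%R) as (d & Hd & H).
  { apply Rdiv_lt_0_compat; lra. }
  rewrite (laurent_const 0 F w HF HD x (ln (d / 2))).
  unfold laurent.
  replace (RtoC (2 * PI) * F 0) with (CInt (fun _ => F 0) 0 (2 * PI))
    by (rewrite CInt_const; f_equal; f_equal; ring).
  rewrite <- CInt_minus; [|now apply contR_laurent|intros t; apply continuous_Cconst].
  eapply Rle_trans; [apply CInt_bound with (M := (eps / (2 * PI))%R)|].
  - intros t; apply continuous_Cminus; [now apply contR_laurent|apply continuous_Cconst].
  - lra.
  - intros t _. simpl. replace (F (Cexp (ln (d / 2), t)) / 1) with (F (Cexp (ln (d / 2), t))) by field.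
    left; apply H. unfold Cminus; rewrite Copp_0, Cplus_0_r, Cmod_circle, exp_ln; lra.
  - right; field; lra.
Qed.

(** The mean of [|F|] on one fixed circle bounds all coefficients at once. *)
Lemma laurent_bound n F x : contC F ->
  (Cmod (laurent n F x) * exp x ^ n <= RInt (fun y => Cmod (F (Cexp (x, y)))) 0 (2 * PI))%R.
Proof.
  intros HF. pose proof PI_RGT_0 as Hpi.
  assert (Hp : (0 < exp x ^ n)%R) by (apply pow_lt, exp_pos).
  assert (Hc : forall t : R, continuous (fun y => Cmod (F (Cexp (x, y)))) t).
  { intros t.
    apply (continuous_comp (fun y : R_UniformSpace => F (Cexp (x, y)) : C_UniformSpace) Cmod).
    - apply contR_circle, HF.
    - intros P [e He]. exists (mkposreal (e / 2) (is_pos_div_2 e)). intros z Hz; apply He.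
      apply ball_C_elim in Hz; simpl in Hz.
      replace (2 * (e / 2))%R with (pos e) in Hz by field.
      change (Rabs (Cmod z - Cmod (F (Cexp (x, t)))) < e)%R.
      eapply Rle_lt_trans; [|exact Hz].
      set (z0 := F (Cexp (x, t)) : C). change C in z.
      apply Rabs_le; split.
      + assert (T := Cmod_triangle z (z0 - z)). replace (z + (z0 - z)) with z0 in T by ring.
        replace (z0 - z) with (- (z - z0)) in T by ring. rewrite Cmod_opp in T. lra.
      + assert (T := Cmod_triangle z0 (z - z0)). replace (z0 + (z - z0)) with z in T by ring. lra. }
  assert (He : ex_RInt (fun y => Cmod (F (Cexp (x, y)))) 0 (2 * PI)).
  { apply (@ex_RInt_continuous R_CompleteNormedModule); auto. }
  apply Rle_div_r; [exact Hp|].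
  apply CInt_le with (g := fun y => (/ (exp x ^ n) * Cmod (F (Cexp (x, y))))%R).
  - now apply contR_laurent.
  - lra.
  - intros t _. rewrite Cmod_div by apply Cpow_nz, Cexp_neq_0.
    rewrite Cmod_pow, Cmod_circle. right; unfold Rdiv; ring.
  - replace (RInt (fun y => Cmod (F (Cexp (x, y)))) 0 (2 * PI) / exp x ^ n)%R
      with (/ (exp x ^ n) * RInt (fun y => Cmod (F (Cexp (x, y)))) 0 (2 * PI))%R by (unfold Rdiv; ring).
    apply (@is_RInt_scal R_NormedModule).
    now apply (@RInt_correct R_CompleteNormedModule).
Qed.

Lemma zero_of_linear_bound (A : C) (B : R) :
  (forall r : R, (1 <= r)%R -> (Cmod A * r <= B)%R) -> A = 0.
Proof.
  intros H; apply NNPP; intros Hn; apply Cmod_gt_0 in Hn.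
  assert (H1 := H 1%R ltac:(lra)).
  specialize (H ((B + 1) / Cmod A)%R).
  replace (Cmod A * ((B + 1) / Cmod A))%R with (B + 1)%R in H by (field; lra).
  enough (1 <= (B + 1) / Cmod A)%R by lra.
  apply Rle_div_r; lra.
Qed.

Lemma laurent_one n x : laurent (S n) (fun _ => 1) x = 0.
Proof.
  pose proof PI_RGT_0 as Hpi.
  assert (Hc : contC (fun _ => 1)) by (intros z; apply continuous_Cconst).
  apply zero_of_linear_bound with (2 * PI)%R; intros r Hr.
  rewrite (laurent_const (S n) (fun _ => 1) 0 Hc (fun z _ => cdiff_const _ z) x (ln r)).
  apply Rle_trans with (Cmod (laurent (S n) (fun _ => 1) (ln r)) * exp (ln r) ^ S n)%R.
  - apply Rmult_le_compat_l; [apply Cmod_ge_0|].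
    rewrite exp_ln by lra. simpl. pose proof (pow_R1_Rle r n Hr). nra.
  - eapply Rle_trans; [now apply laurent_bound|].
    rewrite (RInt_ext _ (fun _ => 1%R)) by (intros; apply Cmod_1).
    rewrite RInt_const. unfold scal; simpl; unfold mult; simpl. lra.
Qed.

(** * Entire functions whose real part has polynomial growth *)

(** The conjugate of [h] has no Laurent coefficients of positive index, so
    these are determined by the real part; a one-sided bound on the latter
    bounds its absolute mean, the signed mean being [Re (h 0)]. *)
Lemma laurent_growth (h : C -> C) (B : R) (m : nat) : (forall z, cdiff h z) ->
  (0 <= B)%R -> (forall z, (Re (h z) <= B * (1 + Cmod z) ^ m)%R) ->
  forall n x, (Cmod (laurent (S n) h x) * exp x ^ S n <= 8 * PI * (B * (1 + exp x) ^ m) - 4 * PI * Re (h 0))%R.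
Proof.
  intros HD HB Hre n x.
  pose proof PI_RGT_0 as Hpi.
  assert (HF : contC h) by (intros z; now apply cdiff_continuous).
  set (N := S n). set (E := fun y => Cexp (x, y) ^ N). set (H := fun y => h (Cexp (x, y))).
  set (b := (B * (1 + exp x) ^ m)%R).
  assert (HE : contR E).
  { intros y; apply continuous_Cpow.
    apply (contR_circle (fun z => z)); intros z; apply continuous_id. }
  assert (HH : contR H) by now apply contR_circle.
  assert (Hconj : forall f, contR f -> contR (fun t => Cconj (f t))).
  { intros f Hf t; apply continuous_C_components; simpl.
    - now apply continuous_Re_comp.
    - apply (continuous_opp (fun t => Im (f t))); now apply continuous_Im_comp. }
  assert (Hp : (0 < exp x ^ N)%R) by (apply pow_lt, exp_pos).
  assert (ME : forall y, Cmod (E y) = (exp x ^ N)%R) by (intros; unfold E; now rewrite Cmod_pow, Cmod_circle).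
  assert (I1 : CInt (fun y => Cconj (H y * E y)) 0 (2 * PI) = 0).
  { rewrite CInt_conj by (intros t; apply continuous_Cmult; [apply HH|apply HE]).
    replace (CInt (fun y => H y * E y) 0 (2 * PI)) with (laurent 0 (fun z => h z * z ^ N) x).
    - rewrite (mean_value _ 0).
      + replace (0 ^ N) with (RtoC 0) by (unfold N; simpl; ring).
        apply C_ext; unfold Re, Im; simpl; ring.
      + intros z; apply continuous_Cmult; [apply HF|]. apply continuous_Cpow, continuous_id.
      + intros z _; apply cdiff_mult; [apply HD|]. apply cdiff_pow, cdiff_id.
    - apply CInt_ext; intros y; unfold H, E; simpl; field. }
  assert (I2 : laurent N h x * RtoC (exp x ^ N * exp x ^ N) = CInt (fun y => H y * Cconj (E y)) 0 (2 * PI)).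
  { unfold laurent. rewrite Cmult_comm, <- CInt_scal by now apply contR_laurent.
    apply CInt_ext; intros y. fold (E y) (H y).
    assert (E y <> 0) by (unfold E; apply Cpow_nz, Cexp_neq_0).
    replace (RtoC (exp x ^ N * exp x ^ N)) with (E y * Cconj (E y)).
    - field; assumption.
    - rewrite <- Cmod2_conj, ME, RtoC_mult, ?RtoC_pow. ring. }
  assert (I3 : laurent N h x * RtoC (exp x ^ N * exp x ^ N) =
     CInt (fun y => RtoC (2 * Re (H y)) * Cconj (E y)) 0 (2 * PI)).
  { rewrite I2.
    rewrite (CInt_ext (fun y => RtoC (2 * Re (H y)) * Cconj (E y))
               (fun y => H y * Cconj (E y) + Cconj (H y * E y))).
    - rewrite CInt_plus, I1; [symmetry; apply Cplus_0_r| |].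
      + intros t; apply continuous_Cmult; [apply HH|now apply Hconj].
      + apply Hconj. intros t; apply continuous_Cmult; [apply HH|apply HE].
    - intros y. rewrite Cmult_conj, <- Cmult_plus_distr_r. f_equal.
      apply C_ext; unfold Re, Im; simpl; ring. }
  assert (Hmean : is_RInt (fun y => Re (H y)) 0 (2 * PI) (2 * PI * Re (h 0))%R).
  { assert (MV := mean_value h 0 HF (fun z _ => HD z) x).
    apply (f_equal Re) in MV.
    replace (2 * PI * Re (h 0))%R with (Re (RtoC (2 * PI) * h 0)) by (unfold Re; simpl; ring).
    rewrite <- MV. unfold laurent, CInt; simpl.
    rewrite (RInt_ext _ (fun y => Re (H y))).
    - apply (@RInt_correct R_CompleteNormedModule). now apply ex_RInt_Re.
    - intros y _; unfold H, Re; simpl; field. }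
  assert (Hint : is_RInt (fun y => exp x ^ N * (4 * b - 2 * Re (H y)))%R 0 (2 * PI)
      (exp x ^ N * (8 * PI * b - 4 * PI * Re (h 0)))%R).
  { apply (@is_RInt_scal R_NormedModule).
    replace (8 * PI * b - 4 * PI * Re (h 0))%R with (minus (scal (2 * PI - 0)%R (4 * b)%R) (scal 2 (2 * PI * Re (h 0))))%R
      by (unfold minus, plus, opp, scal; simpl; unfold mult; simpl; ring).
    apply (@is_RInt_minus R_NormedModule).
    - apply (@is_RInt_const R_NormedModule).
    - apply (@is_RInt_scal R_NormedModule (fun y => Re (H y)) 0 (2 * PI) 2%R _ Hmean). }
  assert (Hfin : (Cmod (laurent N h x * RtoC (exp x ^ N * exp x ^ N)) <= exp x ^ N * (8 * PI * b - 4 * PI * Re (h 0)))%R).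
  { rewrite I3. apply CInt_le with (g := fun y => (exp x ^ N * (4 * b - 2 * Re (H y)))%R); try assumption.
    - intros t; apply continuous_Cmult.
      + apply continuous_C_components; simpl; [|apply continuous_const].
        apply (@continuous_scal_r R_UniformSpace R_AbsRing R_NormedModule 2%R (fun y => Re (H y))).
        apply continuous_Re_comp, HH.
      + now apply Hconj.
    - lra.
    - intros t _. rewrite Cmod_mult, Cmod_conj, ME, Cmod_R, Rmult_comm.
      apply Rmult_le_compat_l; [lra|].
      assert (Hb : (Re (H t) <= b)%R).
      { unfold H, b. eapply Rle_trans; [apply Hre|]. rewrite Cmod_circle; lra. }
      assert (Hb0 : (0 <= b)%R).
      { unfold b; apply Rmult_le_pos; [lra|]. apply pow_le. pose proof (exp_pos x); lra. }
      apply Rabs_le; lra. }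
  rewrite Cmod_mult, Cmod_R, Rabs_right in Hfin by nra.
  apply (Rmult_le_reg_l (exp x ^ N)); [exact Hp|]. lra.
Qed.

Lemma laurent_vanish (h : C -> C) (B : R) (m : nat) : (forall z, cdiff h z) ->
  (0 <= B)%R -> (forall z, (Re (h z) <= B * (1 + Cmod z) ^ m)%R) ->
  forall n x, (m < n)%nat -> laurent n h x = 0.
Proof.
  intros HD HB Hre n x Hn.
  pose proof PI_RGT_0 as Hpi.
  destruct n as [|n]; [lia|].
  assert (HF : contC h) by (intros z; now apply cdiff_continuous).
  apply zero_of_linear_bound with (8 * PI * B * 2 ^ m + 4 * PI * Rabs (Re (h 0)))%R; intros r Hr.
  rewrite (laurent_const (S n) h 0 HF (fun z _ => HD z) x (ln r)).
  assert (G := laurent_growth h B m HD HB Hre n (ln r)).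
  rewrite exp_ln in G by lra.
  set (A := Cmod (laurent (S n) h (ln r))) in *.
  assert (HA : (0 <= A)%R) by apply Cmod_ge_0.
  assert (Hrm : (1 <= r ^ m)%R) by now apply pow_R1_Rle.
  assert (E1 : ((1 + r) ^ m <= 2 ^ m * r ^ m)%R).
  { rewrite <- Rpow_mult_distr. apply pow_incr; lra. }
  assert (E2 : (r ^ m * r <= r ^ S n)%R).
  { replace (r ^ m * r)%R with (r ^ S m)%R by (simpl; ring). apply Rle_pow; [lra|lia]. }
  assert (E3 : (- (4 * PI * Re (h 0)) <= 4 * PI * Rabs (Re (h 0)) * r ^ m)%R).
  { pose proof (Rle_abs (- Re (h 0))) as Hab. rewrite Rabs_Ropp in Hab.
    assert (0 <= Rabs (Re (h 0)))%R by apply Rabs_pos.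
    apply Rle_trans with (4 * PI * Rabs (Re (h 0)))%R; [nra|].
    assert (0 <= 4 * PI * Rabs (Re (h 0)))%R by nra. nra. }
  apply (Rmult_le_reg_l (r ^ m)); [lra|].
  apply Rle_trans with (A * r ^ S n)%R; [nra|].
  eapply Rle_trans; [exact G|].
  assert (0 <= 8 * PI * B)%R by nra.
  assert (8 * PI * B * (1 + r) ^ m <= 8 * PI * B * (2 ^ m * r ^ m))%R by (apply Rmult_le_compat_l; assumption).
  lra.
Qed.

(** Writing [h y = h w + (y - w) phi y], the coefficients of [phi] satisfy
    [phi_(n-1) - w phi_n = h_n]; unrolling this recursion gives Taylor's
    formula with the remainder [w^(N+1) phi_N]. *)
Theorem entire_polynomial (h : C -> C) (B : R) (m : nat) : (forall z, cdiff h z) ->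
  (0 <= B)%R -> (forall z, (Re (h z) <= B * (1 + Cmod z) ^ m)%R) -> polynomial1 h.
Proof.
  intros HD HB Hre.
  pose proof PI_RGT_0 as Hpi.
  assert (H2pi : RtoC (2 * PI) <> 0) by (apply RtoC_neq0; lra).
  assert (HF : contC h) by (intros z; now apply cdiff_continuous).
  exists m, (fun j => laurent j h 0 / RtoC (2 * PI)); intros w.
  destruct (HD w) as (l & phi & Hphi & _ & Ephi).
  assert (Dphi : forall z, z <> w -> cdiff phi z).
  { intros z Hz.
    assert (Hp : (0 < Cmod (z - w))%R) by now apply Cmod_gt_0, Cminus_eq_contra.
    apply cdiff_ext_loc with (f := fun y => (h y - h w) / (y - w)) (d := Cmod (z - w)); [exact Hp| |].
    - intros y Hy. rewrite (Ephi y). field.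
      intros E. apply Ceq_minus in E; subst y.
      replace (w - z) with (- (z - w)) in Hy by ring. rewrite Cmod_opp in Hy. lra.
    - apply cdiff_div; [apply cdiff_minus; [apply HD|apply cdiff_const]
        |apply cdiff_minus; [apply cdiff_id|apply cdiff_const]|now apply Cminus_eq_contra]. }
  assert (Cphi : contC phi).
  { intros z; destruct (Ceq_dec z w) as [->|Hz]; [exact Hphi|]. now apply cdiff_continuous, Dphi. }
  assert (Hrec : forall n, laurent n phi 0 = laurent (S n) h 0 + w * laurent (S n) phi 0).
  { intros n.
    replace (laurent (S n) h 0) with (h w * laurent (S n) (fun _ => 1) 0 + (laurent n phi 0 - w * laurent (S n) phi 0)).
    { rewrite laurent_one; ring. }
    unfold laurent.
    rewrite <- (CInt_scal (h w)) by (apply (contR_laurent (S n) (fun _ => 1)); intros z; apply continuous_Cconst).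
    rewrite <- (CInt_scal w) by now apply contR_laurent.
    assert (Hc1 : contR (fun t => w * (phi (Cexp (0%R, t)) / Cexp (0%R, t) ^ S n))).
    { intros t; apply continuous_Cmult; [apply continuous_Cconst|now apply contR_laurent]. }
    rewrite <- CInt_minus; [|now apply contR_laurent|exact Hc1].
    rewrite <- CInt_plus.
    - apply CInt_ext; intros y. rewrite (Ephi (Cexp (0%R, y))). simpl.
      field. split; [apply Cpow_nz|]; apply Cexp_neq_0.
    - intros t; apply continuous_Cmult; [apply continuous_Cconst|].
      apply (contR_laurent (S n) (fun _ => 1)); intros z; apply continuous_Cconst.
    - intros t; apply continuous_Cminus; [now apply contR_laurent|apply Hc1]. }
  assert (Htaylor : forall N, RtoC (2 * PI) * h w =
     sum_n (fun j => laurent j h 0 * w ^ j) N + w ^ S N * laurent N phi 0).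
  { induction N as [|N IH].
    - rewrite sum_O. simpl.
      rewrite (mean_value h w HF (fun z _ => HD z)), (mean_value phi w Cphi Dphi).
      assert (E := Ephi 0).
      replace (h 0) with (h w + (0 - w) * phi 0) by (symmetry; exact E). ring.
    - rewrite IH, sum_Sn, Hrec. unfold plus; simpl. ring. }
  assert (Hstable : forall k, sum_n (fun j => laurent j h 0 * w ^ j) (m + k) = sum_n (fun j => laurent j h 0 * w ^ j) m).
  { induction k as [|k IH]; [now rewrite Nat.add_0_r|].
    rewrite Nat.add_succ_r, sum_Sn, IH.
    rewrite (laurent_vanish h B m HD HB Hre (S (m + k)) 0) by lia.
    unfold plus; simpl; ring. }
  assert (Hmain : RtoC (2 * PI) * h w = sum_n (fun j => laurent j h 0 * w ^ j) m).
  { set (r := (2 * Cmod w + 1)%R).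
    pose proof (Cmod_ge_0 w) as Hw0.
    assert (Hr : (0 < r)%R) by (unfold r; lra).
    set (I := RInt (fun y => Cmod (phi (Cexp (ln r, y)))) 0 (2 * PI)).
    assert (Hb : forall k, (Cmod (RtoC (2 * PI) * h w - sum_n (fun j => laurent j h 0 * w ^ j) m)%C <= Cmod w * I * (/ 2) ^ (m + k))%R).
    { intros k. rewrite (Htaylor (m + k)%nat), Hstable.
      match goal with |- (Cmod (?a + ?b - ?a) <= _)%R => replace (a + b - a) with b by ring end.
      assert (LB := laurent_bound (m + k) phi (ln r) Cphi).
      fold I in LB. rewrite exp_ln in LB by exact Hr.
      rewrite (laurent_const (m + k) phi w Cphi Dphi 0 (ln r)).
      rewrite Cmod_mult, Cmod_pow. simpl.
      set (A := Cmod (laurent (m + k) phi (ln r))) in *.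
      assert (HA : (0 <= A)%R) by apply Cmod_ge_0.
      rewrite !Rmult_assoc. apply Rmult_le_compat_l; [exact Hw0|].
      assert (Hpw : (Cmod w ^ (m + k) <= (r * / 2) ^ (m + k))%R).
      { apply pow_incr; unfold r; lra. }
      rewrite Rpow_mult_distr in Hpw.
      assert (H2 : (0 < (/ 2) ^ (m + k))%R) by (apply pow_lt; lra).
      apply Rle_trans with (r ^ (m + k) * (/ 2) ^ (m + k) * A)%R; [now apply Rmult_le_compat_r|].
      apply (Rmult_le_compat_r ((/ 2) ^ (m + k))) in LB; lra. }
    apply Ceq_eps; intros eps Heps.
    assert (HI : (0 <= Cmod w * I)%R).
    { specialize (Hb O). rewrite Nat.add_0_r in Hb.
      assert (0 < (/ 2) ^ m)%R by (apply pow_lt; lra).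
      assert (Z := Cmod_ge_0 (RtoC (2 * PI) * h w - sum_n (fun j => laurent j h 0 * w ^ j) m)). nra. }
    destruct (pow_lt_1_zero (/ 2)) with (y := (eps / (Cmod w * I + 1))%R) as [N HN].
    { rewrite Rabs_right; lra. } { apply Rdiv_lt_0_compat; lra. }
    eapply Rle_trans; [apply (Hb N)|].
    specialize (HN (m + N)%nat ltac:(lia)). rewrite Rabs_right in HN by (apply Rle_ge, pow_le; lra).
    apply Rle_trans with (Cmod w * I * (eps / (Cmod w * I + 1)))%R; [apply Rmult_le_compat_l; lra|].
    apply (Rmult_le_reg_r (Cmod w * I + 1)); [lra|].
    unfold Rdiv. rewrite Rmult_assoc, (Rmult_assoc eps), Rinv_l by lra. nra. }
  replace (h w) with (/ RtoC (2 * PI) * (RtoC (2 * PI) * h w)) by (field; exact H2pi).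
  rewrite Hmain.
  rewrite <- (sum_n_mult_l (K := C_Ring) (/ RtoC (2 * PI))).
  apply sum_n_ext; intros j. unfold mult; simpl. unfold Cdiv; ring.
Qed.

(** * Logarithms of nonvanishing functions on C^2 *)

Definition Clog (w : C) : C := (ln (Cmod w), atan (Im w / Re w)).

Lemma Cexp_Clog w : (0 < Re w)%R -> Cexp (Clog w) = w.
Proof.
  destruct w as [x y]; unfold Re, Im; simpl; intros Hx.
  assert (Hw : (0 < Cmod (x, y))%R).
  { apply Cmod_gt_0; intros E; apply (f_equal fst) in E; simpl in E; lra. }
  unfold Cexp, Clog, Re, Im; simpl.
  rewrite exp_ln by exact Hw.
  rewrite cos_atan, sin_atan.
  assert (E : sqrt (1 + (y / x)²) = (Cmod (x, y) / x)%R).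
  { replace (1 + (y / x)²)%R with ((x ^ 2 + y ^ 2) / (x * x))%R by (unfold Rsqr; field; lra).
    rewrite sqrt_div_alt by nra. rewrite sqrt_square by lra. reflexivity. }
  rewrite E. apply C_ext; unfold Re, Im; simpl; field; lra.
Qed.

Lemma Clog_1 : Clog 1 = 0.
Proof.
  unfold Clog; rewrite Cmod_1, ln_1. unfold Re, Im; simpl.
  replace (0 / 1)%R with 0%R by field. now rewrite atan_0.
Qed.

Lemma continuous_Clog {T : UniformSpace} (f : T -> C) x :
  continuous f x -> (0 < Re (f x))%R -> continuous (fun t => Clog (f t)) x.
Proof.
  intros Hf Hp.
  pose proof (continuous_Re_comp _ _ Hf) as Hr; pose proof (continuous_Im_comp _ _ Hf) as Hi.
  apply continuous_C_components; simpl.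
  - apply (continuous_comp (fun t => Cmod (f t)) ln).
    + apply (continuous_ext (fun t => sqrt (Re (f t) * Re (f t) + Im (f t) * Im (f t)))).
      { intros t; unfold Cmod, Re, Im; simpl; f_equal; ring. }
      apply (continuous_comp (fun t => Re (f t) * Re (f t) + Im (f t) * Im (f t))%R sqrt).
      * apply (continuous_plus (fun t => Re (f t) * Re (f t))%R (fun t => Im (f t) * Im (f t))%R);
        apply (@continuous_mult T R_AbsRing); assumption.
      * apply continuous_sqrt.
    + apply continuity_pt_filterlim, derivable_continuous_pt.
      eexists. apply derivable_pt_lim_ln.
      apply Rlt_le_trans with (Rabs (Re (f x))); [now rewrite Rabs_right; lra|apply Re_le_Cmod].
  - apply (continuous_comp (fun t => Im (f t) / Re (f t))%R atan).
    + apply (@continuous_mult T R_AbsRing); [exact Hi|].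
      apply (continuous_comp (fun t => Re (f t)) Rinv); [exact Hr|].
      apply continuous_Rinv; lra.
    + apply continuity_pt_filterlim, derivable_continuous_pt, derivable_pt_atan.
Qed.

Lemma Cexp_surjective (w : C) : w <> 0 -> exists l, Cexp l = w.
Proof.
  intros Hw.
  assert (Hpos : forall v : C, (0 < Re v)%R -> exists l, Cexp l = v).
  { intros v Hv; exists (Clog v); now apply Cexp_Clog. }
  assert (Hi : Cexp (0, PI / 2)%R = Ci).
  { unfold Cexp; simpl; rewrite exp_0, cos_PI2, sin_PI2; apply C_ext; unfold Re, Im; simpl; ring. }
  (* A power of [i] rotates [w] into the right half-plane. *)
  assert (Hrot : forall v, (exists l, Cexp l = v * Ci) -> exists l, Cexp l = v).
  { intros v [l Hl]; exists (l - (0, PI / 2)%R). rewrite Cexp_minus, Hl, Hi.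
    field. apply Ci_nz. }
  destruct w as [x y].
  destruct (Rtotal_order x 0) as [Hx|[Hx|Hx]].
  - apply Hrot, Hrot, Hpos; unfold Re; simpl; lra.
  - destruct (Rtotal_order y 0) as [Hy|[Hy|Hy]].
    + apply Hrot, Hpos; unfold Re; simpl; lra.
    + subst; now elim Hw.
    + apply Hrot, Hrot, Hrot, Hpos; unfold Re; simpl; lra.
  - now apply Hpos.
Qed.

Definition cont2 (u : C * C -> C) : Prop :=
  forall z, continuous (u : prod_UniformSpace C_UniformSpace C_UniformSpace -> C_UniformSpace) z.

Definition inbox (R : R) (z : C * C) : Prop :=
  (Rabs (Re (fst z)) <= R /\ Rabs (Im (fst z)) <= R /\
   Rabs (Re (snd z)) <= R /\ Rabs (Im (snd z)) <= R)%R.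

Definition near2 (d : R) (x y : C * C) : Prop :=
  (Rabs (Re (fst y) - Re (fst x)) < d /\ Rabs (Im (fst y) - Im (fst x)) < d /\
   Rabs (Re (snd y) - Re (snd x)) < d /\ Rabs (Im (snd y) - Im (snd x)) < d)%R.

Lemma near2_ball (d : R) (x y : C * C) :
  near2 d x y <-> ball (x : prod_UniformSpace C_UniformSpace C_UniformSpace) d y.
Proof.
  split.
  - intros (H1 & H2 & H3 & H4); repeat split; assumption.
  - intros [[H1 H2] [H3 H4]]; repeat split; assumption.
Qed.

Lemma cont2_near (u : C * C -> C) x : cont2 u -> forall eps : R, (0 < eps)%R ->
  exists d : posreal, forall y, near2 d x y -> (Cmod (u y - u x) < eps)%R.
Proof.
  intros Hu eps Heps. destruct (proj1 (continuous_to_C u x) (Hu x) eps Heps) as [d Hd].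
  exists d; intros y Hy; apply Hd. now apply near2_ball.
Qed.

(** Heine-Cantor; [y] is not confined to the box because the compactness
    argument only covers the points [x]. *)
Lemma uniform_box (u : C * C -> C) : cont2 u -> forall M eps : R, (0 < eps)%R ->
  exists d : R, (0 < d)%R /\ forall x y, inbox M x -> near2 d x y -> (Cmod (u y - u x) < eps)%R.
Proof.
  intros Hu M eps Heps.
  assert (Hd : forall x, exists d : posreal, forall y, near2 (2 * d) x y -> (Cmod (u y - u x) < eps / 2)%R).
  { intros x; destruct (cont2_near u x Hu (eps / 2)%R) as [d Hd]; [lra|].
    exists (mkposreal (d / 2) (is_pos_div_2 d)); intros y Hy; apply Hd.
    simpl in Hy. now replace (2 * (d / 2))%R with (pos d) in Hy by field. }
  set (pt := fun t : Compactness.Tn 4 R =>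
    let '(t1, (t2, (t3, (t4, _)))) := t in ((t1, t2), (t3, t4)) : C * C).
  set (delta := fun t => proj1_sig (constructive_indefinite_description _ (Hd (pt t)))).
  assert (Hdelta : forall t y, near2 (2 * delta t) (pt t) y -> (Cmod (u y - u (pt t)) < eps / 2)%R).
  { intros t; unfold delta; destruct constructive_indefinite_description as [d H]; exact H. }
  destruct (compactness_value 4 ((- M)%R, ((- M)%R, ((- M)%R, ((- M)%R, tt)))) (M, (M, (M, (M, tt)))) delta) as [d H].
  exists d; split; [apply cond_pos|].
  intros [[x1 x2] [x3 x4]] y Hx Hy.
  specialize (H (x1, (x2, (x3, (x4, tt))))).
  apply NNPP in H.
  - destruct H as (t & _ & Hc & Hdt).
    assert (Hxt : near2 (delta t) (pt t) ((x1, x2), (x3, x4))).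
    { destruct t as (t1 & t2 & t3 & t4 & []); simpl in Hc |- *.
      unfold near2, Re, Im; simpl; tauto. }
    pose proof (cond_pos (delta t)).
    assert (A : (Cmod (u ((x1, x2), (x3, x4)) - u (pt t)) < eps / 2)%R).
    { apply Hdelta. destruct Hxt as (?&?&?&?); repeat split; lra. }
    assert (B : (Cmod (u y - u (pt t)) < eps / 2)%R).
    { apply Hdelta. destruct Hxt as (K1&K2&K3&K4), Hy as (L1&L2&L3&L4).
      apply Rabs_lt_between in K1, K2, K3, K4, L1, L2, L3, L4.
      repeat split; apply Rabs_lt_between; cbn [fst snd] in *; lra. }
    set (v := u (pt t)) in *. set (w := u ((x1, x2), (x3, x4))) in *.
    assert (T := Cmod_triangle (u y - v) (- (w - v))). rewrite Cmod_opp in T.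
    change (Cmod (u y - w) < eps)%R.
    replace (u y - w) with ((u y - v) + - (w - v)) by ring. lra.
  - destruct Hx as (H1 & H2 & H3 & H4); unfold Re, Im in *; simpl in *.
    apply Rabs_le_between in H1, H2, H3, H4. repeat split; lra.
Qed.

Definition dilate (t : R) (z : C * C) : C * C := (RtoC t * fst z, RtoC t * snd z).

Lemma dilate_1 z : dilate 1 z = z.
Proof. unfold dilate; rewrite !Cmult_1_l; symmetry; apply surjective_pairing. Qed.

Lemma dilate_0 z : dilate 0 z = (RtoC 0, RtoC 0).
Proof. unfold dilate; now rewrite !Cmult_0_l. Qed.

Lemma inbox_dilate M t z : (0 <= t <= 1)%R -> inbox M z -> inbox M (dilate t z).
Proof.
  intros Ht (H1 & H2 & H3 & H4); unfold inbox, dilate.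
  assert (S : forall x : R, (Rabs x <= M -> Rabs (t * x) <= M)%R).
  { intros x Hx. rewrite Rabs_mult, (Rabs_right t) by lra. pose proof (Rabs_pos x). nra. }
  cbn [fst snd]. rewrite !re_scal_l, !im_scal_l. repeat split; now apply S.
Qed.

Lemma near2_dilate M d s t z : inbox M z -> (Rabs (t - s) * M < d)%R ->
  near2 d (dilate s z) (dilate t z).
Proof.
  intros (H1 & H2 & H3 & H4) Hd; unfold near2, dilate; cbn [fst snd]. rewrite !re_scal_l, !im_scal_l.
  assert (S : forall x : R, (Rabs x <= M -> Rabs (t * x - s * x) < d)%R).
  { intros x Hx. replace (t * x - s * x)%R with ((t - s) * x)%R by ring. rewrite Rabs_mult.
    pose proof (Rabs_pos (t - s)). nra. }
  repeat split; now apply S.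
Qed.

(** By uniform continuity the modulus grows by at most 1 in each of finitely
    many steps along the ray from the origin. *)
Lemma bounded_box (u : C * C -> C) : cont2 u -> forall M, exists B, forall z, inbox M z -> (Cmod (u z) <= B)%R.
Proof.
  intros Hu M.
  destruct (uniform_box u Hu M 1) as (d & Hd & H); [lra|].
  destruct (INR_archimed d (Rabs M)) as [N HN]; [exact Hd|].
  exists (Cmod (u (RtoC 0, RtoC 0)) + INR (S N))%R; intros z Hz.
  assert (HNp : (0 < INR (S N))%R) by (apply lt_0_INR; lia).
  assert (HM : (0 <= M)%R) by (destruct Hz as [Hz _]; pose proof (Rabs_pos (Re (fst z))); lra).
  rewrite (Rabs_right M) in HN by lra.
  assert (G : forall k, (k <= S N)%nat -> (Cmod (u (dilate (INR k / INR (S N)) z)) <= Cmod (u (RtoC 0, RtoC 0)) + INR k)%R).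
  { induction k as [|k IH]; intros Hk.
    - unfold dilate. replace (INR 0 / INR (S N))%R with 0%R by (simpl INR at 1; field; lra).
      rewrite !Cmult_0_l. simpl; lra.
    - specialize (IH ltac:(lia)).
      assert (Hs : (Cmod (u (dilate (INR (S k) / INR (S N)) z) - u (dilate (INR k / INR (S N)) z)) < 1)%R).
      { apply H.
        - apply inbox_dilate; [|exact Hz]. split; [apply Rle_div_r; [lra|]; rewrite Rmult_0_l; apply pos_INR|].
          apply Rle_div_l; [lra|]. rewrite Rmult_1_l; apply le_INR; lia.
        - apply near2_dilate with M; [exact Hz|].
          replace (INR (S k) / INR (S N) - INR k / INR (S N))%R with (/ INR (S N))%R
            by (rewrite (S_INR k); field; lra).
          rewrite Rabs_right by (apply Rle_ge; left; now apply Rinv_0_lt_compat).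
          apply (Rmult_lt_reg_l (INR (S N))); [exact HNp|].
          rewrite <- Rmult_assoc, Rinv_r, Rmult_1_l by lra. rewrite S_INR. lra. }
      replace (u (dilate (INR (S k) / INR (S N)) z)) with
        (u (dilate (INR k / INR (S N)) z) + (u (dilate (INR (S k) / INR (S N)) z) - u (dilate (INR k / INR (S N)) z))) by ring.
      eapply Rle_trans; [apply Cmod_triangle|]. pose proof (S_INR k). lra. }
  specialize (G (S N) (le_n _)).
  replace (INR (S N) / INR (S N))%R with 1%R in G by (field; lra).
  now rewrite dilate_1 in G.
Qed.

(** Two continuous logarithms along a segment differ by a constant: their
    difference takes values in a discrete set. *)
Lemma log_path_unique (f g : R -> C) :
  (forall t, (0 <= t <= 1)%R -> continuous (f : R_UniformSpace -> C_UniformSpace) t) ->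
  (forall t, (0 <= t <= 1)%R -> continuous (g : R_UniformSpace -> C_UniformSpace) t) ->
  (forall t, (0 <= t <= 1)%R -> Cexp (f t) = Cexp (g t)) ->
  f 0%R = g 0%R -> f 1%R = g 1%R.
Proof.
  intros Hf Hg He H0.
  set (phi := fun t => Im (f t - g t)).
  assert (Hexp : forall t, (0 <= t <= 1)%R -> Cexp (f t - g t) = 1).
  { intros t Ht; rewrite Cexp_minus, He by exact Ht. field; apply Cexp_neq_0. }
  assert (Hre : forall t, (0 <= t <= 1)%R -> Re (f t - g t) = 0%R).
  { intros t Ht. apply exp_inv. rewrite <- Cmod_Cexp, Hexp, exp_0 by exact Ht. apply Cmod_1. }
  assert (Hcos : forall t, (0 <= t <= 1)%R -> cos (phi t) = 1%R).
  { intros t Ht. assert (E := Hexp t Ht). apply (f_equal Re) in E. unfold Cexp in E; simpl in E.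
    change (exp (Re (f t - g t)) * cos (phi t) = 1)%R in E.
    rewrite Hre, exp_0 in E by exact Ht. lra. }
  assert (Hphi : forall t, (0 <= t <= 1)%R -> continuity_pt phi t).
  { intros t Ht. apply continuity_pt_filterlim. apply (continuous_Im_comp (fun t : R_UniformSpace => f t - g t)).
    apply continuous_Cminus; auto. }
  assert (Hphi0 : phi 0%R = 0%R) by (unfold phi; rewrite H0; unfold Cminus; rewrite Cplus_opp_r; reflexivity).
  assert (Hphi1 : phi 1%R = 0%R).
  { pose proof PI_RGT_0 as Hpi.
    apply NNPP; intros Hn.
    (* Otherwise the difference takes a value [a] in (0, PI), where the cosine is not 1. *)
    set (a := (Rmin (Rabs (phi 1)) PI / 2)%R).
    assert (Ha : (0 < a < Rabs (phi 1) /\ a < PI)%R).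
    { pose proof (Rabs_pos_lt _ Hn). unfold a. split; [split|].
      - enough (0 < Rmin (Rabs (phi 1)) PI)%R by lra. now apply Rmin_glb_lt.
      - pose proof (Rmin_l (Rabs (phi 1)) PI). lra.
      - pose proof (Rmin_r (Rabs (phi 1)) PI). lra. }
    assert (Hex : exists t, (0 <= t <= 1)%R /\ Rabs (phi t) = a).
    { destruct (Rlt_le_dec 0 (phi 1%R)) as [Hp|Hp].
      - rewrite Rabs_right in Ha by lra.
        destruct (Ranalysis5.IVT_interv (fun t => phi t - a)%R 0 1) as (t & Ht & E).
        + intros t Ht. apply (continuity_pt_minus phi (fun _ => a)); [now apply Hphi|].
          apply continuity_pt_const; now intros ? ?.
        + lra.
        + rewrite Hphi0; lra.
        + lra.
        + exists t; split; [exact Ht|]. rewrite Rabs_right; lra.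
      - rewrite Rabs_left1 in Ha by lra.
        destruct (Ranalysis5.IVT_interv (fun t => - a - phi t)%R 0 1) as (t & Ht & E).
        + intros t Ht. apply (continuity_pt_minus (fun _ => - a)%R phi); [|now apply Hphi].
          apply continuity_pt_const; now intros ? ?.
        + lra.
        + rewrite Hphi0; lra.
        + lra.
        + exists t; split; [exact Ht|]. rewrite Rabs_left; lra. }
    destruct Hex as (t & Ht & E).
    assert (Hc := Hcos t Ht).
    assert (Hc' : cos a = 1%R).
    { rewrite <- E. unfold Rabs; destruct Rcase_abs; [rewrite cos_neg|]; exact Hc. }
    assert (Hlt : (cos a < cos 0)%R) by (apply cos_decreasing_1; lra).
    rewrite cos_0 in Hlt; lra. }
  apply Ceq_minus, C_ext; [|exact Hphi1].
  apply Hre; lra.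
Qed.

Section Lifting.
Context (u : C * C -> C) (Hu : cont2 u) (Hnz : forall z, u z <> 0).

(** Consecutive values along the ray through [z], divided into [N] steps. *)
Definition ratio (N k : nat) (z : C * C) : C :=
  u (dilate (INR (S k) / INR N) z) / u (dilate (INR k / INR N) z).

Fixpoint log_sum (N k : nat) (z : C * C) : C :=
  match k with
  | O => 0
  | S j => log_sum N j z + Clog (ratio N j z)
  end.

Definition fine_mesh (M : R) (N : nat) : Prop :=
  (0 < N)%nat /\ forall z, inbox M z -> forall k, (k < N)%nat -> (0 < Re (ratio N k z))%R.

Lemma fine_mesh_exists M : exists N, fine_mesh M N.
Proof.
  assert (Hinv : cont2 (fun z => / u z)) by (intros z; apply continuous_Cinv; [apply Hu|apply Hnz]).
  destruct (bounded_box _ Hinv M) as [B HB].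
  set (B' := (Rabs B + 1)%R).
  assert (HB' : (0 < B')%R) by (unfold B'; pose proof (Rabs_pos B); lra).
  destruct (uniform_box u Hu M (/ B')) as (d & Hd & H); [now apply Rinv_0_lt_compat|].
  destruct (INR_archimed d (Rabs M)) as [N HN]; [exact Hd|].
  assert (HNp : (0 < INR (S N))%R) by (apply lt_0_INR; lia).
  exists (S N); split; [lia|]; intros z Hz k Hk.
  assert (HM : (0 <= M)%R) by (destruct Hz as [Hz _]; pose proof (Rabs_pos (Re (fst z))); lra).
  rewrite (Rabs_right M) in HN by lra.
  set (x := dilate (INR k / INR (S N)) z). set (y := dilate (INR (S k) / INR (S N)) z).
  assert (Hx : inbox M x).
  { apply inbox_dilate; [|exact Hz]. split; [apply Rle_div_r; [lra|]; rewrite Rmult_0_l; apply pos_INR|].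
    apply Rle_div_l; [lra|]. rewrite Rmult_1_l; apply le_INR; lia. }
  assert (Hyx : (Cmod (u y - u x) < / B')%R).
  { apply H; [exact Hx|]. apply near2_dilate with M; [exact Hz|].
    replace (INR (S k) / INR (S N) - INR k / INR (S N))%R with (/ INR (S N))%R
      by (rewrite (S_INR k); field; lra).
    rewrite Rabs_right by (apply Rle_ge; left; now apply Rinv_0_lt_compat).
    apply (Rmult_lt_reg_l (INR (S N))); [exact HNp|].
    rewrite <- Rmult_assoc, Rinv_r, Rmult_1_l by lra. rewrite S_INR. lra. }
  assert (Hr : (Cmod (ratio (S N) k z - 1) < 1)%R).
  { unfold ratio. fold x y.
    replace (u y / u x - 1) with ((u y - u x) * / u x) by (field; apply Hnz).
    rewrite Cmod_mult.
    assert (HBx : (Cmod (/ u x) <= B')%R).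
    { eapply Rle_trans; [now apply HB|]. unfold B'; pose proof (Rle_abs B); lra. }
    apply Rle_lt_trans with (Cmod (u y - u x) * B')%R.
    - apply Rmult_le_compat_l; [apply Cmod_ge_0|exact HBx].
    - apply (Rmult_lt_compat_r B') in Hyx; [|exact HB']. rewrite Rinv_l in Hyx by lra. exact Hyx. }
  pose proof (Re_le_Cmod (ratio (S N) k z - 1)) as Hre.
  assert (E : Re (ratio (S N) k z - 1) = (Re (ratio (S N) k z) - 1)%R) by (unfold Re; simpl; ring).
  rewrite E in Hre. apply Rabs_le_between in Hre. lra.
Qed.

Lemma continuous_dilate t z :
  continuous (dilate t : prod_UniformSpace C_UniformSpace C_UniformSpace -> prod_UniformSpace C_UniformSpace C_UniformSpace) z.
Proof.
  apply (continuous_comp_2 (fun z : prod_UniformSpace C_UniformSpace C_UniformSpace => RtoC t * fst z)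
     (fun z : prod_UniformSpace C_UniformSpace C_UniformSpace => RtoC t * snd z) (fun a b => (a, b))).
  - apply continuous_Cmult; [apply continuous_Cconst|apply continuous_fst].
  - apply continuous_Cmult; [apply continuous_Cconst|apply continuous_snd].
  - apply continuous_ext with (fun z => z); [intros [? ?]; reflexivity|]. apply continuous_id.
Qed.

Lemma continuous_log_sum M N : fine_mesh M N -> forall k z, (k <= N)%nat -> inbox M z ->
  continuous (log_sum N k : prod_UniformSpace C_UniformSpace C_UniformSpace -> C_UniformSpace) z.
Proof.
  intros [HN Hm] k z Hk Hz; induction k as [|k IH]; simpl.
  - apply continuous_Cconst.
  - apply continuous_Cplus; [apply IH; lia|].
    apply continuous_Clog; [|apply Hm; [exact Hz|lia]].
    apply continuous_Cdiv; [| |apply Hnz];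
    (apply (continuous_comp (dilate _ : prod_UniformSpace C_UniformSpace C_UniformSpace -> prod_UniformSpace C_UniformSpace C_UniformSpace) u); [apply continuous_dilate|apply Hu]).
Qed.

Lemma Cexp_log_sum M N : fine_mesh M N -> forall k z, (k <= N)%nat -> inbox M z ->
  Cexp (log_sum N k z) = u (dilate (INR k / INR N) z) / u (RtoC 0, RtoC 0).
Proof.
  intros [HN Hm] k z Hk Hz; induction k as [|k IH]; cbn [log_sum].
  - rewrite Cexp_0. simpl INR at 1. unfold dilate, Rdiv; rewrite Rmult_0_l, !Cmult_0_l.
    field; apply Hnz.
  - rewrite Cexp_plus, Cexp_Clog, IH by first [lia|apply Hm; [exact Hz|lia]].
    unfold ratio. field. split; apply Hnz.
Qed.

Lemma log_sum_0 N k : log_sum N k (RtoC 0, RtoC 0) = 0.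
Proof.
  induction k as [|k IH]; cbn [log_sum]; [reflexivity|].
  rewrite IH. unfold ratio, dilate; cbn [fst snd]. rewrite !Cmult_0_r.
  replace (u (RtoC 0, RtoC 0) / u (RtoC 0, RtoC 0)) with (RtoC 1) by (field; apply Hnz).
  rewrite Clog_1; ring.
Qed.

(** Both sums are continuous logarithms along the segment from 0 to [z]. *)
Lemma log_sum_indep M N M' N' z : fine_mesh M N -> fine_mesh M' N' -> inbox M z -> inbox M' z ->
  log_sum N N z = log_sum N' N' z.
Proof.
  intros Hm Hm' Hz Hz'.
  assert (Hray : forall t : R, continuous (fun t : R_UniformSpace => dilate t z : prod_UniformSpace C_UniformSpace C_UniformSpace) t).
  { intros t. apply (continuous_comp_2 (fun t : R_UniformSpace => RtoC t * fst z : C_UniformSpace)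
     (fun t : R_UniformSpace => RtoC t * snd z : C_UniformSpace) (fun a b => (a, b))).
    1, 2: apply continuous_Cmult; [|apply continuous_Cconst];
      apply continuous_C_components; simpl; [apply continuous_id|apply continuous_const].
    apply continuous_ext with (fun z => z); [intros [? ?]; reflexivity|]. apply continuous_id. }
  assert (E := log_path_unique (fun t => log_sum N N (dilate t z)) (fun t => log_sum N' N' (dilate t z))).
  cbv beta in E. rewrite dilate_1, dilate_0 in E.
  apply E.
  - intros t Ht. apply (continuous_comp (fun t : R_UniformSpace => dilate t z : prod_UniformSpace C_UniformSpace C_UniformSpace) (log_sum N N)); [apply Hray|].
    apply (continuous_log_sum M); [assumption|lia|now apply inbox_dilate].
  - intros t Ht. apply (continuous_comp (fun t : R_UniformSpace => dilate t z : prod_UniformSpace C_UniformSpace C_UniformSpace) (log_sum N' N')); [apply Hray|].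
    apply (continuous_log_sum M'); [assumption|lia|now apply inbox_dilate].
  - intros t Ht.
    rewrite (Cexp_log_sum M N) by first [assumption|lia|now apply inbox_dilate].
    rewrite (Cexp_log_sum M' N') by first [assumption|lia|now apply inbox_dilate].
    replace (INR N / INR N)%R with 1%R by (field; apply not_0_INR; destruct Hm; lia).
    replace (INR N' / INR N')%R with 1%R by (field; apply not_0_INR; destruct Hm'; lia).
    reflexivity.
  - rewrite !log_sum_0; reflexivity.
Qed.

(** Along each ray the logarithm is a sum of principal logarithms of ratios
    close to 1; on a box one subdivision serves all rays, which makes the
    result continuous. *)
Theorem continuous_log_exists : exists P, cont2 P /\ forall z, Cexp (P z) = u z.
Proof.
  destruct (Cexp_surjective (u (RtoC 0, RtoC 0)) (Hnz _)) as [l0 Hl0].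
  set (size := fun z : C * C => (Rabs (Re (fst z)) + Rabs (Im (fst z)) + (Rabs (Re (snd z)) + Rabs (Im (snd z))) + 1)%R).
  assert (Hsize : forall z y, near2 1 z y -> inbox (size z) y).
  { intros z y (H1 & H2 & H3 & H4).
    pose proof (Rabs_pos (Re (fst z))); pose proof (Rabs_pos (Im (fst z)));
    pose proof (Rabs_pos (Re (snd z))); pose proof (Rabs_pos (Im (snd z))).
    assert (T : forall a b, (Rabs (b - a) < 1 -> Rabs b <= Rabs a + 1)%R).
    { intros a b Hab. replace b with (a + (b - a))%R by ring.
      eapply Rle_trans; [apply Rabs_triang|]; lra. }
    apply T in H1, H2, H3, H4. unfold size; repeat split; lra. }
  assert (Hself : forall z, near2 1 z z).
  { intros z; repeat split; rewrite Rminus_diag_eq by reflexivity; rewrite Rabs_R0; lra. }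
  set (mesh := fun z => proj1_sig (constructive_indefinite_description _ (fine_mesh_exists (size z)))).
  assert (Hmesh : forall z, fine_mesh (size z) (mesh z)).
  { intros z; unfold mesh; destruct constructive_indefinite_description as [N HN]; exact HN. }
  exists (fun z => l0 + log_sum (mesh z) (mesh z) z); split.
  - intros z.
    apply (continuous_ext_loc _ (fun y : prod_UniformSpace C_UniformSpace C_UniformSpace => l0 + log_sum (mesh z) (mesh z) y)).
    + exists (mkposreal 1 Rlt_0_1); intros y Hy. apply near2_ball in Hy; simpl in Hy.
      f_equal. apply (log_sum_indep (size z) _ (size y)); auto.
    + apply continuous_Cplus; [apply continuous_Cconst|].
      apply (continuous_log_sum (size z)); auto.
  - intros z. rewrite Cexp_plus, Hl0, (Cexp_log_sum (size z)) by auto.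
    replace (INR (mesh z) / INR (mesh z))%R with 1%R
      by (field; apply not_0_INR; destruct (Hmesh z); lia).
    rewrite dilate_1. field. apply Hnz.
Qed.

End Lifting.

(** The derivative of the exponential does not vanish, so the difference
    quotient of [h] is that of [g] divided by that of the exponential. *)
Lemma cdiff_log (g h : C -> C) (z : C) : cdiff g z ->
  continuous (h : C_UniformSpace -> C_UniformSpace) z -> (forall y, Cexp (h y) = g y) -> cdiff h z.
Proof.
  intros (l & phi & Hphi & _ & Ephi) Hh He.
  destruct (der_Cexp_id (h z)) as (psi & Hpsi & Epsi0 & Epsi).
  assert (Hc : continuous (fun y : C_UniformSpace => psi (h y) : C_UniformSpace) z)
    by now apply (continuous_comp (h : C_UniformSpace -> C_UniformSpace) psi).
  assert (Hn : psi (h z) <> 0) by (rewrite Epsi0; apply Cexp_neq_0).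
  assert (Hp : (0 < Cmod (psi (h z)))%R) by now apply Cmod_gt_0.
  destruct (proj1 (continuous_C_C (fun y => psi (h y)) z) Hc _ Hp) as (d & Hd & H).
  apply cdiff_ext_loc with (f := fun y => h z + (y - z) * (phi y / psi (h y))) (d := d); [exact Hd| |].
  - intros y Hy.
    assert (Hny : psi (h y) <> 0).
    { intros E. specialize (H y Hy). rewrite E in H.
      replace (0 - psi (h z)) with (- psi (h z)) in H by ring. rewrite Cmod_opp in H. lra. }
    assert (E : (h y - h z) * psi (h y) = (y - z) * phi y).
    { transitivity (Cexp (h y) - Cexp (h z)); [rewrite (Epsi (h y)); ring|].
      rewrite !He, (Ephi y). ring. }
    replace ((y - z) * (phi y / psi (h y))) with (((y - z) * phi y) / psi (h y)) by (field; exact Hny).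
    rewrite <- E. field; exact Hny.
  - eexists; exists (fun y => phi y / psi (h y)); split; [now apply continuous_Cdiv|split; [reflexivity|]].
    intros y; ring.
Qed.

(** * Polynomial functions of one variable *)

(** Degree less than [n]; Horner form lets proofs recurse on the degree. *)
Fixpoint pol (n : nat) (f : C -> C) : Prop :=
  match n with
  | O => forall x, f x = 0
  | S m => exists (a : C) (g : C -> C), pol m g /\ forall x, f x = a + x * g x
  end.

Definition polyf (f : C -> C) : Prop := exists n, pol n f.

Lemma pol_ext n f g : (forall x, f x = g x) -> pol n f -> pol n g.
Proof.
  destruct n as [|n]; simpl.
  - intros E H x; now rewrite <- E.
  - intros E (a & h & Hh & Eh); exists a, h; split; [exact Hh|]. intros x; now rewrite <- E.
Qed.

Lemma pol_S n f : pol n f -> pol (S n) f.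
Proof.
  revert f; induction n as [|n IH]; intros f H.
  - exists 0, (fun _ => 0); split; [now intros|]. intros x; rewrite (H x); ring.
  - destruct H as (a & g & Hg & E). exists a, g; split; [now apply IH|exact E].
Qed.

Lemma pol_le n m f : (n <= m)%nat -> pol n f -> pol m f.
Proof. intros Hle H; induction Hle; [exact H|now apply pol_S]. Qed.

Lemma pol_const c : pol 1 (fun _ => c).
Proof. exists c, (fun _ => 0); split; [now intros|intros; ring]. Qed.

Lemma pol_mulx n f : pol n f -> pol (S n) (fun x => x * f x).
Proof. intros H; exists 0, f; split; [exact H|intros; ring]. Qed.

Lemma pol_plus n f g : pol n f -> pol n g -> pol n (fun x => f x + g x).
Proof.
  revert f g; induction n as [|n IH]; intros f g Hf Hg.
  - intros x; rewrite (Hf x), (Hg x); ring.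
  - destruct Hf as (a & h & Hh & E), Hg as (b & k & Hk & E').
    exists (a + b), (fun x => h x + k x); split; [now apply IH|].
    intros x; rewrite E, E'; ring.
Qed.

Lemma pol_scal n c f : pol n f -> pol n (fun x => c * f x).
Proof.
  revert f; induction n as [|n IH]; intros f Hf.
  - intros x; rewrite (Hf x); ring.
  - destruct Hf as (a & h & Hh & E). exists (c * a), (fun x => c * h x); split; [now apply IH|].
    intros x; rewrite E; ring.
Qed.

Lemma pol_mult n m f g : pol n f -> pol m g -> pol (n + m) (fun x => f x * g x).
Proof.
  revert f; induction n as [|n IH]; intros f Hf Hg.
  - apply pol_le with O; [lia|]. intros x; rewrite (Hf x); ring.
  - destruct Hf as (a & h & Hh & E).
    apply pol_ext with (fun x => a * g x + x * (h x * g x)); [intros x; rewrite E; ring|].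
    apply pol_plus.
    + apply pol_le with m; [lia|now apply pol_scal].
    + apply (pol_mulx (n + m)). now apply IH.
Qed.

Lemma pol_monomial n : pol (S n) (fun x => x ^ n).
Proof.
  induction n as [|n IH]; [apply (pol_const 1)|]. apply (pol_mulx (S n)), IH.
Qed.

Lemma contC_pol n f : pol n f -> contC f.
Proof.
  revert f; induction n as [|n IH]; intros f Hf z.
  - apply (@continuous_ext C_UniformSpace C_UniformSpace (fun _ => RtoC 0)); [intros y; symmetry; apply Hf|].
    apply continuous_Cconst.
  - destruct Hf as (a & g & Hg & E).
    apply (@continuous_ext C_UniformSpace C_UniformSpace (fun x => a + x * g x)); [intros y; symmetry; apply E|].
    apply continuous_Cplus; [apply continuous_Cconst|].
    apply continuous_Cmult; [apply continuous_id|now apply IH].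
Qed.

Lemma sum_n_horner (a : nat -> C) (x : C) d :
  sum_n (fun j => a j * x ^ j) (S d) = a O + x * sum_n (fun j => a (S j) * x ^ j) d.
Proof.
  induction d as [|d IH].
  - rewrite sum_Sn, !sum_O. unfold plus; simpl. ring.
  - rewrite sum_Sn, IH, (sum_Sn _ d). unfold plus; simpl. ring.
Qed.

Lemma polyf_polynomial1 f : polyf f <-> polynomial1 f.
Proof.
  split.
  - intros [n Hn]; revert f Hn; induction n as [|n IH]; intros f Hf.
    + exists O, (fun _ => 0); intros t. rewrite sum_O, (Hf t). ring.
    + destruct Hf as (a & g & Hg & E). destruct (IH g Hg) as (d & b & Hb).
      exists (S d), (fun j => match j with O => a | S i => b i end); intros t.
      rewrite sum_n_horner, E, Hb. reflexivity.
  - intros (d & a & H). exists (S d).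
    revert f a H; induction d as [|d IH]; intros f a H.
    + exists (a O), (fun _ => 0); split; [now intros|]. intros x; rewrite H, sum_O. simpl; ring.
    + exists (a O), (fun x => sum_n (fun j => a (S j) * x ^ j) d); split.
      * now apply IH with (fun j => a (S j)).
      * intros x; rewrite H. apply sum_n_horner.
Qed.

Lemma polyf_const c : polyf (fun _ => c).
Proof. exists 1%nat; apply pol_const. Qed.

Lemma polyf_plus f g : polyf f -> polyf g -> polyf (fun x => f x + g x).
Proof.
  intros [n Hn] [m Hm]; exists (n + m)%nat; apply pol_plus; [apply pol_le with n|apply pol_le with m]; assumption || lia.
Qed.

Lemma polyf_mult f g : polyf f -> polyf g -> polyf (fun x => f x * g x).
Proof. intros [n Hn] [m Hm]; exists (n + m)%nat; now apply pol_mult. Qed.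

Lemma polyf_scal c f : polyf f -> polyf (fun x => c * f x).
Proof. intros [n Hn]; exists n; now apply pol_scal. Qed.

Lemma polyf_ext f g : (forall x, f x = g x) -> polyf f -> polyf g.
Proof. intros E [n H]; exists n; now apply pol_ext with f. Qed.

Lemma continuous_eq_at (f g : C -> C) z :
  continuous (f : C_UniformSpace -> C_UniformSpace) z ->
  continuous (g : C_UniformSpace -> C_UniformSpace) z ->
  (forall y, y <> z -> f y = g y) -> f z = g z.
Proof.
  intros Hf Hg E; apply Ceq_eps; intros eps Heps.
  destruct (proj1 (continuous_C_C f z) Hf (eps / 2)%R) as (d1 & Hd1 & H1); [lra|].
  destruct (proj1 (continuous_C_C g z) Hg (eps / 2)%R) as (d2 & Hd2 & H2); [lra|].
  set (d := (Rmin d1 d2 / 2)%R).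
  assert (Hd : (0 < d < d1 /\ d < d2)%R).
  { assert (0 < Rmin d1 d2)%R by now apply Rmin_glb_lt.
    pose proof (Rmin_l d1 d2); pose proof (Rmin_r d1 d2). unfold d; lra. }
  set (y := z + RtoC d).
  assert (Hy : Cmod (y - z) = d).
  { unfold y. replace (z + RtoC d - z) with (RtoC d) by ring. rewrite Cmod_R, Rabs_right; lra. }
  assert (Hn : y <> z).
  { intros Ey. rewrite Ey in Hy. unfold Cminus in Hy; rewrite Cplus_opp_r, Cmod_0 in Hy. lra. }
  specialize (H1 y ltac:(lra)). specialize (H2 y ltac:(lra)). rewrite <- (E y Hn) in H2.
  assert (T := Cmod_triangle (f y - g z) (- (f y - f z))). rewrite Cmod_opp in T.
  replace (f z - g z) with (f y - g z + - (f y - f z)) by ring. lra.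
Qed.

Lemma cancel_x n m f g : pol n f -> pol m g -> (forall x : C, x * f x = x * g x) -> forall x : C, f x = g x.
Proof.
  intros Hf Hg E.
  assert (Hoff : forall x : C, x <> 0 -> f x = g x).
  { intros x Hx. replace (f x) with (/ x * (x * f x)) by (field; exact Hx).
    rewrite E. field; exact Hx. }
  intros x; destruct (Ceq_dec x 0) as [->|Hx]; [|now apply Hoff].
  apply continuous_eq_at; [now apply (contC_pol n)|now apply (contC_pol m)|exact Hoff].
Qed.

(** * Leading coefficients *)

Definition lead (n : nat) (a : C) (f : C -> C) : Prop :=
  exists g, pol n g /\ forall x, f x = a * x ^ n + g x.

Lemma lead_pol n a f : lead n a f -> pol (S n) f.
Proof.
  intros (g & Hg & E). apply pol_ext with (fun x => a * x ^ n + g x); [intros; now rewrite E|].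
  apply pol_plus; [apply pol_scal, pol_monomial|now apply pol_S].
Qed.

Lemma pol_lead n f : pol (S n) f -> exists a, lead n a f.
Proof.
  revert f; induction n as [|n IH]; intros f (b & g & Hg & E).
  - exists b, (fun _ => 0); split; [now intros|]. intros x; rewrite E, (Hg x). simpl; ring.
  - destruct (IH g Hg) as (a & h & Hh & Eh). exists a, (fun x => b + x * h x); split.
    + exists b, h; split; [exact Hh|reflexivity].
    + intros x; rewrite E, Eh. simpl; ring.
Qed.

Lemma pol_lead_or_zero n f : pol n f -> (forall x, f x = 0) \/ exists m (a : C), a <> 0 /\ lead m a f.
Proof.
  revert f; induction n as [|n IH]; intros f Hf; [now left|].
  destruct (pol_lead n f Hf) as (a & Ha).
  destruct (Ceq_dec a 0) as [->|Hn].
  - apply IH. destruct Ha as (g & Hg & E). apply pol_ext with g; [|exact Hg].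
    intros x; rewrite E; ring.
  - right; exists n, a; now split.
Qed.

Lemma polyf_lead f x : polyf f -> f x <> 0 -> exists m (a : C), a <> 0 /\ lead m a f.
Proof.
  intros [n Hn] Hx; destruct (pol_lead_or_zero n f Hn) as [H|H]; [|exact H].
  now elim Hx.
Qed.

Lemma lead_mult n m a b f g : lead n a f -> lead m b g -> lead (n + m) (a * b) (fun x => f x * g x).
Proof.
  intros (h & Hh & E) (k & Hk & E').
  exists (fun x => (a * (x ^ n * k x) + b * (h x * x ^ m)) + h x * k x); split.
  - apply pol_plus; [apply pol_plus|now apply pol_mult].
    + clear - Hk. apply pol_scal. induction n as [|n IH].
      * apply pol_ext with k; [intros; simpl; ring|exact Hk].
      * apply pol_ext with (fun x => x * (x ^ n * k x)); [intros; simpl; ring|].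
        now apply (pol_mulx (n + m)).
    + clear - Hh. apply pol_scal. induction m as [|m IH].
      * rewrite Nat.add_0_r. apply pol_ext with h; [intros; simpl; ring|exact Hh].
      * rewrite Nat.add_succ_r. apply pol_ext with (fun x => x * (h x * x ^ m)); [intros; simpl; ring|].
        now apply pol_mulx.
  - intros x; rewrite E, E', Cpow_add_r. ring.
Qed.

Lemma monomial_not_pol n (a : C) f : pol n f -> (forall x, f x = a * x ^ n) -> a = 0.
Proof.
  revert f; induction n as [|n IH]; intros f Hf E.
  - specialize (E 0). rewrite (Hf 0) in E. simpl in E. rewrite E; ring.
  - destruct Hf as (b & g & Hg & Eg).
    assert (Hb : b = 0).
    { assert (E0 := E 0). rewrite Eg in E0. simpl in E0.
      replace b with (b + 0 * g 0) by ring. rewrite E0; ring. }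
    apply (IH g Hg).
    apply (cancel_x n (S n) g (fun x => a * x ^ n)); [exact Hg|apply pol_scal, pol_monomial|].
    intros x. replace (x * g x) with (f x) by (rewrite Eg, Hb; ring). rewrite E. simpl; ring.
Qed.

Lemma lead_not_pol n (a : C) f : a <> 0 -> lead n a f -> ~ pol n f.
Proof.
  intros Ha (g & Hg & E) Hf. apply Ha.
  apply (monomial_not_pol n a (fun x => f x + - (1) * g x)).
  - apply pol_plus; [exact Hf|now apply pol_scal].
  - intros x; rewrite E; ring.
Qed.

(** Nonzero leading coefficients multiply to a nonzero one. *)
Lemma polyf_mult_nonzero f g x y : polyf f -> polyf g -> f x <> 0 -> g y <> 0 ->
  exists z, f z * g z <> 0.
Proof.
  intros Hf Hg Hx Hy.
  destruct (polyf_lead f x Hf Hx) as (n & a & Ha & La).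
  destruct (polyf_lead g y Hg Hy) as (m & b & Hb & Lb).
  apply NNPP; intros Hno.
  apply (lead_not_pol (n + m) (a * b) (fun z => f z * g z)).
  - now apply Cmult_neq_0.
  - now apply lead_mult.
  - apply pol_le with O; [lia|]. intros z; apply NNPP; intros Hz; apply Hno; eauto.
Qed.

Lemma pol_factor n f a : pol (S n) f -> exists g, pol n g /\ forall x, f x = f a + (x - a) * g x.
Proof.
  revert f; induction n as [|n IH]; intros f (b & g & Hg & E).
  - exists (fun _ => 0); split; [now intros|]. intros x; rewrite !E, !Hg; ring.
  - destruct (IH g Hg) as (h & Hh & Eh).
    exists (fun x => g a + x * h x); split.
    + exists (g a), h; split; [exact Hh|reflexivity].
    + intros x; rewrite !E, (Eh x). ring.
Qed.

Lemma pol_many_roots n f (y : nat -> C) : pol n f -> (forall i j, y i = y j -> i = j) ->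
  (forall k, f (y k) = 0) -> forall x, f x = 0.
Proof.
  revert f y; induction n as [|n IH]; intros f y Hf Hy H0; [exact Hf|].
  destruct (pol_factor n f (y O) Hf) as (g & Hg & E).
  assert (Hg0 : forall x, g x = 0).
  { apply (IH g (fun k => y (S k)) Hg).
    - intros i j Hij; apply Hy in Hij; lia.
    - intros k. assert (Ek := E (y (S k))). rewrite !H0 in Ek.
      assert (Hn : y (S k) - y O <> 0).
      { intros Z; apply Ceq_minus, Hy in Z; lia. }
      replace (g (y (S k))) with (/ (y (S k) - y O) * (0 + (y (S k) - y O) * g (y (S k)))) by (field; exact Hn).
      rewrite <- Ek; ring. }
  intros x; rewrite E, H0, Hg0; ring.
Qed.

(** A period gives infinitely many roots of [f - f 0]. *)
Lemma polyf_periodic_const f (h : nat) : (0 < h)%nat -> polyf f ->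
  (forall x, f (x + RtoC (INR h)) = f x) -> forall x, f x = f 0.
Proof.
  intros Hh [n Hn] Hp.
  assert (Hk : forall k : nat, f (RtoC (INR (k * h))) = f 0).
  { induction k as [|k IH]; [reflexivity|].
    replace (RtoC (INR (S k * h))) with (RtoC (INR (k * h)) + RtoC (INR h)).
    - now rewrite Hp.
    - rewrite <- RtoC_plus, <- plus_INR. f_equal; f_equal; lia. }
  assert (H0 : forall x, f x + - (1) * f 0 = 0).
  { apply (pol_many_roots (n + 1) (fun x => f x + - (1) * f 0) (fun k => RtoC (INR (k * h)))).
    - apply pol_plus; [apply pol_le with n; [lia|exact Hn]|].
      apply pol_le with 1%nat; [lia|]. apply (pol_const (- (1) * f 0)).
    - intros i j E. apply RtoC_inj, INR_eq in E. nia.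
    - intros k; rewrite Hk; ring. }
  intros x. specialize (H0 x). replace (f x) with ((f x + - (1) * f 0) + f 0) by ring.
  rewrite H0; ring.
Qed.

(** * Derivatives of polynomials *)

Lemma der_unique f z l l' : der f z l -> der f z l' -> l = l'.
Proof.
  intros (p & Hp & <- & Ep) (q & Hq & <- & Eq).
  apply continuous_eq_at; [exact Hp|exact Hq|].
  intros y Hy. assert (Hn : y - z <> 0) by now apply Cminus_eq_contra.
  assert (E : (y - z) * p y = (y - z) * q y).
  { transitivity (f y - f z); [rewrite (Ep y); ring|rewrite (Eq y); ring]. }
  replace (p y) with (/ (y - z) * ((y - z) * p y)) by (field; exact Hn). rewrite E. field; exact Hn.
Qed.

Lemma pol_der n f : pol (S n) f -> exists f', pol n f' /\ forall z, der f z (f' z).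
Proof.
  revert f; induction n as [|n IH]; intros f (a & g & Hg & E).
  - exists (fun _ => 0); split; [now intros|]. intros z.
    apply der_ext with (fun _ => a); [intros x; rewrite E, Hg; ring|apply der_const].
  - destruct (IH g Hg) as (g' & Hg' & Dg).
    exists (fun x => g x + x * g' x); split.
    + apply pol_plus; [exact Hg|now apply pol_mulx].
    + intros z. apply der_ext with (fun x => a + x * g x); [intros; now rewrite E|].
      replace (g z + z * g' z) with (0 + (1 * g z + z * g' z)) by ring.
      apply der_plus; [apply der_const|]. apply (der_mult (fun x => x) g); [apply der_id|apply Dg].
Qed.

Lemma polyf_der f : polyf f -> exists f', polyf f' /\ forall z, der f z (f' z).
Proof.
  intros [n Hn]. destruct (pol_der n f (pol_S n f Hn)) as (f' & Hf' & D).
  exists f'; split; [now exists n|exact D].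
Qed.

Lemma monomial_der k z : der (fun x => x ^ S k) z (RtoC (INR (S k)) * z ^ k).
Proof.
  induction k as [|k IH].
  - apply der_ext with (fun x => x); [intros; simpl; ring|].
    replace (RtoC (INR 1) * z ^ 0) with (RtoC 1) by (simpl; ring). apply der_id.
  - apply der_ext with (fun x => x * x ^ S k); [intros; simpl; ring|].
    replace (RtoC (INR (S (S k))) * z ^ S k) with (1 * z ^ S k + z * (RtoC (INR (S k)) * z ^ k)).
    + apply (der_mult (fun x => x) (fun x => x ^ S k)); [apply der_id|exact IH].
    + rewrite (S_INR (S k)), RtoC_plus. simpl (z ^ S k). ring.
Qed.

(** [q = q 0 + x g] with [g] nonzero, so [q] has positive degree, which
    differentiation lowers by one without losing the leading coefficient. *)
Lemma nonconst_der_lead q q' x : polyf q -> q x <> q 0 -> (forall z, der q z (q' z)) ->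
  exists k (b : C), b <> 0 /\ lead k b q'.
Proof.
  intros Hq Hx Dq.
  destruct Hq as [n Hn]. destruct (pol_factor n q 0 (pol_S n q Hn)) as (g & Hg & E).
  assert (Hgx : g x <> 0).
  { intros Z; apply Hx; rewrite E, Z; ring. }
  destruct (polyf_lead g x (ex_intro _ n Hg) Hgx) as (k & a & Ha & h & Hh & Eh).
  assert (HS : RtoC (INR (S k)) <> 0) by (apply RtoC_neq0, not_0_INR; lia).
  exists k, (RtoC (INR (S k)) * a); split; [now apply Cmult_neq_0|].
  destruct (pol_der k (fun x => q 0 + x * h x)) as (r & Hr & Dr).
  { exists (q 0), h; split; [exact Hh|reflexivity]. }
  exists r; split; [exact Hr|]. intros z.
  apply (der_unique q z); [apply Dq|].
  apply der_ext with (fun x => a * x ^ S k + (q 0 + x * h x)).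
  { intros y; rewrite (E y), Eh. simpl; ring. }
  apply der_plus; [|apply Dr].
  replace (RtoC (INR (S k)) * a * z ^ k) with (0 * z ^ S k + a * (RtoC (INR (S k)) * z ^ k)) by ring.
  apply (der_mult (fun _ => a)); [apply der_const|apply monomial_der].
Qed.

(** Degrees: [q' R] has degree at least that of [R], but [R'] has less. *)
Lemma no_polynomial_exponential R q R' q' x : polyf R -> polyf q -> q x <> q 0 ->
  (forall z, der R z (R' z)) -> (forall z, der q z (q' z)) ->
  (forall z, R' z = q' z * R z) -> forall z, R z = 0.
Proof.
  intros HR Hq Hx DR Dq E z. apply NNPP; intros Hz.
  destruct (nonconst_der_lead q q' x Hq Hx Dq) as (k & b & Hb & Lb).
  destruct (polyf_lead R z HR Hz) as (n & a & Ha & La).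
  destruct (pol_der n R (lead_pol n a R La)) as (r & Hr & Dr).
  apply (lead_not_pol (k + n) (b * a) (fun z => q' z * R z)).
  - now apply Cmult_neq_0.
  - now apply lead_mult.
  - apply pol_le with n; [lia|]. apply pol_ext with r; [|exact Hr].
    intros y; rewrite <- E. apply (der_unique R y); [apply Dr|apply DR].
Qed.

(** * Borel's lemma for polynomial exponents *)

Definition exp_sum (l : list ((C -> C) * (C -> C))) (x : C) : C :=
  fold_right (fun p s => fst p x * Cexp (snd p x) + s) 0 l.

Definition nonconst_terms (l : list ((C -> C) * (C -> C))) : Prop :=
  List.Forall (fun p : (C -> C) * (C -> C) => polyf (fst p) /\ polyf (snd p) /\ exists x : C, snd p x <> snd p 0) l.

(** Differentiating [exp (- q)] times the sum replaces each coefficient [P]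
    with exponent [p] by [P' + (p' - q') P]. *)
Lemma exp_sum_twist_der l q q' : nonconst_terms l -> (forall z, der q z (q' z)) -> polyf q' ->
  exists l', length l' = length l /\ nonconst_terms l' /\
    forall z, der (fun x => exp_sum l x * Cexp (- q x)) z (exp_sum l' z * Cexp (- q z)).
Proof.
  intros Hl Dq Hq'; induction Hl as [|[P p] l (HP & Hp & Hn) Hl IH].
  - exists nil; split; [reflexivity|split; [constructor|]]. intros z; simpl.
    rewrite Cmult_0_l. apply der_ext with (fun _ => 0); [intros; ring|apply der_const].
  - destruct IH as (l' & Hlen & Hl' & D).
    simpl in HP, Hp, Hn.
    destruct (polyf_der P HP) as (P' & HP' & DP). destruct (polyf_der p Hp) as (p' & Hp' & Dp).
    exists (((fun x => P' x + (p' x + - (1) * q' x) * P x), p) :: l'); split; [simpl; now rewrite Hlen|split].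
    + constructor; [|exact Hl']. simpl; split; [|now split].
      apply polyf_plus; [exact HP'|]. apply polyf_mult; [|exact HP].
      apply polyf_plus; [exact Hp'|now apply polyf_scal].
    + intros z; simpl.
      apply der_ext with (fun x => P x * Cexp (p x + - (1) * q x) + exp_sum l x * Cexp (- q x)).
      { intros x. replace (p x + - (1) * q x) with (p x + - q x) by ring. rewrite Cexp_plus. ring. }
      replace (((P' z + (p' z + - (1) * q' z) * P z) * Cexp (p z) + exp_sum l' z) * Cexp (- q z)) with
        (P' z * Cexp (p z + - (1) * q z) + P z * ((p' z + (0 * q z + - (1) * q' z)) * Cexp (p z + - (1) * q z)) + exp_sum l' z * Cexp (- q z)).
      * apply der_plus; [|apply D]. apply (der_mult P (fun x => Cexp (p x + - (1) * q x))); [apply DP|].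
        apply (der_Cexp (fun x => p x + - (1) * q x)). apply der_plus; [apply Dp|].
        apply (der_mult (fun _ => - (1))); [apply der_const|apply Dq].
      * replace (p z + - (1) * q z) with (p z + - q z) by ring. rewrite Cexp_plus. ring.
Qed.

(** Dividing by one exponential [exp q] and differentiating until its
    coefficient disappears shortens the sum and turns [R] into
    [(d/dx - q')^n R], which vanishes only with [R]. *)
Lemma borel_1 k : forall l, length l = k -> forall R, nonconst_terms l -> polyf R ->
  (forall x, exp_sum l x = R x) -> forall x, R x = 0.
Proof.
  induction k as [|k IHk]; intros l Hk R Hl HR E.
  - destruct l; [|discriminate]. intros x; rewrite <- E; reflexivity.
  - destruct l as [|[P q] l]; [discriminate|]. injection Hk as Hk.
    inversion Hl as [|? ? (HP & Hq & y & Hy) Hl']; subst. simpl in HP, Hq, Hy. clear Hl.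
    destruct (polyf_der q Hq) as (q' & Hq' & Dq).
    destruct HP as [n Hn].
    revert P l R Hn Hl' HR E IHk; induction n as [|n IHn]; intros P l R Hn Hl' HR E IHk.
    + apply (IHk l eq_refl R Hl' HR). intros x; rewrite <- E. simpl. rewrite (Hn x). ring.
    + destruct (pol_der n P Hn) as (P' & HP' & DP).
      destruct (polyf_der R HR) as (R' & HR' & DR).
      destruct (exp_sum_twist_der l q q' Hl' Dq Hq') as (l' & Hlen & Hl'' & D).
      assert (Key : forall z, R' z + - (1) * (q' z * R z) = 0).
      { rewrite <- Hlen in IHk.
        apply (IHn P' l' (fun z => R' z + - (1) * (q' z * R z)) HP' Hl'').
        - apply polyf_plus; [exact HR'|]. apply polyf_scal, polyf_mult; assumption.
        - intros z.
          assert (D1 : der (fun x => P x + exp_sum l x * Cexp (- q x)) z (P' z + exp_sum l' z * Cexp (- q z)))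
            by (apply der_plus; [apply DP|apply D]).
          assert (D2 : der (fun x => R x * Cexp (- (1) * q x)) z
              (R' z * Cexp (- (1) * q z) + R z * ((0 * q z + - (1) * q' z) * Cexp (- (1) * q z)))).
          { apply (der_mult R (fun x => Cexp (- (1) * q x))); [apply DR|]. apply (der_Cexp (fun x => - (1) * q x)).
            apply (der_mult (fun _ => - (1)) q); [apply der_const|apply Dq]. }
          assert (Hopp : forall x, - (1) * q x = - q x) by (intros; ring).
          assert (D3 : der (fun x => P x + exp_sum l x * Cexp (- q x)) z
              (R' z * Cexp (- (1) * q z) + R z * ((0 * q z + - (1) * q' z) * Cexp (- (1) * q z)))).
          { refine (der_ext _ _ _ _ _ D2). intros x; rewrite <- E, Hopp, Cexp_opp. simpl.
            field. apply Cexp_neq_0. }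
          assert (Eq := der_unique _ _ _ _ D1 D3). rewrite Hopp, Cexp_opp in Eq.
          assert (Hz := Cexp_neq_0 (q z)).
          simpl.
          replace (P' z * Cexp (q z) + exp_sum l' z) with ((P' z + exp_sum l' z * / Cexp (q z)) * Cexp (q z)) by (field; exact Hz).
          rewrite Eq. field; exact Hz.
        - exact IHk. }
      apply (no_polynomial_exponential R q R' q' y HR Hq Hy DR Dq).
      intros z. replace (R' z) with ((R' z + - (1) * (q' z * R z)) + q' z * R z) by ring.
      rewrite Key; ring.
Qed.

(** * Functions on C^2 that are polynomial on every complex line *)

Definition on_line (F : C * C -> C) (z v : C * C) (w : C) : C :=
  F (fst z + w * fst v, snd z + w * snd v).

(** Polynomial on every complex line.  No coefficients in two variables occur,
    and the degree may depend on the line. *)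
Definition line_poly (F : C * C -> C) : Prop := forall z v, polyf (on_line F z v).

Definition constant_fun (F : C * C -> C) : Prop := forall z, F z = F (RtoC 0, RtoC 0).

Lemma line_poly_const c : line_poly (fun _ => c).
Proof. intros z v; apply (polyf_const c). Qed.

Lemma line_poly_plus F G : line_poly F -> line_poly G -> line_poly (fun z => F z + G z).
Proof. intros HF HG z v; apply (polyf_plus (on_line F z v) (on_line G z v)); auto. Qed.

Lemma line_poly_mult F G : line_poly F -> line_poly G -> line_poly (fun z => F z * G z).
Proof. intros HF HG z v; apply (polyf_mult (on_line F z v) (on_line G z v)); auto. Qed.

Lemma line_poly_scal c F : line_poly F -> line_poly (fun z => c * F z).
Proof. intros HF z v; apply (polyf_scal c (on_line F z v)); auto. Qed.

Lemma line_poly_shift F c : line_poly F -> line_poly (fun z => F (shift c z)).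
Proof.
  intros HF z v. apply polyf_ext with (on_line F (shift c z) v); [|apply HF].
  intros x; unfold on_line, shift; simpl. f_equal; f_equal; ring.
Qed.

Lemma on_line_0 F z v : on_line F z v 0 = F z.
Proof. unfold on_line; rewrite !Cmult_0_l, !Cplus_0_r; now rewrite <- surjective_pairing. Qed.

Lemma on_line_ray_1 F z : on_line F (RtoC 0, RtoC 0) z 1 = F z.
Proof. unfold on_line; simpl; rewrite !Cmult_1_l, !Cplus_0_l; now rewrite <- surjective_pairing. Qed.

Lemma line_poly_mult_nonzero F G x y : line_poly F -> line_poly G -> F x <> 0 -> G y <> 0 ->
  exists z, F z * G z <> 0.
Proof.
  intros HF HG Hx Hy.
  set (v := (fst y - fst x, snd y - snd x) : C * C).
  destruct (polyf_mult_nonzero (on_line F x v) (on_line G x v) 0 1) as [w Hw]; auto.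
  - now rewrite on_line_0.
  - unfold on_line, v; simpl.
    replace (fst x + 1 * (fst y - fst x)) with (fst y) by ring.
    replace (snd x + 1 * (snd y - snd x)) with (snd y) by ring.
    now rewrite <- surjective_pairing.
  - eexists; exact Hw.
Qed.

(** The product of the functions [F - F 0] is nonzero: two functions nonzero at
    [x] and [y] restrict to nonzero polynomials on the line through [x] and
    [y].  Any point where the product does not vanish will do. *)
Lemma common_nonconst_direction (l : list (C * C -> C)) :
  List.Forall (fun F => line_poly F /\ ~ constant_fun F) l ->
  exists x, List.Forall (fun F => F x <> F (RtoC 0, RtoC 0)) l.
Proof.
  intros Hl.
  assert (H : exists H, line_poly H /\ (exists x, H x <> 0) /\
     forall x, H x <> 0 -> List.Forall (fun F => F x <> F (RtoC 0, RtoC 0)) l).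
  { induction Hl as [|F l (HF & Hn) Hl (G & HG & (x & Hx) & IH)].
    - exists (fun _ => 1); split; [apply line_poly_const|split].
      + exists (RtoC 0, RtoC 0); apply C1_nz.
      + constructor.
    - set (F0 := fun z => F z + - F (RtoC 0, RtoC 0)).
      assert (HF0 : line_poly F0) by (apply line_poly_plus; [exact HF|apply (line_poly_const (- F (RtoC 0, RtoC 0)))]).
      assert (Hy : exists y, F0 y <> 0).
      { apply NNPP; intros Hno; apply Hn; intros z. apply Ceq_minus.
        apply NNPP; intros Hz; apply Hno; now exists z. }
      destruct Hy as [y Hy].
      exists (fun z => F0 z * G z); split; [now apply line_poly_mult|split].
      + now apply (line_poly_mult_nonzero F0 G y x).
      + intros z Hz; constructor.
        * intros E; apply Hz. unfold F0; rewrite E; ring.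
        * apply IH; intros E; apply Hz; rewrite E; ring. }
  destruct H as (H & _ & (x & Hx) & HH). exists x; now apply HH.
Qed.

Definition exp_sum2 (l : list (C * (C * C -> C))) (z : C * C) : C :=
  fold_right (fun p s => fst p * Cexp (snd p z) + s) 0 l.

(** Restrict to a line through 0 on which no exponent is constant. *)
Lemma borel_2 (l : list (C * (C * C -> C))) (a : C) :
  List.Forall (fun p => line_poly (snd p) /\ ~ constant_fun (snd p)) l ->
  (forall z, exp_sum2 l z = a) -> a = 0.
Proof.
  intros Hl E.
  destruct (common_nonconst_direction (map snd l)) as [x Hx].
  { rewrite List.Forall_map; exact Hl. }
  rewrite List.Forall_map in Hx.
  set (l1 := map (fun p : C * (C * C -> C) => ((fun _ : C => fst p), on_line (snd p) (RtoC 0, RtoC 0) x)) l).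
  apply (borel_1 (length l1) l1 eq_refl (fun _ => a)).
  - unfold nonconst_terms, l1. rewrite List.Forall_map. simpl.
    apply List.Forall_forall; intros p Hp.
    rewrite List.Forall_forall in Hl, Hx. destruct (Hl p Hp) as [Hp1 _].
    split; [apply polyf_const|split; [apply Hp1|]].
    exists 1. rewrite on_line_ray_1, on_line_0. now apply Hx.
  - apply polyf_const.
  - intros w. rewrite <- (E (fst (RtoC 0, RtoC 0) + w * fst x, snd (RtoC 0, RtoC 0) + w * snd x)).
    unfold l1, exp_sum, exp_sum2. clear. induction l as [|p l IH]; [reflexivity|].
    cbn [map fold_right]. rewrite IH. reflexivity.
  - exact 0.
Qed.

(** * Entire functions of finite order *)

Lemma entire_cont2 f : entire f -> cont2 f.
Proof. intros Hf z. apply (@filterdiff_continuous C_AbsRing C2_NormedModule C_NormedModule f z), Hf. Qed.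

Lemma entire_on_line f z v w : entire f -> cdiff (on_line f z v) w.
Proof.
  intros Hf.
  set (pt := fun y : C => (fst z + y * fst v, snd z + y * snd v) : C2_NormedModule).
  destruct (Hf (pt w)) as [l [Hlin Hdom]].
  specialize (Hdom (pt w) (fun P H => H)).
  set (N := norm (v : C2_NormedModule)).
  assert (HN : (0 <= N)%R) by apply norm_ge_0.
  exists (l v); apply der_intro.
  intros eps Heps.
  assert (He : (0 < eps / (N + 1))%R) by (apply Rdiv_lt_0_compat; lra).
  destruct (Hdom (mkposreal _ He)) as [d Hd].
  set (V := (Cmod (fst v) + Cmod (snd v) + 1)%R).
  pose proof (Cmod_ge_0 (fst v)) as V1; pose proof (Cmod_ge_0 (snd v)) as V2.
  assert (HV : (0 < V)%R) by (unfold V; lra).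
  exists (d / V)%R; split; [apply Rdiv_lt_0_compat; [apply cond_pos|exact HV]|]. intros y Hy.
  assert (Hy' : (Cmod (y - w) * V < d)%R) by (apply Rlt_div_r in Hy; [exact Hy|exact HV]).
  pose proof (Cmod_ge_0 (y - w)) as Hyw.
  assert (Hdiff : minus (pt y) (pt w) = @scal C_AbsRing C2_NormedModule (y - w) v).
  { unfold pt; destruct v as [v1 v2]. unfold minus, plus, opp, scal; simpl.
    unfold prod_plus, prod_opp, prod_scal; simpl. unfold plus, opp, scal; simpl. unfold mult; simpl.
    f_equal; ring. }
  assert (Hball : ball (pt w) d (pt y)).
  { split; apply C_NormedModule_mixin_compat1; unfold pt; simpl; unfold minus, plus, opp; simpl.
    - replace (fst z + y * fst v + - (fst z + w * fst v)) with ((y - w) * fst v) by ring.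
      rewrite Cmod_mult. unfold V in Hy'. nra.
    - replace (snd z + y * snd v + - (snd z + w * snd v)) with ((y - w) * snd v) by ring.
      rewrite Cmod_mult. unfold V in Hy'. nra. }
  specialize (Hd _ Hball). rewrite Hdiff, (linear_scal l Hlin) in Hd.
  assert (Hs := norm_scal (y - w : C_AbsRing) (v : C2_NormedModule)). fold N in Hs.
  change (abs (y - w : C_AbsRing)) with (Cmod (y - w)) in Hs.
  change (Cmod (on_line f z v y - on_line f z v w - (y - w) * l v) <=
    eps / (N + 1) * norm (@scal C_AbsRing C2_NormedModule (y - w)%C v))%R in Hd.
  replace (l v * (y - w)) with ((y - w) * l v) by ring.
  eapply Rle_trans; [exact Hd|].
  apply Rle_trans with (eps / (N + 1) * (Cmod (y - w) * N))%R.
  - apply Rmult_le_compat_l; [lra|exact Hs].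
  - apply Rle_trans with (eps / (N + 1) * (Cmod (y - w) * (N + 1)))%R.
    + apply Rmult_le_compat_l; [lra|]. nra.
    + right; field; lra.
Qed.

Definition norm1 (z : C * C) : R := (Cmod (fst z) + Cmod (snd z))%R.

Lemma norm1_ge_0 z : (0 <= norm1 z)%R.
Proof. unfold norm1; pose proof (Cmod_ge_0 (fst z)); pose proof (Cmod_ge_0 (snd z)); lra. Qed.

(** Finite order in a form stable under sums, shifts and restriction to lines. *)
Definition exp_growth (f : C * C -> C) : Prop :=
  exists (B : R) (m : nat), (0 <= B)%R /\ forall z, (Cmod (f z) <= exp (B * (1 + norm1 z) ^ m))%R.

Lemma Cmod_le_C2norm z : (Cmod (fst z) <= C2norm z /\ Cmod (snd z) <= C2norm z)%R.
Proof.
  unfold C2norm. pose proof (Cmod_ge_0 (fst z)); pose proof (Cmod_ge_0 (snd z)).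
  split; (rewrite <- (sqrt_pow2 (Cmod _)) at 1 by assumption); apply sqrt_le_1_alt; nra.
Qed.

Lemma C2norm_le_norm1 z : (C2norm z <= norm1 z)%R.
Proof.
  unfold C2norm, norm1. pose proof (Cmod_ge_0 (fst z)); pose proof (Cmod_ge_0 (snd z)).
  rewrite <- (sqrt_pow2 (Cmod (fst z) + Cmod (snd z))) by lra.
  apply sqrt_le_1_alt. nra.
Qed.

(** The supremum is finite because [f] is bounded on the ball, so taking its
    real part is harmless. *)
Lemma max_modulus_ge f z r : cont2 f -> (C2norm z <= r)%R -> (Cmod (f z) <= max_modulus f r)%R.
Proof.
  intros Hf Hz. unfold max_modulus.
  set (E := fun m : R => exists z, (C2norm z <= r)%R /\ m = Cmod (f z)).
  destruct (bounded_box f Hf r) as [B HB].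
  assert (Hub : is_ub_Rbar E (Finite B)).
  { intros m (y & Hy & ->). simpl. apply HB.
    destruct (Cmod_le_C2norm y) as [H1 H2].
    pose proof (Re_le_Cmod (fst y)); pose proof (Im_le_Cmod (fst y));
    pose proof (Re_le_Cmod (snd y)); pose proof (Im_le_Cmod (snd y)).
    repeat split; lra. }
  destruct (Lub_Rbar_correct E) as [H1 H2].
  assert (Hle := H2 _ Hub).
  assert (Hge : Rbar_le (Finite (Cmod (f z))) (Lub_Rbar E)) by (apply H1; now exists z).
  destruct (Lub_Rbar E) as [l| |]; simpl in *; [exact Hge|contradiction|contradiction].
Qed.

(** Beyond some radius the quotient defining the order stays below an integer
    [m], that is [M(r) <= exp (r^m)]; taking [r = r1 (1 + |z|)] covers all [z]. *)
Lemma finite_order_growth f : entire f -> finite_order f -> exp_growth f.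
Proof.
  intros Hf Ho. apply entire_cont2 in Hf.
  unfold finite_order, order, limsup_infty in Ho.
  set (g := fun r => (lnp (lnp (max_modulus f r)) / ln r)%R) in Ho.
  set (S := fun s => exists r0 : R, s = Lub_Rbar (fun y => exists r : R, (r0 < r)%R /\ y = g r)) in Ho.
  assert (Hglb : forall b, Rbar_is_lower_bound S b -> Rbar_le b (Rbar_glb S)).
  { destruct (Rbar_ex_glb S) as [l Hl]. rewrite (Rbar_is_glb_unique S l Hl). apply Hl. }
  set (o := real (Rbar_glb S)). change (Finite o = Rbar_glb S) in Ho.
  assert (Hex : exists r0, Rbar_lt (Lub_Rbar (fun y => exists r : R, (r0 < r)%R /\ y = g r)) (Finite (o + 1))).
  { apply NNPP; intros Hno.
    assert (Hlb : Rbar_le (Finite (o + 1)) (Rbar_glb S)).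
    { apply Hglb. intros s (r0 & ->). apply Rbar_not_lt_le. intros Hl; apply Hno; now exists r0. }
    rewrite <- Ho in Hlb. simpl in Hlb. lra. }
  destruct Hex as [r0 Hr0].
  destruct (Lub_Rbar_correct (fun y => exists r : R, (r0 < r)%R /\ y = g r)) as [Hub _].
  assert (Hg : forall r, (r0 < r)%R -> (g r <= o + 1)%R).
  { intros r Hr. assert (H := Hub (g r) (ex_intro _ r (conj Hr eq_refl))).
    apply Rbar_lt_le in Hr0. exact (Rbar_le_trans _ _ _ H Hr0). }
  destruct (INR_unbounded (o + 1)) as [m Hm].
  assert (HM : forall r, (r0 < r)%R -> (2 <= r)%R -> (max_modulus f r <= exp (r ^ m))%R).
  { intros r Hr Hr2. specialize (Hg r Hr). unfold g in Hg.
    assert (Hln : (0 < ln r)%R) by (rewrite <- ln_1; apply ln_increasing; lra).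
    assert (Hrm : (0 < r ^ m)%R) by (apply pow_lt; lra).
    assert (Hlp : forall x, (lnp x <= exp (lnp (lnp x)))%R /\ (x <= exp (lnp x))%R).
    { assert (Hb : forall x, (x <= exp (lnp x))%R).
      { intros x; unfold lnp. rewrite exp_ln; [apply Rmax_r|].
        apply Rlt_le_trans with 1%R; [lra|apply Rmax_l]. }
      intros x; split; apply Hb. }
    eapply Rle_trans; [apply Hlp|]. apply exp_le_compat.
    eapply Rle_trans; [apply Hlp|].
    rewrite <- (exp_ln (r ^ m)) by exact Hrm. apply exp_le_compat.
    rewrite ln_pow by lra.
    apply Rle_div_l in Hg; [|lra]. nra. }
  set (r1 := (Rabs r0 + 2)%R).
  assert (Hr1 : (2 <= r1 /\ r0 < r1)%R).
  { unfold r1; pose proof (Rabs_pos r0); pose proof (Rle_abs r0); lra. }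
  exists (r1 ^ m)%R, m; split; [apply pow_le; lra|]. intros z.
  pose proof (C2norm_le_norm1 z) as Hn. pose proof (norm1_ge_0 z) as Hn0.
  eapply Rle_trans; [apply (max_modulus_ge f z (r1 * (1 + norm1 z))%R Hf); nra|].
  rewrite <- Rpow_mult_distr. apply HM; nra.
Qed.

Lemma exp_growth_plus f g : exp_growth f -> exp_growth g -> exp_growth (fun z => f z + g z).
Proof.
  intros (B & m & HB & Hf) (B' & m' & HB' & Hg).
  exists (B + B' + 1)%R, (m + m')%nat; split; [lra|]. intros z.
  pose proof (norm1_ge_0 z) as Hn. set (n := (1 + norm1 z)%R) in *.
  assert (Hn1 : (1 <= n)%R) by (unfold n; lra).
  assert (H1 : (n ^ m <= n ^ (m + m'))%R) by (apply Rle_pow; [exact Hn1|lia]).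
  assert (H2 : (n ^ m' <= n ^ (m + m'))%R) by (apply Rle_pow; [exact Hn1|lia]).
  assert (H3 : (1 <= n ^ (m + m'))%R) by now apply pow_R1_Rle.
  set (M := (n ^ (m + m'))%R) in *.
  assert (E : forall x, (x <= (B + B') * M -> exp x <= exp ((B + B') * M))%R) by (intros; now apply exp_le_compat).
  eapply Rle_trans; [apply Cmod_triangle|].
  assert (F1 : (Cmod (f z) <= exp ((B + B') * M))%R).
  { eapply Rle_trans; [apply Hf|]. fold n. apply E. nra. }
  assert (F2 : (Cmod (g z) <= exp ((B + B') * M))%R).
  { eapply Rle_trans; [apply Hg|]. fold n. apply E. nra. }
  apply Rle_trans with (exp ((B + B') * M) * exp 1)%R.
  - pose proof (exp_pos ((B + B') * M)). pose proof (exp_ineq1 1 ltac:(lra)). nra.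
  - rewrite <- exp_plus. apply exp_le_compat. nra.
Qed.

Lemma exp_growth_scal c f : exp_growth f -> exp_growth (fun z => c * f z).
Proof.
  intros (B & m & HB & Hf). pose proof (Cmod_ge_0 c) as Hc.
  exists (B + Cmod c)%R, m; split; [lra|]. intros z.
  pose proof (norm1_ge_0 z) as Hn.
  assert (H3 : (1 <= (1 + norm1 z) ^ m)%R) by (apply pow_R1_Rle; lra).
  rewrite Cmod_mult, Rplus_comm, Rmult_plus_distr_r, exp_plus.
  apply Rmult_le_compat; [exact Hc|apply Cmod_ge_0| |apply Hf].
  apply Rle_trans with (exp (Cmod c)); [|apply exp_le_compat; nra].
  pose proof (exp_ineq1_le (Cmod c)). lra.
Qed.

Lemma exp_growth_shift c f : exp_growth f -> exp_growth (fun z => f (shift c z)).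
Proof.
  intros (B & m & HB & Hf). pose proof (norm1_ge_0 c) as Hc.
  exists (B * (1 + norm1 c) ^ m)%R, m; split; [apply Rmult_le_pos; [lra|apply pow_le; lra]|]. intros z.
  pose proof (norm1_ge_0 z) as Hn.
  eapply Rle_trans; [apply Hf|]. apply exp_le_compat.
  rewrite Rmult_assoc. apply Rmult_le_compat_l; [exact HB|].
  rewrite <- Rpow_mult_distr. apply pow_incr.
  assert (Hs : (norm1 (shift c z) <= norm1 z + norm1 c)%R).
  { unfold norm1, shift; simpl.
    pose proof (Cmod_triangle (fst z) (fst c)); pose proof (Cmod_triangle (snd z) (snd c)). lra. }
  pose proof (norm1_ge_0 (shift c z)). nra.
Qed.

(** Hadamard's theorem for nonvanishing functions: on each line the logarithm
    is entire with real part of polynomial growth. *)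
Theorem log_line_poly (u : C * C -> C) : cont2 u -> (forall z v w, cdiff (on_line u z v) w) ->
  exp_growth u -> (forall z, u z <> 0) ->
  exists P, line_poly P /\ forall z, Cexp (P z) = u z.
Proof.
  intros Hu Hd (B & m & HB & Hg) Hnz.
  destruct (continuous_log_exists u Hu Hnz) as (P & HP & EP).
  exists P; split; [|exact EP]. intros z v. apply polyf_polynomial1.
  assert (Hc : contC (on_line P z v)).
  { intros w. apply (continuous_comp_2 (fun w : C_UniformSpace => fst z + w * fst v : C_UniformSpace)
      (fun w : C_UniformSpace => snd z + w * snd v : C_UniformSpace) (fun a b => P (a, b))).
    1, 2: apply continuous_Cplus; [apply continuous_Cconst|]; apply continuous_Cmult; [apply continuous_id|apply continuous_Cconst].
    apply continuous_ext with P; [intros [? ?]; reflexivity|]. apply HP. }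
  pose proof (norm1_ge_0 z) as Hz. pose proof (norm1_ge_0 v) as Hv.
  apply (entire_polynomial _ (B * (1 + norm1 z + norm1 v) ^ m) m).
  - intros w. apply (cdiff_log (on_line u z v)); [apply Hd|apply Hc|]. intros y; apply EP.
  - apply Rmult_le_pos; [exact HB|apply pow_le; lra].
  - intros w.
    set (y := (fst z + w * fst v, snd z + w * snd v) : C * C).
    assert (H : (Re (P y) <= B * (1 + norm1 y) ^ m)%R).
    { assert (H := Hg y). rewrite <- EP, Cmod_Cexp in H.
      destruct (Rle_lt_dec (Re (P y)) (B * (1 + norm1 y) ^ m)) as [|Hl]; [assumption|].
      apply exp_increasing in Hl. lra. }
    change (on_line P z v w) with (P y).
    eapply Rle_trans; [exact H|].
    rewrite Rmult_assoc. apply Rmult_le_compat_l; [exact HB|].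
    rewrite <- Rpow_mult_distr. pose proof (norm1_ge_0 y). pose proof (Cmod_ge_0 w).
    apply pow_incr; split; [lra|].
    assert (Hy : (norm1 y <= norm1 z + Cmod w * norm1 v)%R).
    { unfold norm1, y; simpl.
      pose proof (Cmod_triangle (fst z) (w * fst v)); pose proof (Cmod_triangle (snd z) (w * snd v)).
      rewrite !Cmod_mult in *. lra. }
    nra.
Qed.

(** * Comparing exponents *)

Lemma Cmult_integral_l (a b : C) : a <> 0 -> a * b = 0 -> b = 0.
Proof.
  intros Ha H. replace b with (/ a * (a * b)) by (field; exact Ha). rewrite H; ring.
Qed.

Lemma two_neq_0 : RtoC 2 <> 0.
Proof. apply RtoC_neq0; lra. Qed.

(** Divide by [exp X]: Borel's lemma forbids the constant [b1] unless one of
    the remaining exponents is constant. *)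
Lemma six_exponentials (X Y Z : C * C -> C) (b1 b2 b3 b4 b5 b6 : C) :
  line_poly X -> line_poly Y -> line_poly Z -> ~ constant_fun X -> b1 <> 0 ->
  (forall z, b1 * Cexp (X z) + b2 * Cexp (- X z) + b3 * Cexp (Y z) + b4 * Cexp (- Y z)
             + b5 * Cexp (Z z) + b6 * Cexp (- Z z) = 0) ->
  (exists k, forall z, Y z = X z + k) \/ (exists k, forall z, Y z = - X z + k) \/
  (exists k, forall z, Z z = X z + k) \/ (exists k, forall z, Z z = - X z + k).
Proof.
  intros HX HY HZ Hn Hb E.
  apply NNPP; intros Hno; apply Hb.
  apply (borel_2 ((- b2, fun z => - (2) * X z) :: (- b3, fun z => Y z + - (1) * X z) ::
     (- b4, fun z => - (1) * Y z + - (1) * X z) :: (- b5, fun z => Z z + - (1) * X z) ::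
     (- b6, fun z => - (1) * Z z + - (1) * X z) :: nil)).
  - repeat apply List.Forall_cons; try apply List.Forall_nil; simpl;
    (split; [repeat first [assumption|apply line_poly_plus|apply line_poly_scal]|]); intros Hc; apply Hno.
    + exfalso; apply Hn; intros z. specialize (Hc z).
      replace (X z) with (- / 2 * (- (2) * X z)) by (field; apply two_neq_0). rewrite Hc. field; apply two_neq_0.
    + left. exists (Y (RtoC 0, RtoC 0) + - (1) * X (RtoC 0, RtoC 0)); intros z. rewrite <- (Hc z). ring.
    + right; left. exists (- (- (1) * Y (RtoC 0, RtoC 0) + - (1) * X (RtoC 0, RtoC 0))); intros z. rewrite <- (Hc z). ring.
    + right; right; left. exists (Z (RtoC 0, RtoC 0) + - (1) * X (RtoC 0, RtoC 0)); intros z. rewrite <- (Hc z). ring.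
    + right; right; right. exists (- (- (1) * Z (RtoC 0, RtoC 0) + - (1) * X (RtoC 0, RtoC 0))); intros z. rewrite <- (Hc z). ring.
  - intros z. specialize (E z). simpl.
    assert (Ex := Cexp_neq_0 (X z)). assert (Ey := Cexp_neq_0 (Y z)). assert (Ez := Cexp_neq_0 (Z z)).
    replace (- (2) * X z) with (- X z + - X z) by ring.
    replace (Y z + - (1) * X z) with (Y z + - X z) by ring.
    replace (- (1) * Y z + - (1) * X z) with (- Y z + - X z) by ring.
    replace (Z z + - (1) * X z) with (Z z + - X z) by ring.
    replace (- (1) * Z z + - (1) * X z) with (- Z z + - X z) by ring.
    rewrite !Cexp_plus.
    rewrite !Cexp_opp in *.
    set (ex := Cexp (X z)) in *. set (ey := Cexp (Y z)) in *. set (ez := Cexp (Z z)) in *.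
    transitivity (b1 - (b1 * ex + b2 * / ex + b3 * ey + b4 * / ey + b5 * ez + b6 * / ez) * / ex).
    + field; repeat split; assumption.
    + rewrite E; ring.
Qed.

Lemma opposite_exponentials (X : C * C -> C) (b1 b2 : C) : line_poly X -> ~ constant_fun X ->
  (forall z, b1 * Cexp (X z) + b2 * Cexp (- X z) = 0) -> b1 = 0 /\ b2 = 0.
Proof.
  intros HX Hn E.
  assert (H2 : b2 = 0).
  { apply (borel_2 ((- b1, fun z => 2 * X z) :: nil)).
    - repeat constructor; simpl; [now apply line_poly_scal|].
      intros Hc; apply Hn; intros z. specialize (Hc z).
      replace (X z) with (/ 2 * (2 * X z)) by (field; apply two_neq_0). rewrite Hc. field; apply two_neq_0.
    - intros z. specialize (E z). simpl.
      replace (2 * X z) with (X z + X z) by ring. rewrite Cexp_plus. rewrite Cexp_opp in E.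
      assert (Ex := Cexp_neq_0 (X z)). set (ex := Cexp (X z)) in *.
      transitivity (b2 - (b1 * ex + b2 * / ex) * ex); [field; exact Ex|rewrite E; ring]. }
  split; [|exact H2].
  specialize (E (RtoC 0, RtoC 0)). rewrite H2 in E.
  apply (Cmult_integral_l _ _ (Cexp_neq_0 (X (RtoC 0, RtoC 0)))).
  refine (eq_trans _ E). ring.
Qed.

(** * Shifts of line-polynomial functions *)

Lemma on_line_shift F c z w : on_line F z c (w + 1) = F (shift c (fst z + w * fst c, snd z + w * snd c)).
Proof. unfold on_line, shift; simpl; f_equal; f_equal; ring. Qed.

(** Two shifts by [c] give a period on each line in direction [c], so [F] is
    invariant under the shift and the equation reads [2 F = k]. *)
Lemma antiperiodic_const F c k : line_poly F -> (forall z, F (shift c z) = - F z + k) -> constant_fun F.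
Proof.
  intros HF H.
  assert (Hper : forall z, F (shift c z) = F z).
  { intros z.
    assert (Hp := polyf_periodic_const (on_line F z c) 2 ltac:(lia) (HF z c)).
    assert (Hstep : forall w, on_line F z c (w + 1) = - on_line F z c w + k)
      by (intros w; rewrite on_line_shift; apply H).
    assert (Hc : forall x, on_line F z c x = on_line F z c 0).
    { apply Hp. intros x. replace (x + RtoC (INR 2)) with (x + 1 + 1).
      - rewrite !Hstep; ring.
      - replace (INR 2) with (1 + 1)%R by (simpl; ring). rewrite RtoC_plus; ring. }
    transitivity (on_line F z c (0 + 1)); [|now rewrite Hc, on_line_0].
    rewrite on_line_shift, !Cmult_0_l, !Cplus_0_r. now rewrite <- surjective_pairing. }
  assert (Hv : forall z, F z = k / 2).
  { intros z. assert (E := H z). rewrite Hper in E.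
    replace (F z) with ((F z + F z) / 2) by (field; apply two_neq_0).
    rewrite E at 1. field; apply two_neq_0. }
  intros z; now rewrite !Hv.
Qed.

(** Along [c] the function is affine, so it is a linear form plus a function
    of [t = c_2 z_1 - c_1 z_2]. *)
Lemma shift_affine F (c : C * C) m : line_poly F -> c <> (RtoC 0, RtoC 0) ->
  (forall z, F (shift c z) = F z + m) ->
  exists (al1 al2 : C) (Phi : C -> C), polynomial1 Phi /\
    (forall z, F z = al1 * fst z + al2 * snd z + Phi (snd c * fst z - fst c * snd z)) /\
    al1 * fst c + al2 * snd c = m.
Proof.
  intros HF Hc H.
  assert (Haff : forall z w, on_line F z c w = F z + m * w).
  { intros z w.
    assert (Hp := polyf_periodic_const (fun x => on_line F z c x + - m * x) 1 ltac:(lia)).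
    assert (Hx : forall x, on_line F z c x + - m * x = on_line F z c 0 + - m * 0).
    { apply Hp.
      - apply polyf_plus; [apply HF|]. apply (polyf_scal (- m) (fun x => x)).
        exists 2%nat. apply pol_ext with (fun x => x ^ 1); [intros; simpl; ring|apply (pol_monomial 1)].
      - intros x. simpl INR. replace (on_line F z c (x + 1)) with (on_line F z c x + m)
          by (rewrite on_line_shift; symmetry; apply H). ring. }
    specialize (Hx w). rewrite on_line_0 in Hx.
    replace (on_line F z c w) with ((on_line F z c w + - m * w) + m * w) by ring. rewrite Hx; ring. }
  destruct (Ceq_dec (fst c) 0) as [H1|H1].
  - assert (H2 : snd c <> 0).
    { intros H2; apply Hc; rewrite (surjective_pairing c), H1, H2; reflexivity. }
    exists 0, (m / snd c), (fun t => F (t / snd c, RtoC 0)); split; [|split].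
    + apply polyf_polynomial1.
      apply polyf_ext with (on_line F (RtoC 0, RtoC 0) (/ snd c, RtoC 0)); [|apply HF].
      intros t; unfold on_line; simpl. f_equal; f_equal; unfold Cdiv; ring.
    + intros z. transitivity (on_line F ((snd c * fst z - fst c * snd z) / snd c, RtoC 0) c (snd z / snd c)).
      * unfold on_line; simpl. rewrite (surjective_pairing z) at 1. f_equal; f_equal; field; exact H2.
      * rewrite Haff. field; exact H2.
    + field; exact H2.
  - exists (m / fst c), 0, (fun t => F (RtoC 0, - t / fst c)); split; [|split].
    + apply polyf_polynomial1.
      apply polyf_ext with (on_line F (RtoC 0, RtoC 0) (RtoC 0, - / fst c)); [|apply HF].
      intros t; unfold on_line; simpl. f_equal; f_equal; unfold Cdiv; ring.
    + intros z. transitivity (on_line F (RtoC 0, - (snd c * fst z - fst c * snd z) / fst c) c (fst z / fst c)).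
      * unfold on_line; simpl. rewrite (surjective_pairing z) at 1. f_equal; f_equal; field; exact H1.
      * rewrite Haff. field; exact H1.
    + field; exact H1.
Qed.

(** * The system in exponential form *)

Section System.
Context (a1 a2 a3 : C) (c : C * C) (P1 P2 : C * C -> C).
Context (ha1 : a1 <> 0) (ha2 : a2 <> 0) (ha3 : a3 <> 0).
Context (HP1 : line_poly P1) (HP2 : line_poly P2).
Context (Hn1 : ~ constant_fun P1) (Hn2 : ~ constant_fun P2).

(** Twice the equation [a2 cosh Q(z+c) + a3 cosh Q(z) = - i a1 sinh P(z)]. *)
Definition exp_equation (P Q : C * C -> C) : Prop := forall z,
  a2 * (Cexp (Q (shift c z)) + Cexp (- Q (shift c z))) + a3 * (Cexp (Q z) + Cexp (- Q z))
  + Ci * a1 * (Cexp (P z) - Cexp (- P z)) = 0.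

(** Each of [P2 (z + c)], [P2] and [P1] must agree up to sign and a constant
    with another exponent; the sign is determined between [P2 (z + c)] and
    [P2], and [P1] cannot be left out. *)
Lemma exponents_related : exp_equation P1 P2 ->
  (exists m, forall z, P2 (shift c z) = P2 z + m) /\
  ((exists k, forall z, P1 z = P2 z + k) \/ (exists k, forall z, P1 z = - P2 z + k)).
Proof.
  intros E.
  set (Q := fun z => P2 (shift c z)).
  assert (HQ : line_poly Q) by now apply line_poly_shift.
  assert (Hanti : ~ exists k, forall z, Q z = - P2 z + k).
  { intros [k Hk]; apply Hn2. now apply (antiperiodic_const P2 c k). }
  assert (HnQ : ~ constant_fun Q).
  { intros Hc; apply Hn2; intros z.
    assert (Hall : forall y, P2 y = Q (RtoC 0, RtoC 0)).
    { intros y. rewrite <- (Hc (fst y - fst c, snd y - snd c)). unfold Q, shift; simpl.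
      rewrite (surjective_pairing y) at 1. f_equal; f_equal; ring. }
    now rewrite !Hall. }
  assert (Hia : Ci * a1 <> 0) by (apply Cmult_neq_0; [apply Ci_nz|exact ha1]).
  assert (RQ := six_exponentials Q P2 P1 a2 a2 a3 a3 (Ci * a1) (- (Ci * a1)) HQ HP2 HP1 HnQ ha2).
  assert (R2 := six_exponentials P2 Q P1 a3 a3 a2 a2 (Ci * a1) (- (Ci * a1)) HP2 HQ HP1 Hn2 ha3).
  assert (R1 := six_exponentials P1 P2 Q (Ci * a1) (- (Ci * a1)) a3 a3 a2 a2 HP1 HP2 HQ Hn1 Hia).
  specialize (RQ ltac:(intros z; rewrite <- (E z); unfold Q; ring)).
  specialize (R2 ltac:(intros z; rewrite <- (E z); unfold Q; ring)).
  specialize (R1 ltac:(intros z; rewrite <- (E z); unfold Q; ring)).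
  assert (Hshift : exists m, forall z, Q z = P2 z + m).
  { destruct RQ as [[k H]|[[k H]|RQ]].
    - exists (- k); intros z; rewrite H; ring.
    - exfalso; apply Hanti; exists k; intros z; rewrite H; ring.
    - destruct R2 as [H|[H|R2]]; [exact H|contradiction|].
      (* [P1] agrees up to sign with both [Q] and [P2] *)
      destruct RQ as [[k H]|[k H]], R2 as [[k' H']|[k' H']].
      + exists (k' - k); intros z. transitivity (P1 z - k); [rewrite H; ring|rewrite H'; ring].
      + exfalso; apply Hanti; exists (k' - k); intros z. transitivity (P1 z - k); [rewrite H; ring|rewrite H'; ring].
      + exfalso; apply Hanti; exists (k - k'); intros z. transitivity (k - P1 z); [rewrite H; ring|rewrite H'; ring].
      + exists (k - k'); intros z. transitivity (k - P1 z); [rewrite H; ring|rewrite H'; ring]. }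
  split; [exact Hshift|].
  destruct Hshift as [m Hm].
  destruct R1 as [[k H]|[[k H]|[[k H]|[k H]]]].
  - left; exists (- k); intros z; rewrite H; ring.
  - right; exists k; intros z; rewrite H; ring.
  - left; exists (m - k); intros z. transitivity (Q z - k); [rewrite H; ring|rewrite Hm; ring].
  - right; exists (k - m); intros z. transitivity (k - Q z); [rewrite H; ring|rewrite Hm; ring].
Qed.

(** All exponents are [+- P2] up to constants, so the coefficients of [exp P2]
    and [exp (- P2)] vanish separately in both equations. *)
Lemma same_sign_relations (m k : C) : exp_equation P1 P2 -> exp_equation P2 P1 ->
  (forall z, P2 (shift c z) = P2 z + m) -> (forall z, P1 z = P2 z + k) ->
  let e := Cexp m in let K := Cexp k in
  a2 * e + a3 = - (Ci * a1) * K /\ a2 / e + a3 = Ci * a1 / K /\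
  a2 * e + a3 = - (Ci * a1) / K.
Proof.
  intros E1 E2 Hm Hk e K.
  assert (He : e <> 0) by apply Cexp_neq_0. assert (HK : K <> 0) by apply Cexp_neq_0.
  destruct (opposite_exponentials P2 (a2 * e + a3 + Ci * a1 * K) (a2 / e + a3 - Ci * a1 / K)) as [A1 A2]; [assumption|assumption| |].
  { intros z. specialize (E1 z). rewrite Hm, Hk, !Cexp_opp, !Cexp_plus in E1. fold e K in E1.
    rewrite Cexp_opp. assert (Ez := Cexp_neq_0 (P2 z)).
    rewrite <- E1. field; repeat split; assumption. }
  destruct (opposite_exponentials P2 (K * (a2 * e + a3) + Ci * a1) ((a2 / e + a3) / K - Ci * a1)) as [A3 _]; [assumption|assumption| |].
  { intros z. specialize (E2 z). rewrite !(Hk (shift c z)), Hm, !Hk in E2.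
    rewrite !Cexp_opp, !Cexp_plus in E2. fold e K in E2.
    rewrite Cexp_opp. assert (Ez := Cexp_neq_0 (P2 z)).
    rewrite <- E2. field; repeat split; assumption. }
  repeat split.
  - replace (a2 * e + a3) with ((a2 * e + a3 + Ci * a1 * K) - Ci * a1 * K) by ring. rewrite A1; ring.
  - replace (a2 / e + a3) with ((a2 / e + a3 - Ci * a1 / K) + Ci * a1 / K) by ring. rewrite A2; ring.
  - replace (a2 * e + a3) with ((K * (a2 * e + a3) + Ci * a1) / K - Ci * a1 / K) by (field; exact HK).
    rewrite A3. field; exact HK.
Qed.

Lemma opposite_sign_relations (m k : C) : exp_equation P1 P2 -> exp_equation P2 P1 ->
  (forall z, P2 (shift c z) = P2 z + m) -> (forall z, P1 z = - P2 z + k) ->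
  let e := Cexp m in let K := Cexp k in
  a2 * e + a3 = Ci * a1 / K /\ a2 / e + a3 = - (Ci * a1) * K /\
  a2 * e + a3 = - (Ci * a1) * K.
Proof.
  intros E1 E2 Hm Hk e K.
  assert (He : e <> 0) by apply Cexp_neq_0. assert (HK : K <> 0) by apply Cexp_neq_0.
  destruct (opposite_exponentials P2 (a2 * e + a3 - Ci * a1 / K) (a2 / e + a3 + Ci * a1 * K)) as [A1 A2]; [assumption|assumption| |].
  { intros z. specialize (E1 z). rewrite Hm, Hk, !Cexp_opp, !Cexp_plus, !Cexp_opp in E1. fold e K in E1.
    rewrite Cexp_opp. assert (Ez := Cexp_neq_0 (P2 z)).
    rewrite <- E1. field; repeat split; assumption. }
  destruct (opposite_exponentials P2 ((a2 * e + a3) / K + Ci * a1) ((a2 / e + a3) * K - Ci * a1)) as [A3 _]; [assumption|assumption| |].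
  { intros z. specialize (E2 z). rewrite !(Hk (shift c z)), Hm, !Hk in E2.
    rewrite !Cexp_opp, !Cexp_plus, !Cexp_opp, !Cexp_plus in E2. fold e K in E2.
    rewrite Cexp_opp. assert (Ez := Cexp_neq_0 (P2 z)).
    rewrite <- E2. field; repeat split; assumption. }
  repeat split.
  - replace (a2 * e + a3) with ((a2 * e + a3 - Ci * a1 / K) + Ci * a1 / K) by ring. rewrite A1; ring.
  - replace (a2 / e + a3) with ((a2 / e + a3 + Ci * a1 * K) - Ci * a1 * K) by ring. rewrite A2; ring.
  - replace (a2 * e + a3) with (((a2 * e + a3) / K + Ci * a1) * K - Ci * a1 * K) by (field; exact HK).
    rewrite A3. ring.
Qed.

End System.

Lemma Ci2 : Ci * Ci = - (1).
Proof. apply C_ext; unfold Re, Im; simpl; ring. Qed.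

Lemma Csquare_1 (x : C) : x * x = 1 -> x = 1 \/ x = - (1).
Proof.
  intros H. destruct (Ceq_dec x 1) as [E|E]; [now left|right].
  apply Ceq_minus, (Cmult_integral_l (x - 1)); [now apply Cminus_eq_contra|].
  transitivity (x * x - 1); [ring|rewrite H; ring].
Qed.

Lemma same_sign_solution (a1 a2 a3 e K : C) : a1 <> 0 -> a2 <> 0 -> e <> 0 -> K <> 0 ->
  a2 * e + a3 = - (Ci * a1) * K -> a2 / e + a3 = Ci * a1 / K -> a2 * e + a3 = - (Ci * a1) / K ->
  a2 ^ 2 = a1 ^ 2 + a3 ^ 2 /\ K * K = 1 /\
  e * e = - ((a1 - Ci * a3 * K) / (a1 + Ci * a3 / K)).
Proof.
  intros ha1 ha2 he hK R1 R2 R3.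
  assert (HK : K * K = 1).
  { apply Ceq_minus, (Cmult_integral_l (Ci * a1)); [apply Cmult_neq_0; [apply Ci_nz|exact ha1]|].
    transitivity ((- (Ci * a1) / K - - (Ci * a1) * K) * K); [field; exact hK|].
    rewrite <- R1, <- R3. ring. }
  assert (HKi : / K = K) by (replace K with (K * K * / K) at 2 by (field; exact hK); rewrite HK; ring).
  unfold Cdiv in *. rewrite HKi in *.
  assert (S1 : a2 * e = - a3 - Ci * a1 * K).
  { transitivity ((a2 * e + a3) - a3); [ring|rewrite R1; ring]. }
  assert (S2 : a2 * / e = - a3 + Ci * a1 * K).
  { transitivity ((a2 * / e + a3) - a3); [ring|rewrite R2; ring]. }
  assert (Hsq : a2 * a2 = a1 * a1 + a3 * a3).
  { transitivity ((a2 * e) * (a2 * / e)); [field; exact he|]. rewrite S1, S2.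
    transitivity (a3 * a3 - (Ci * Ci) * (K * K) * (a1 * a1)); [ring|]. rewrite Ci2, HK; ring. }
  split; [|split; [exact HK|]].
  - simpl. rewrite !Cmult_1_r. exact Hsq.
  - assert (Hd : a1 + Ci * a3 * K <> 0).
    { intros Z. apply (Cmult_neq_0 a2 a2 ha2 ha2). rewrite Hsq.
      transitivity ((a1 + Ci * a3 * K) * (a1 - Ci * a3 * K) + (Ci * Ci * (K * K) + 1) * (a3 * a3)); [ring|].
      rewrite Z, Ci2, HK. ring. }
    assert (G : (e * e) * (a1 + Ci * a3 * K) = - (a1 - Ci * a3 * K)).
    { apply Ceq_minus, (Cmult_integral_l (a2 * / e)).
      { apply Cmult_neq_0; [exact ha2|]. intros Z. apply C1_nz. rewrite <- (Cinv_r e he), Z. ring. }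
      transitivity ((a2 * e) * (a1 + Ci * a3 * K) + (a2 * / e) * (a1 - Ci * a3 * K)); [field; exact he|].
      rewrite S1, S2.
      transitivity (- (2) * (Ci * Ci * (K * K) + 1) * a1 * a3); [ring|]. rewrite Ci2, HK; ring. }
    transitivity ((e * e) * (a1 + Ci * a3 * K) / (a1 + Ci * a3 * K)); [field; exact Hd|].
    rewrite G. unfold Cdiv; ring.
Qed.

Lemma opposite_sign_solution (a1 a2 a3 e K : C) : a1 <> 0 -> a2 <> 0 -> e <> 0 -> K <> 0 ->
  a2 * e + a3 = Ci * a1 / K -> a2 / e + a3 = - (Ci * a1) * K -> a2 * e + a3 = - (Ci * a1) * K ->
  (K = Ci \/ K = - Ci) /\
  (e = 1 /\ (a1 = a2 + a3 \/ a1 = - (a2 + a3)) \/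
   e = - (1) /\ (a1 = a2 - a3 \/ a1 = - (a2 - a3))).
Proof.
  intros ha1 ha2 he hK R1 R2 R3.
  assert (HK : K = Ci \/ K = - Ci).
  { destruct (Csquare_1 (- Ci * K)) as [H|H].
    - transitivity (Ci * Ci * (K * K)); [ring|]. rewrite Ci2.
      apply Ceq_minus, (Cmult_integral_l (Ci * a1)); [apply Cmult_neq_0; [apply Ci_nz|exact ha1]|].
      transitivity ((- (Ci * a1) * K - Ci * a1 / K) * K); [field; exact hK|]. rewrite <- R1, <- R3. ring.
    - left. transitivity (- (Ci * Ci) * K); [rewrite Ci2; ring|].
      transitivity (Ci * (- Ci * K)); [ring|]. rewrite H; ring.
    - right. transitivity (- (Ci * Ci) * K); [rewrite Ci2; ring|].
      transitivity (Ci * (- Ci * K)); [ring|]. rewrite H; ring. }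
  split; [exact HK|].
  assert (He : e * e = 1).
  { apply Ceq_minus, (Cmult_integral_l a2 _ ha2).
    transitivity (((a2 * e + a3) - (a2 / e + a3)) * e); [field; exact he|]. rewrite R2, R3; ring. }
  assert (Hs : a2 * e + a3 = a1 \/ a2 * e + a3 = - a1).
  { rewrite R3. destruct HK as [-> | ->]; [left|right].
    - transitivity (- (Ci * Ci) * a1); [ring|rewrite Ci2; ring].
    - transitivity ((Ci * Ci) * a1); [ring|rewrite Ci2; ring]. }
  destruct (Csquare_1 e He) as [-> | ->]; [left|right]; (split; [reflexivity|]).
  - destruct Hs as [H|H]; [left; rewrite <- H; ring|right].
    transitivity (- - a1); [ring|rewrite <- H; ring].
  - destruct Hs as [H|H]; [right; rewrite <- H; ring|left].
    transitivity (- - a1); [ring|rewrite <- H; ring].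
Qed.

(** * Parametrising the two equations *)

(** [X^2 + Y^2 = 1] is [(X + i Y) (X - i Y) = 1], so [X + i Y] has no zeros. *)
Lemma circle_parametrization (X Y : C) (u : C) : X ^ 2 + Y ^ 2 = 1 -> u = X + Ci * Y ->
  u <> 0 /\ X = (u + / u) / 2 /\ 2 * Y = - Ci * (u - / u).
Proof.
  intros H ->.
  assert (Hp : (X + Ci * Y) * (X - Ci * Y) = 1).
  { transitivity (X ^ 2 - (Ci * Ci) * Y ^ 2); [simpl; ring|]. rewrite Ci2. refine (eq_trans _ H); ring. }
  assert (Hn : X + Ci * Y <> 0).
  { intros Z; apply C1_nz. refine (eq_trans (eq_sym Hp) _). rewrite Z; ring. }
  assert (Hi : / (X + Ci * Y) = X - Ci * Y).
  { transitivity (/ (X + Ci * Y) * ((X + Ci * Y) * (X - Ci * Y))); [rewrite Hp; ring|field; exact Hn]. }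
  split; [exact Hn|]. rewrite Hi. split.
  - field.
  - transitivity (- (Ci * Ci) * (2 * Y)); [rewrite Ci2; ring|ring].
Qed.

Lemma log_of_solution (a1 a2 a3 : C) (c : C * C) (f g : C * C -> C) :
  entire f -> entire g -> finite_order f -> finite_order g ->
  (forall z, a1 ^ 2 * f z ^ 2 + (a2 * g (shift c z) + a3 * g z) ^ 2 = 1) ->
  exists P, line_poly P /\
    (forall z, a1 * f z = (Cexp (P z) + Cexp (- P z)) / 2) /\
    (forall z, 2 * (a2 * g (shift c z) + a3 * g z) = - Ci * (Cexp (P z) - Cexp (- P z))).
Proof.
  intros Hf Hg Hof Hog E.
  set (u := fun z => a1 * f z + Ci * (a2 * g (shift c z) + a3 * g z)).
  assert (Hcirc : forall z, u z <> 0 /\ a1 * f z = (u z + / u z) / 2 /\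
     2 * (a2 * g (shift c z) + a3 * g z) = - Ci * (u z - / u z)).
  { intros z; apply circle_parametrization; [|reflexivity]. rewrite <- (E z); simpl; ring. }
  destruct (log_line_poly u) as (P & HP & EP).
  - intros z. apply continuous_Cplus; [apply continuous_Cmult; [apply continuous_Cconst|now apply entire_cont2]|].
    apply continuous_Cmult; [apply continuous_Cconst|].
    apply continuous_Cplus; apply continuous_Cmult; try apply continuous_Cconst; [|now apply entire_cont2].
    apply (continuous_comp_2 (fun z : prod_UniformSpace C_UniformSpace C_UniformSpace => fst z + fst c : C_UniformSpace)
      (fun z : prod_UniformSpace C_UniformSpace C_UniformSpace => snd z + snd c : C_UniformSpace) (fun a b => g (a, b))).
    + apply continuous_Cplus; [apply continuous_fst|apply continuous_Cconst].
    + apply continuous_Cplus; [apply continuous_snd|apply continuous_Cconst].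
    + apply continuous_ext with g; [intros [? ?]; reflexivity|]. now apply entire_cont2.
  - intros z v w.
    assert (Hsh : cdiff (on_line (fun z => g (shift c z)) z v) w).
    { apply cdiff_ext with (on_line g (shift c z) v); [|now apply entire_on_line].
      intros y; unfold on_line, shift; simpl; f_equal; f_equal; ring. }
    apply (cdiff_ext (fun y => a1 * on_line f z v y + Ci * (a2 * on_line (fun z => g (shift c z)) z v y + a3 * on_line g z v y)));
      [reflexivity|].
    apply cdiff_plus; [apply cdiff_mult; [apply cdiff_const|now apply entire_on_line]|].
    apply cdiff_mult; [apply cdiff_const|].
    apply cdiff_plus; (apply cdiff_mult; [apply cdiff_const|]); [exact Hsh|now apply entire_on_line].
  - pose proof (finite_order_growth f Hf Hof); pose proof (finite_order_growth g Hg Hog).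
    apply exp_growth_plus; [now apply exp_growth_scal|]. apply exp_growth_scal.
    apply exp_growth_plus; apply exp_growth_scal; [now apply exp_growth_shift|assumption].
  - intros z; apply Hcirc.
  - exists P; split; [exact HP|split]; intros z; rewrite Cexp_opp, EP; apply Hcirc.
Qed.

Lemma const_polynomial2 (f : C * C -> C) k : (forall z, f z = k) -> polynomial2 f.
Proof.
  intros H. exists O, (fun _ _ => k); intros z1 z2. rewrite H, !sum_O. simpl; ring.
Qed.

Lemma exponent_nonconst (a1 : C) (f P : C * C -> C) : a1 <> 0 -> ~ polynomial2 f ->
  (forall z, a1 * f z = (Cexp (P z) + Cexp (- P z)) / 2) -> ~ constant_fun P.
Proof.
  intros Ha Hf E Hc. apply Hf.
  apply (const_polynomial2 f ((Cexp (P (RtoC 0, RtoC 0)) + Cexp (- P (RtoC 0, RtoC 0))) / 2 / a1)).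
  intros z. rewrite <- (Hc z), <- E. field; exact Ha.
Qed.

(** The cosine is even, so the sign of the exponent is immaterial. *)
Lemma Ccos_of_exp (a1 x P w : C) : a1 <> 0 -> a1 * x = (Cexp P + Cexp (- P)) / 2 ->
  Ci * w = P \/ Ci * w = - P -> x = 1 / a1 * Ccos w.
Proof.
  intros Ha E Hw.
  replace x with (a1 * x / a1) by (field; exact Ha). rewrite E. unfold Ccos.
  destruct Hw as [-> | ->].
  - field; exact Ha.
  - replace (- - P) with P by ring. field; exact Ha.
Qed.

Theorem theorem1p2 (a1 a2 a3 : C) (c : C * C) (f1 f2 : C * C -> C)
  (ha1 : a1 <> 0) (ha2 : a2 <> 0) (ha3 : a3 <> 0) (hc : c <> (RtoC 0, RtoC 0))
  (hf1 : transcendental_entire f1) (hf2 : transcendental_entire f2)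
  (ho1 : finite_order f1) (ho2 : finite_order f2)
  (heq1 : forall z : C * C,
     a1 ^ 2 * f1 z ^ 2 + (a2 * f2 (shift c z) + a3 * f2 z) ^ 2 = 1)
  (heq2 : forall z : C * C,
     a1 ^ 2 * f2 z ^ 2 + (a2 * f1 (shift c z) + a3 * f1 z) ^ 2 = 1) :
  exists (alpha1 alpha2 A k : C) (Phi : C -> C),
    polynomial1 Phi /\
    let L := fun z : C * C => alpha1 * fst z + alpha2 * snd z in
    let t := fun z : C * C => snd c * fst z - fst c * snd z in
    ( ((forall z : C * C,
          f1 z = 1 / a1 * Ccos (L z + Phi (t z) + A) /\
          f2 z = 1 / a1 * Ccos (L z + Phi (t z) + A + k)) /\
       a2 ^ 2 = a1 ^ 2 + a3 ^ 2 /\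
       Cexp (2 * Ci * k) = 1 /\
       Cexp (2 * Ci * L c) =
         - ((a1 - Ci * a3 * Cexp (- (Ci * k))) /
            (a1 + Ci * a3 * Cexp (Ci * k))))
      \/
      ((forall z : C * C,
          f1 z = 1 / a1 * Ccos (- (L z + Phi (t z) + A) + k) /\
          f2 z = 1 / a1 * Ccos (L z + Phi (t z) + A)) /\
       ((Cexp (Ci * L c) = 1 /\
         (Cexp (Ci * k) = Ci \/ Cexp (Ci * k) = - Ci) /\
         (a1 = a2 + a3 \/ a1 = - (a2 + a3)))
        \/
        (Cexp (Ci * L c) = - (1) /\
         (Cexp (Ci * k) = Ci \/ Cexp (Ci * k) = - Ci) /\
         (a1 = a2 - a3 \/ a1 = - (a2 - a3)))))
      \/
      ((forall z : C * C,
          f1 z = 1 / a1 * Ccos (- (L z + Phi (t z) + A) + L c + k) /\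
          f2 z = 1 / a1 * Ccos (L z + Phi (t z) + A)) /\
       ((Cexp (Ci * L c) = 1 /\
         (Cexp (Ci * k) = Ci \/ Cexp (Ci * k) = - Ci) /\
         (a1 = a2 + a3 \/ a1 = - (a2 + a3)))
        \/
        (Cexp (Ci * L c) = - (1) /\
         (Cexp (Ci * k) = Ci \/ Cexp (Ci * k) = - Ci) /\
         (a1 = a2 - a3 \/ a1 = - (a2 - a3))))) ).
Proof.
  destruct hf1 as [hf1 hn1], hf2 as [hf2 hn2].
  destruct (log_of_solution a1 a2 a3 c f1 f2 hf1 hf2 ho1 ho2 heq1) as (P1 & HP1 & F1 & G1).
  destruct (log_of_solution a1 a2 a3 c f2 f1 hf2 hf1 ho2 ho1 heq2) as (P2 & HP2 & F2 & G2).
  assert (Hn1 := exponent_nonconst a1 f1 P1 ha1 hn1 F1).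
  assert (Hn2 := exponent_nonconst a1 f2 P2 ha1 hn2 F2).
  assert (EQ : forall g P Q, (forall z, a1 * g z = (Cexp (Q z) + Cexp (- Q z)) / 2) ->
     (forall z, 2 * (a2 * g (shift c z) + a3 * g z) = - Ci * (Cexp (P z) - Cexp (- P z))) ->
     exp_equation a1 a2 a3 c P Q).
  { intros g P Q Fg G z. specialize (G z).
    transitivity (2 * a2 * (a1 * g (shift c z)) + 2 * a3 * (a1 * g z) + Ci * a1 * (Cexp (P z) - Cexp (- P z))).
    - rewrite !Fg. field.
    - transitivity (a1 * (2 * (a2 * g (shift c z) + a3 * g z)) + Ci * a1 * (Cexp (P z) - Cexp (- P z))); [ring|].
      rewrite G; ring. }
  assert (E1 := EQ f2 P1 P2 F2 G1). assert (E2 := EQ f1 P2 P1 F1 G2). clear EQ.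
  destruct (exponents_related a1 a2 a3 c P1 P2 ha1 ha2 ha3 HP1 HP2 Hn1 Hn2 E1) as [[m Hm] Hk].
  assert (He := Cexp_neq_0 m).
  destruct (shift_affine P2 c m HP2 hc Hm) as (al1 & al2 & Phi & HPhi & EP & Em).
  assert (Hi : forall x : C, Ci * (- Ci * x) = x).
  { intros x; transitivity (- (Ci * Ci) * x); [ring|rewrite Ci2; ring]. }
  assert (HPhi' : polynomial1 (fun t => - Ci * Phi t)).
  { apply polyf_polynomial1, polyf_scal, polyf_polynomial1, HPhi. }
  assert (HL : forall z, Ci * (- Ci * al1 * fst z + - Ci * al2 * snd z + - Ci * Phi (snd c * fst z - fst c * snd z)) = P2 z).
  { intros z. rewrite EP. rewrite <- (Hi (al1 * fst z + al2 * snd z + Phi (snd c * fst z - fst c * snd z))). ring. }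
  assert (HLc : Ci * (- Ci * al1 * fst c + - Ci * al2 * snd c) = m).
  { rewrite <- Em, <- (Hi (al1 * fst c + al2 * snd c)). ring. }
  (* Exponents are [i] times the arguments of the cosine. *)
  exists (- Ci * al1), (- Ci * al2).
  destruct Hk as [[k Hk]|[k Hk]].
  - assert (HK := Cexp_neq_0 k).
    destruct (same_sign_relations a1 a2 a3 c P1 P2 HP2 Hn2 m k E1 E2 Hm Hk) as (R1 & R2 & R3).
    destruct (same_sign_solution a1 a2 a3 (Cexp m) (Cexp k) ha1 ha2 He HK R1 R2 R3) as (S1 & S2 & S3).
    exists (- Ci * k), (Ci * k), (fun t => - Ci * Phi t); split; [exact HPhi'|]. left.
    replace (Ci * (Ci * k)) with (- k) by (transitivity ((Ci * Ci) * k); [rewrite Ci2; ring|ring]).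
    split; [|split; [exact S1|split]].
    + intros z; split.
      * apply (Ccos_of_exp a1 (f1 z) (P1 z)); [exact ha1|apply F1|]. left.
        rewrite Hk, <- (HL z). transitivity (Ci * (- Ci * al1 * fst z + - Ci * al2 * snd z + - Ci * Phi (snd c * fst z - fst c * snd z)) + Ci * (- Ci * k)); [ring|].
        now rewrite Hi.
      * apply (Ccos_of_exp a1 (f2 z) (P2 z)); [exact ha1|apply F2|]. left.
        rewrite <- (HL z). ring.
    + replace (2 * Ci * (Ci * k)) with (- (k + k)) by (transitivity (2 * (Ci * Ci) * k); [rewrite Ci2; ring|ring]).
      rewrite Cexp_opp, Cexp_plus, S2. field.
    + replace (2 * Ci * (- Ci * al1 * fst c + - Ci * al2 * snd c)) with (m + m) by (rewrite <- HLc; ring).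
      replace (- - k) with k by ring. rewrite Cexp_plus, S3, Cexp_opp. reflexivity.
  - assert (HK := Cexp_neq_0 k).
    destruct (opposite_sign_relations a1 a2 a3 c P1 P2 HP2 Hn2 m k E1 E2 Hm Hk) as (R1 & R2 & R3).
    destruct (opposite_sign_solution a1 a2 a3 (Cexp m) (Cexp k) ha1 ha2 He HK R1 R2 R3) as (S1 & S2).
    exists 0, (- Ci * k), (fun t => - Ci * Phi t); split; [exact HPhi'|]. right; left.
    rewrite HLc, Hi. split.
    + intros z; split.
      * apply (Ccos_of_exp a1 (f1 z) (P1 z)); [exact ha1|apply F1|]. left.
        rewrite Hk, <- (HL z). transitivity (- (Ci * (- Ci * al1 * fst z + - Ci * al2 * snd z + - Ci * Phi (snd c * fst z - fst c * snd z))) + Ci * (- Ci * k)); [ring|].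
        now rewrite Hi.
      * apply (Ccos_of_exp a1 (f2 z) (P2 z)); [exact ha1|apply F2|]. left.
        rewrite <- (HL z). ring.
    + destruct S2 as [[S2 S3]|[S2 S3]]; [left|right]; auto.
Qed.
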